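(* Let $X$ be a complex irreducible quasi-projective algebraic variety and let $\mathcal{E}=(E_1,\ldots,E_k)$ be an overdetermined collection of base-point free linear series on $X$ with essential subcollection $J\subset\{1,\ldots,k\}$. Then the consistency variety $R_{\mathcal E}$ does not depend on the $E_i$ with $i\notin J$; that is, $$R_{\mathcal E}=p^{-1}(R_{\mathcal{E}_J}),$$ where $\mathcal{E}_J=(E_i)_{i\in J}$ and $p:\prod_{i=1}^kE_i\to\prod_{i\in J}E_i$ is the natural projection.
   Context: Each $E_i$ is a finite-dimensional subspace of $H^0(X,\mathcal{L}_i)$ for a globally generated line bundle $\mathcal{L}_i$, base-point free (the sections in $E_i$ have no common zero on $X$). For a collection $\mathcal{F}=(F_1,\ldots,F_m)$ of linear series on $X$, the consistency variety $R_{\mathcal F}\subset\prod F_i$ is the Zariski closure of the set of $(s_1,\ldots,s_m)$ such that $s_1=\cdots=s_m=0$ has a root on $X$. The collection $\mathcal{E}$ is overdetermined if $s_1=\cdots=s_k=0$ has no root on $X$ for generic $(s_i)\in\prod E_i$ (i.e. for all systems outside a proper Zariski closed subset). For $J\subset\{1,\ldots,k\}$, $E_J=\prod_{j\in J}E_j\subset H^0(X,\bigotimes_{j\in J}\mathcal{L}_j)$ is the span of all products $\bigotimes_{j\in J}f_j$, $f_j\in E_j$. The Kodaira map $\Phi_J:X\to\mathbb{P}(E_J^* )$ sends $x$ to the hyperplane $\{g\in E_J:g(x)=0\}$; $\tau_J=\dim\Phi_J(X)$; $\mathrm{def}(J)=\tau_J-|J|$ (with $\mathrm{def}(\emptyset)=0$);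 $\mathrm{d}(\mathcal{E})=\min_{J\subset\{1,\ldots,k\}}\mathrm{def}(J)$. An essential subcollection is a subset $J$ with $\mathrm{def}(J)=\mathrm{d}(\mathcal{E})$ and $\mathrm{def}(I)>\mathrm{def}(J)$ for every proper subset $I\subsetneq J$; it exists and is unique. *)

(* Defs.v *)
(* Varieties are taken in the classical sense: sets of complex points with
   their Zariski topology, functions being regular when they are locally
   quotients of homogeneous polynomials of equal degree. *)
From mathcomp Require Import all_boot all_order all_algebra.
From mathcomp Require Import boolp classical_sets functions reals complex mpoly.

Set Implicit Arguments.
Unset Strict Implicit.
Unset Printing Implicit Defensive.

Import Order.TTheory GRing.Theory Num.Theory.

Local Open Scope classical_set_scope.
Local Open Scope ring_scope.

Section Topology.
(* A topology is given by the predicate [cl] of its closed sets. *)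
Context {T : Type} (cl : set T -> Prop).
Implicit Types A : set T.

Definition irreducible A : Prop :=
  A !=set0 /\
  forall Z1 Z2, cl Z1 -> cl Z2 -> A `<=` Z1 `|` Z2 -> A `<=` Z1 \/ A `<=` Z2.

Definition zclosure A : set T :=
  \bigcap_(Z in [set Z | cl Z /\ A `<=` Z]) Z.

(* Z 0 < ... < Z d, all irreducible and closed in the subspace A. *)
Definition irreducible_chain A (d : nat) (Z : nat -> set T) : Prop :=
  (forall i, (i <= d)%N ->
     irreducible (Z i) /\ exists2 K, cl K & Z i = A `&` K) /\
  (forall i, (i < d)%N -> Z i `<` Z i.+1).

(* Krull dimension; 0 by default when the lengths of chains are unbounded or
   there is no chain, which does not occur for the spaces considered here. *)
Definition krull_dim A : nat :=
  xget 0%N [set d | (exists Z, irreducible_chain A d Z) /\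
                    forall e Z, irreducible_chain A e Z -> (e <= d)%N].

End Topology.

Section LinearSpans.
Context {K : fieldType} {V : lmodType K}.
Implicit Types W : set V.

Definition lspan (S : set V) : set V :=
  [set g | exists m (a : 'I_m -> K) (b : 'I_m -> V),
             (forall l, S (b l)) /\ g = \sum_l a l *: b l].

Definition finite_dim_subspace W : Prop := exists b : seq V, W = lspan [set` b].

(* phi represents an element of the dual space of W; its values outside W are
   irrelevant. *)
Definition functional W (phi : V -> K) : Prop :=
  forall a u v, W u -> W v -> phi (a *: u + v) = a * phi u + phi v.

(* The points of P(W^* ) are the hyperplanes of W, the kernels of the nonzero
   functionals. *)
Definition hyperplane W (H : set V) : Prop :=
  exists phi, [/\ functional W phi, exists2 g, W g & phi g != 0
                & H = W `&` [set g | phi g = 0]].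

(* A homogeneous polynomial function on W^* is phi |-> p (phi g_1, ..., phi g_m)
   with p homogeneous and the g_l in W; it vanishes at H when it vanishes at
   every phi with kernel H (all of them proportional). *)
Definition dual_vanish W (m : nat) (p : {mpoly K[m]}) (g : 'I_m -> V)
    (H : set V) : Prop :=
  forall phi, functional W phi -> H = W `&` [set u | phi u = 0] ->
    p.@[fun l => phi (g l)] = 0.

Definition dual_zclosed W (Z : set (set V)) : Prop :=
  exists S : set {m : nat & ({mpoly K[m]} * ('I_m -> V))%type},
    (forall f, S f -> (exists d, (tagged f).1 \is d.-homog) /\
                      forall l, W ((tagged f).2 l)) /\
    Z = [set H | hyperplane W H /\
         forall f, S f -> dual_vanish W (tagged f).1 (tagged f).2 H].

End LinearSpans.

Section ProjectiveSpace.
Context {R : realType} {n : nat}.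
Local Notation C := R[i].

Definition projective_space := {x : {vspace 'rV[C]_n.+1} | \dim x == 1%N}.
Local Notation P := projective_space.

Definition coord_eval (p : {mpoly C[n.+1]}) (v : 'rV[C]_n.+1) : C :=
  p.@[fun i => v 0 i].

Definition zclosed (Z : set P) : Prop :=
  exists S : set {mpoly C[n.+1]},
    (forall p, S p -> exists d, p \is d.-homog) /\
    Z = [set x : P | forall p, S p -> forall v, v \in val x -> coord_eval p v = 0].

Definition zopen_in (X U : set P) : Prop :=
  exists2 Z, zclosed Z & U = X `\` Z.

Definition quasi_projective (X : set P) : Prop :=
  exists Z1 Z2, [/\ zclosed Z1, zclosed Z2 & X = Z1 `\` Z2].

Definition regular_on (U : set P) (f : P -> C) : Prop :=
  forall x, U x -> exists d (p q : {mpoly C[n.+1]}) (Z : set P),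
    [/\ p \is d.-homog, q \is d.-homog, zclosed Z, ~ Z x
      & forall y, U y -> ~ Z y -> forall v, v \in val y -> v != 0 ->
          coord_eval q v != 0 /\ f y = coord_eval p v / coord_eval q v].

Lemma coord_evalZ d p c v :
  p \is d.-homog -> coord_eval p (c *: v) = c ^+ d * coord_eval p v.
Proof.
move=> /dhomogP hp; rewrite /coord_eval !mevalE mulr_sumr.
apply: eq_big_seq => m /hp hm; rewrite mulrCA; congr (_ * _).
rewrite -hm /= mdegE -prodrXr -big_split /=.
by apply: eq_bigr => i _; rewrite mxE exprMn.
Qed.

Lemma coord_evalM p q v : coord_eval (p * q) v = coord_eval p v * coord_eval q v.
Proof. exact: mevalM. Qed.

Lemma line_colinear (x : P) v w :
  v \in val x -> v != 0 -> w \in val x -> exists c, w = c *: v.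
Proof.
move=> vx v0 wx; have /eqP xE : (<[v]> == val x)%VS.
  by rewrite eqEdim -memvE vx dim_vline v0 (eqP (valP x)).
by move: wx; rewrite -xE => /vlineP.
Qed.

Lemma line_neq0 (x : P) : exists2 v, v \in val x & v != 0.
Proof.
exists (vpick (val x)); first exact: memv_pick.
by rewrite vpick0 -dimv_eq0 (eqP (valP x)).
Qed.

Lemma zclosed0 : zclosed set0.
Proof.
exists [set 1]; split; first by move=> p ->; exists 0; exact: dhomog1.
apply/esym; rewrite -subset0 => x /(_ 1 erefl) h.
have := h 0 (mem0v _); rewrite /coord_eval meval1 => /eqP.
by rewrite oner_eq0.
Qed.

Lemma zclosedU Z1 Z2 : zclosed Z1 -> zclosed Z2 -> zclosed (Z1 `|` Z2).
Proof.
move=> [S1 [h1 ->]] [S2 [h2 ->]].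
exists [set r | exists p q, [/\ S1 p, S2 q & r = p * q]]; split.
  move=> _ [p [q [/h1[d hd] /h2[e he] ->]]].
  by exists (d + e)%N; exact: dhomogM.
apply/seteqP; split=> x /=.
  move=> [] h _ [p [q [Sp Sq ->]]] v vx; rewrite coord_evalM.
    by rewrite h // mul0r.
  by rewrite (h q) // mulr0.
move=> h; have [v vx v0] := line_neq0 x.
have vE d (p : {mpoly C[n.+1]}) w : p \is d.-homog -> w \in val x ->
    coord_eval p v = 0 -> coord_eval p w = 0.
  move=> hp wx pv; have [c ->] := line_colinear vx v0 wx.
  by rewrite (coord_evalZ _ _ hp) pv mulr0.
have [h1x|/existsNP[p /not_implyP[Sp pv]]] :=
  pselect (forall p, S1 p -> coord_eval p v = 0).
  left=> p Sp w wx; have [d hd] := h1 _ Sp; exact: (vE d p w hd wx (h1x _ Sp)).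
right=> q Sq w wx; have [d hd] := h2 _ Sq; apply: (vE d q w hd wx).
have := h _ (ex_intro _ p (ex_intro _ q (And3 Sp Sq erefl))) v vx.
by rewrite coord_evalM => /eqP; rewrite mulf_eq0 => /orP[/eqP|/eqP].
Qed.

Lemma zopen_inI X U V : zopen_in X U -> zopen_in X V -> zopen_in X (U `&` V).
Proof.
move=> [Z hZ ->] [Z' hZ' ->]; exists (Z `|` Z'); first exact: zclosedU.
by rewrite setDUr.
Qed.

Lemma zopen_in_bigcap X (I : finType) (U : I -> set P) :
  (forall i, zopen_in X (U i)) -> zopen_in X (X `&` \bigcap_i U i).
Proof.
move=> hU; rewrite (_ : setT = [set` enum I]); last first.
  by apply/seteqP; split=> i //= _; rewrite mem_enum.
rewrite bigcap_seq; elim: (enum I) => [|i s IHs].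
  by exists set0; [exact: zclosed0|rewrite big_nil setIT setD0].
by rewrite big_cons setICA; exact: zopen_inI.
Qed.

Lemma regular_onS U V f : U `<=` V -> regular_on V f -> regular_on U f.
Proof.
move=> UV hf x /UV /hf [d [p [q [Z [hp hq hZ Zx h]]]]].
by exists d, p, q, Z; split=> // y /UV; exact: h.
Qed.

Lemma eq_regular_on U f g :
  (forall x, U x -> f x = g x) -> regular_on U f -> regular_on U g.
Proof.
move=> fg hf x /hf [d [p [q [Z [hp hq hZ Zx h]]]]].
by exists d, p, q, Z; split=> // y Uy; rewrite -fg //; exact: h.
Qed.

Lemma regular_on1 U : regular_on U (fun=> 1).
Proof.
move=> x _; exists 0, 1, 1, set0; split=> //; try exact: dhomog1.
  exact: zclosed0.
by move=> y _ _ v _ _; rewrite /coord_eval meval1 divr1 oner_eq0.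
Qed.

Lemma regular_onM U f g :
  regular_on U f -> regular_on U g -> regular_on U (fun x => f x * g x).
Proof.
move=> hf hg x Ux; have [d [p [q [Z [hp hq hZ Zx h]]]]] := hf _ Ux.
have [d' [p' [q' [Z' [hp' hq' hZ' Zx' h']]]]] := hg _ Ux.
exists (d + d')%N, (p * p'), (q * q'), (Z `|` Z').
split; try exact: dhomogM; try exact: zclosedU; first by case.
move=> y Uy /not_orP[nZ nZ'] v vy v0.
have [q0 ->] := h _ Uy nZ _ vy v0; have [q0' ->] := h' _ Uy nZ' _ vy v0.
by rewrite !coord_evalM mulf_neq0 // mulf_div.
Qed.

Lemma regular_on_prod U (I : finType) (f : I -> P -> C) :
  (forall i, regular_on U (f i)) -> regular_on U (fun x => \prod_i f i x).
Proof.
move=> hf; elim: (index_enum I) => [|i s IHs].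
  by apply: eq_regular_on (@regular_on1 U) => x _; rewrite big_nil.
by apply: eq_regular_on (regular_onM (hf i) IHs) => x _; rewrite big_cons.
Qed.

(* A line bundle given by a trivializing open cover and the transition
   functions of the trivializations. The transition functions are invertible
   since lb_trans a b * lb_trans b a = lb_trans a a = 1. *)
Record line_bundle (X : set P) := LineBundle {
  lb_index : Type;
  lb_open : lb_index -> set P;
  lb_trans : lb_index -> lb_index -> P -> C;
  lb_openP : forall a, zopen_in X (lb_open a);
  lb_cover : X `<=` \bigcup_a lb_open a;
  lb_regular : forall a b,
    regular_on (lb_open a `&` lb_open b) (lb_trans a b);
  lb_trans1 : forall a x, lb_open a x -> lb_trans a a x = 1;
  lb_cocycle : forall a b c x, lb_open a x -> lb_open b x -> lb_open c x ->
    lb_trans a b x * lb_trans b c x = lb_trans a c x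
}.

Context {X : set P}.

(* A section is the family of its expressions in the trivializations. *)
Definition section (L : line_bundle X) : Type := lb_index L -> P -> C^o.

(* H^0(X, L). The expression s a is extended by 0 outside lb_open a, so that
   equality of sections is equality of functions. *)
Definition global_section (L : line_bundle X) : set (section L) :=
  [set s | [/\ forall a, regular_on (lb_open a) (s a),
               forall a b x, lb_open a x -> lb_open b x ->
                 s a x = lb_trans a b x * s b x
             & forall a x, ~ lb_open a x -> s a x = 0]].

Definition vanish_at (L : line_bundle X) (s : section L) (x : P) : Prop :=
  forall a, lb_open a x -> s a x = 0.

Definition globally_generated (L : line_bundle X) : Prop :=
  forall x, X x -> exists2 s, global_section s & ~ @vanish_at L s x.

Record linear_series := LinearSeries {
  ls_bundle : line_bundle X;
  ls_sections : set (section ls_bundle);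
  ls_globally_generated : globally_generated ls_bundle;
  ls_global : ls_sections `<=` @global_section ls_bundle;
  ls_finite_dim : finite_dim_subspace ls_sections
}.

Arguments ls_sections : clear implicits.

Definition base_point_free (E : linear_series) : Prop :=
  forall x, X x -> exists2 s, ls_sections E s & ~ vanish_at s x.

End ProjectiveSpace.

Arguments projective_space R n : clear implicits.
Arguments linear_series {R n} X.
Arguments ls_sections {R n X} _ _.

Section Collections.
Context {R : realType} {n : nat} {X : set (projective_space R n)}.
Local Notation C := R[i].
Local Notation P := (projective_space R n).

(* The tensor product is trivialized on the intersections of the trivializing
   opens of the factors; it is the trivial bundle when I is empty. *)
Section Tensor.
Context {I : finType} (L : I -> line_bundle X).

Definition tensor_index : Type := forall i, lb_index (L i).

Definition tensor_open (a : tensor_index) : set P :=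
  X `&` \bigcap_i lb_open (a i).

Definition tensor_trans (a b : tensor_index) (x : P) : C :=
  \prod_i lb_trans (a i) (b i) x.

Lemma tensor_openP a : zopen_in X (tensor_open a).
Proof. by apply: zopen_in_bigcap => i; exact: lb_openP. Qed.

Lemma tensor_cover : X `<=` \bigcup_a tensor_open a.
Proof.
move=> x Xx; have h i : exists a, lb_open (l := L i) a x.
  by have [a _ ax] := @lb_cover _ _ _ (L i) _ Xx; exists a.
by exists (fun i => projT1 (cid (h i))) => //; split=> // i _; case: cid.
Qed.

Lemma tensor_regular a b :
  regular_on (tensor_open a `&` tensor_open b) (tensor_trans a b).
Proof.
apply: regular_on_prod => i; apply: regular_onS (@lb_regular _ _ _ _ _ _).
by move=> x [[_ ax] [_ bx]]; split; [exact: ax|exact: bx].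
Qed.

Lemma tensor_trans1 a x : tensor_open a x -> tensor_trans a a x = 1.
Proof.
by move=> [_ ax]; apply: big1 => i _; apply: lb_trans1; exact: ax.
Qed.

Lemma tensor_cocycle a b c x :
  tensor_open a x -> tensor_open b x -> tensor_open c x ->
  tensor_trans a b x * tensor_trans b c x = tensor_trans a c x.
Proof.
move=> [_ ax] [_ bx] [_ cx]; rewrite -big_split; apply: eq_bigr => i _ /=.
by apply: lb_cocycle; [exact: ax|exact: bx|exact: cx].
Qed.

Definition tensor : line_bundle X :=
  LineBundle tensor_openP tensor_cover tensor_regular tensor_trans1
    tensor_cocycle.

Definition tensor_section (f : forall i, section (L i)) : section tensor :=
  fun a x => if `[< tensor_open a x >] then \prod_i f i (a i) x else 0.

Lemma tensor_section_global (f : forall i, section (L i)) :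
  (forall i, global_section (f i)) -> global_section (tensor_section f).
Proof.
move=> hf; split=> [a|a b x ax bx|a x ax]; rewrite /tensor_section.
- apply: (@eq_regular_on _ _ _ (fun x => \prod_i f i (a i) x)) => [x /asboolP->//|].
  apply: regular_on_prod => i; have [h _ _] := hf i.
  by apply: regular_onS (h (a i)) => x [_ /(_ i)]; exact.
- rewrite !asboolT //= -big_split; apply: eq_bigr => i _ /=.
  have [_ h _] := hf i; case: ax bx => [_ ax] [_ bx].
  by apply: h; [exact: ax|exact: bx].
- by rewrite asboolF.
Qed.

End Tensor.

Section Systems.
Context {I : finType} (E : I -> linear_series X).

Definition system : Type := forall i, section (ls_bundle (E i)).

Definition systems : set system := [set s | forall i, ls_sections (E i) (s i)].

Definition has_root (s : system) : Prop :=
  exists2 x, X x & forall i, vanish_at (s i) x.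

(* A polynomial in finitely many linear coordinates of the factors E i. *)
Definition polynomial_function (f : system -> C) : Prop :=
  exists m (p : {mpoly C[m]}) (i : 'I_m -> I)
         (phi : forall l, section (ls_bundle (E (i l))) -> C),
    (forall l, functional (ls_sections (E (i l))) (phi l)) /\
    forall s, systems s -> f s = p.@[fun l => phi l (s (i l))].

Definition systems_zclosed (Z : set system) : Prop :=
  exists S : set (system -> C),
    S `<=` polynomial_function /\
    Z = systems `&` [set s | forall f, S f -> f s = 0].

Definition consistency_variety : set system :=
  zclosure systems_zclosed (systems `&` has_root).

Definition overdetermined : Prop :=
  exists Z, [/\ systems_zclosed Z, Z `<` systems
              & forall s, systems s -> ~ Z s -> ~ has_root s].

(* The product of all the linear series, as a subspace of the sections of the
   tensor product of their bundles. *)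
Definition product_series : set (section (tensor (fun i => ls_bundle (E i)))) :=
  lspan (@tensor_section I _ @` systems).

Definition kodaira (x : P) :
    set (section (tensor (fun i => ls_bundle (E i)))) :=
  product_series `&` [set g | vanish_at g x].

Definition kodaira_dim : nat :=
  krull_dim (dual_zclosed product_series) (kodaira @` X).

End Systems.

Section Defect.
Context {I : finType} (E : I -> linear_series X).
Implicit Types J : {set I}.

Definition subcollection J (i : {i | i \in J}) : linear_series X := E (val i).
Arguments subcollection : clear implicits.

Definition subsystem J (s : system E) : system (subcollection J) :=
  fun i => s (val i).

Definition defect J : int :=
  if J == finset.set0 then 0
  else (kodaira_dim (subcollection J))%:Z - #|J|%:Z.

Definition min_defect : int :=
  \big[Order.min/defect finset.set0]_(J : {set I}) defect J.

Definition essential J : Prop :=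
  defect J = min_defect /\
  forall J' : {set I}, J' \proper J -> defect J < defect J'.

End Defect.

End Collections.

Arguments subcollection {R n X I} E J i.
Arguments subsystem {R n X I E} J s i.
Arguments systems {R n X I} E _.
Arguments consistency_variety {R n X I} E _.
Arguments overdetermined {R n X I} E.

(* Main.v *)
Require Import Defs.
From HB Require Import structures.
From mathcomp Require Import all_boot all_order all_algebra.
From mathcomp Require Import boolp classical_sets functions filter reals complex.
From mathcomp Require Import mpoly zify ring.

Set Implicit Arguments.
Unset Strict Implicit.
Unset Printing Implicit Defensive.

Import Order.TTheory GRing.Theory Num.Theory.

Local Open Scope classical_set_scope.
Local Open Scope ring_scope.

(** If a system has a root, so does its part indexed by J; this gives one
    inclusion. For the other one, let f be a polynomial function that vanishes
    on all solvable systems, and let w be a system whose part indexed by J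
    vanishes at a point x0 of X. It must be shown that f w = 0
    ([vanish_beyond_essential]).

    Let D be an affine open neighbourhood of x0 on which some e_i in E_i has no
    zero, for every i, and let K be an extension of the function field of D. The
    quotients s / e_i, for s in E_i, are elements of K; let Q_I be the set of
    those with i in I. The dimension of the image of the Kodaira map of the
    subcollection I is the transcendence degree of C(Q_I) over C
    ([kodaira_dim_basis]). Since J has the least defect, the transcendence degree of C(Q_J)(Q_I) over C(Q_J) is
    at least the cardinal of I, for every I disjoint from J
    ([hall_of_defect]). This is the condition of Hall and Rado: choosing the w_i,
    i not in J, one after the other and each of them outside finitely many
    proper subspaces of E_i, one obtains quotients w_i / e_i that are
    algebraically independent over C(Q_J) ([hall_adjoin]).

    For such a w, and for every y in D, the system with components
    w_i - (w_i / e_i)(y) e_i vanishes at y. Hence the polynomial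
    q(t) = f (w - t e) vanishes at the point of K with coordinates w_i / e_i. By
    independence it still vanishes there when the coordinates with i not in J
    are replaced by 0; at x0 the coordinates with i in J are 0 as well, and
    f w = q(0) = 0 ([vanish_of_independent]). All other w are reached along lines,
    on which f is a polynomial in one variable ([generic_vanish]).

    It remains to compare the Krull dimension of the image of the Kodaira map,
    which is in general not closed, with a transcendence degree. An extension of
    the function field of an irreducible set of points is obtained as an
    ultrapower along an ultrafilter on that set ([generic_field]). An
    irreducible closed set strictly larger than another one has a strictly larger transcendence degree ([prime_chain_rank]); this
    bounds the length of chains. Chains of the right length come from points:
    let f_1, ..., f_d be algebraically independent functions on X. By the
    extension of specializations (Chevalley), some fibre f_1 = a contains enough
    points for f_2, ..., f_d to be independent on an irreducible closed
    subset of it; iterating this yields a chain in X ([specialization_chain]).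
    Its images are distinct, since the f_i may be taken among the coordinates of
    the Kodaira map. *)

(** * Generic points from ultrafilters *)

Section ResidueField.
Variables (A : comNzRingType) (M : set A).
Hypotheses (M0 : M 0) (MD : forall x y, M x -> M y -> M (x + y))
  (MM : forall a x, M x -> M (a * x)) (M1 : ~ M 1)
  (Mmax : forall x, ~ M x -> exists y, M (y * x - 1)).

Definition residue_pred : pred A := fun x => `[< M x >].

Fact residue_zmod : zmod_closed residue_pred.
Proof.
split=> [|x y /asboolP Mx /asboolP My]; apply/asboolP => //.
by apply: MD => //; rewrite -mulN1r; apply: MM.
Qed.

Fact residue_nontrivial : 1 \notin residue_pred.
Proof. by apply/asboolP. Qed.

Fact residue_absorb a : {in residue_pred, forall x, a * x \in residue_pred}.
Proof. by move=> x /asboolP Mx; apply/asboolP; apply: MM. Qed.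

Let J : idealr A := HB.pack residue_pred
  (GRing.isZmodClosed.Build A residue_pred residue_zmod)
  (isProperIdeal.Build A residue_pred (conj residue_nontrivial residue_absorb)).
Let Q : comNzRingType := {ideal_quot J}.
Let pr (x : A) : Q := \pi_({ideal_quot J})%qT x.

Let prE x y : (pr x = pr y) <-> M (x - y).
Proof.
split=> [/eqP|Mxy]; rewrite /pr.
  by rewrite -Quotient.idealrBE => /asboolP.
by apply/eqP; rewrite -Quotient.idealrBE; apply/asboolP.
Qed.

Let pr_zmod : zmod_morphism pr.
Proof. by move=> x y; rewrite /pr !raddfB. Qed.

Let pr_monoid : monoid_morphism pr.
Proof. by split=> [|x y]; rewrite /pr ?rmorph1 ?rmorphM. Qed.

Let inv_ex (x : Q) : exists y : Q, (x != 0 -> y * x = 1) /\ (x = 0 -> y = 0).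
Proof.
have [->|x0] := eqVneq x 0; first by exists 0.
have [|y My] := @Mmax (repr x).
  move=> Mx; case/negP: x0; apply/eqP.
  have := (prE (repr x) 0).2; rewrite subr0 => /(_ Mx).
  by rewrite /pr reprK => ->; rewrite raddf0.
exists (pr y); split=> [_|x00]; last by rewrite x00 eqxx in x0.
have /prE := My; rewrite pr_monoid.2 pr_monoid.1 => <-.
by rewrite /pr reprK.
Qed.

(** Maximality is given by inverses modulo M: for functions modulo an
    ultrafilter these are the pointwise inverses. *)
Lemma residue_field :
  exists (K : fieldType) (p : {rmorphism A -> K}), forall x, p x = 0 <-> M x.
Proof.
have mulVf (x : Q) : x != 0 -> sval (cid (inv_ex x)) * x = 1.
  by case: cid => y [].
have invr0 : sval (cid (inv_ex 0)) = 0 by case: cid => y [] /= _ ->.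
pose K : fieldType := HB.pack Q (GRing.ComNzRing_isField.Build Q mulVf invr0).
pose ad := GRing.isZmodMorphism.Build A K pr pr_zmod.
pose mu := GRing.isMonoidMorphism.Build A K pr pr_monoid.
pose p : {rmorphism A -> K} := HB.pack (pr : A -> K) ad mu.
exists K, p => x; have := prE x 0; rewrite subr0 => <- /=.
by rewrite /pr raddf0.
Qed.
End ResidueField.

(** The value of functions at a generic point. It is defined for all functions,
    regular or not: a quotient of sections has a value in K without being
    written as a fraction of polynomials. *)
Record evaluation (T : Type) (F K : fieldType) := Evaluation {
  ev_cst : {rmorphism F -> K};
  ev_fun :> (T -> F) -> K;
  ev_c : forall c, ev_fun (fun=> c) = ev_cst c;
  evD : forall f g, ev_fun (fun x => f x + g x) = ev_fun f + ev_fun g;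
  evM : forall f g, ev_fun (fun x => f x * g x) = ev_fun f * ev_fun g }.

Section GenericPoint.
Variables (T : Type) (t0 : T) (F : fieldType) (D : set T) (S : set (T -> F)).
Hypotheses (S1 : S (fun=> 1))
  (SM : forall f g, S f -> S g -> S (fun x => f x * g x))
  (D0 : D !=set0)
  (Dprime : forall f g, S f -> S g -> (forall x, D x -> f x * g x = 0) ->
     (forall x, D x -> f x = 0) \/ (forall x, D x -> g x = 0)).

(** The functions on T form a nonzero ring because T has the point x0. *)
Definition pointed_copy (x0 : T) : Type := T.
HB.instance Definition _ x0 := gen_eqMixin (pointed_copy x0).
HB.instance Definition _ x0 := gen_choiceMixin (pointed_copy x0).
HB.instance Definition _ x0 := isPointed.Build (pointed_copy x0) x0.

Let TT : pointedType := pointed_copy t0.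

Definition generic_filter : set_system T :=
  [set B | exists f, [/\ S f, exists2 x, D x & f x != 0 &
                         forall x, D x -> f x != 0 -> B x]].

(** The irreducibility of D with respect to S says exactly that the nonzero loci
    of the functions of S have the finite intersection property. *)
Lemma generic_filter_proper : ProperFilter generic_filter.
Proof.
apply: Build_ProperFilter_ex => [B [f [_ [x Dx fx] fB]]|].
  by exists x; exact: fB.
split=> [|P Q [f [Sf [x Dx fx] fP]] [g [Sg [y Dy gy] gQ]]|P Q PQ [f [Sf Df fP]]].
- case: D0 => x Dx; exists (fun=> 1); split=> //.
  by exists x => //; exact: oner_neq0.
- exists (fun x => f x * g x); split; first exact: SM.
    apply: contrapT => nfg.
    have [|f0|g0] := Dprime Sf Sg.
    + move=> z Dz; apply/eqP; apply: contrapT => /negP fgz.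
      by apply: nfg; exists z.
    + by rewrite f0 ?eqxx in fx.
    + by rewrite g0 ?eqxx in gy.
  move=> z Dz; rewrite mulf_eq0 negb_or => /andP[fz gz].
  by split; [exact: fP | exact: gQ].
- by exists f; split=> // x Dx fx; apply: PQ; exact: fP.
Qed.

(** K is the ultrapower of F along an ultrafilter that contains D and the nonzero
    locus of every function of S that is not zero on D. *)
Lemma generic_field :
  exists (K : fieldType) (ev : evaluation T F K),
    (forall f, (forall x, D x -> f x = 0) -> ev f = 0) /\
    (forall f, S f -> ev f = 0 -> forall x, D x -> f x = 0).
Proof.
have [G [GU FG]] := ultraFilterLemma generic_filter_proper.
have GF := @ultra_proper _ _ GU.
have GD : G D.
  apply: FG; case: D0 => x Dx; exists (fun=> 1); split=> //.
  by exists x => //; exact: oner_neq0.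
pose A : comNzRingType := (TT -> F).
pose M : set A := [set f | G [set x | f x = 0]].
have Gn (B : set T) : ~ G B -> G (~` B).
  by move=> nB; have [//|] := in_ultra_setVsetC B GU.
have [|||||K [p pM]] := @residue_field A M.
- by rewrite /M /=; apply: filterS (@filterT _ G _).
- move=> f g Mf Mg; rewrite /M /=; apply: filterS (filterI Mf Mg) => x [/= f0 g0].
  by change (f x + g x = 0); rewrite f0 g0 addr0.
- move=> f g Mg; rewrite /M /=; apply: filterS Mg => x /= g0.
  by change (f x * g x = 0); rewrite g0 mulr0.
- rewrite /M /= => M1; apply: (@filter_not_empty T G _).
  by apply: filterS M1 => x /= /eqP; rewrite oner_eq0.
- move=> f nf; exists (fun x => (f x)^-1); rewrite /M /=.
  apply: filterS (Gn _ nf) => x /= /eqP fx.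
  by change ((f x)^-1 * f x - 1 = 0); rewrite mulVf ?subrr.
pose cst (c : F) : K := p (fun=> c : F).
have cstB : zmod_morphism cst by move=> a b; rewrite /cst -rmorphB.
have cstM : monoid_morphism cst.
  by split=> [|a b]; [exact: (rmorph1 p) | exact: (rmorphM p (fun=> a : F) (fun=> b))].
pose ad := GRing.isZmodMorphism.Build F K cst cstB.
pose mu := GRing.isMonoidMorphism.Build F K cst cstM.
pose ic : {rmorphism F -> K} := HB.pack cst ad mu.
have pc c : p (fun=> c) = ic c by [].
have pD f g : p (fun x => f x + g x) = p f + p g by exact: (rmorphD p).
have pMu f g : p (fun x => f x * g x) = p f * p g by exact: (rmorphM p).
exists K, (Evaluation pc pD pMu); split=> [f f0|f Sf /pM fG x Dx].
  by apply/pM; apply: filterS GD => x; exact: f0.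
apply/eqP; apply: contrapT => /negP fx.
have Gf : G [set y | f y != 0] by apply: FG; exists f; split=> //; exists x.
apply: (@filter_not_empty T G _).
by apply: filterS (filterI fG Gf) => y /= [-> ]; rewrite eqxx.
Qed.

End GenericPoint.

Lemma ev_sum (T : Type) (F K : fieldType) (ev : evaluation T F K) I (r : seq I)
    (P : pred I) (f : I -> T -> F) :
  ev (fun x => \sum_(i <- r | P i) f i x) = \sum_(i <- r | P i) ev (f i).
Proof.
elim: r => [|i r IHr].
  rewrite big_nil -[RHS](rmorph0 (ev_cst ev)) -ev_c; congr (ev _).
  by apply/funext => x; rewrite big_nil.
rewrite big_cons -IHr; case: ifP => Pi; rewrite -?evD; congr (ev _);
  by apply/funext => x; rewrite big_cons Pi.
Qed.

Lemma ev_prod (T : Type) (F K : fieldType) (ev : evaluation T F K) I (r : seq I)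
    (P : pred I) (f : I -> T -> F) :
  ev (fun x => \prod_(i <- r | P i) f i x) = \prod_(i <- r | P i) ev (f i).
Proof.
elim: r => [|i r IHr].
  rewrite big_nil -[RHS](rmorph1 (ev_cst ev)) -ev_c; congr (ev _).
  by apply/funext => x; rewrite big_nil.
rewrite big_cons -IHr; case: ifP => Pi; rewrite -?evM; congr (ev _);
  by apply/funext => x; rewrite big_cons Pi.
Qed.

Lemma ev_exp (T : Type) (F K : fieldType) (ev : evaluation T F K) (f : T -> F) n :
  ev (fun x => f x ^+ n) = ev f ^+ n.
Proof.
elim: n => [|n IHn].
  by rewrite expr0 -[RHS](rmorph1 (ev_cst ev)) -ev_c.
rewrite exprS -IHn -evM; congr (ev _); apply/funext => x.
by rewrite exprS.
Qed.

Lemma ev_mpoly (T : Type) (F K : fieldType) (ev : evaluation T F K) N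
    (z : T -> 'I_N -> F) (p : {mpoly F[N]}) :
  ev (fun x => p.@[z x]) = mmap (ev_cst ev) (fun i => ev (z^~ i)) p.
Proof.
rewrite /mmap.
under eq_fun do rewrite mevalE.
rewrite ev_sum; apply: eq_bigr => m _; rewrite evM ev_c; congr (_ * _).
by rewrite ev_prod /mmap1; apply: eq_bigr => i _; rewrite ev_exp.
Qed.

(** * Extension of specializations *)

Lemma exists_least_nat (P : nat -> Prop) :
  (exists n, P n) -> exists2 n, P n & forall k, P k -> (n <= k)%N.
Proof.
move=> [n0 Pn0]; have ex : exists n, `[< P n >] by exists n0; apply/asboolP.
exists (ex_minn ex); case: ex_minnP => n /asboolP // _ h k Pk.
by apply: h; apply/asboolP.
Qed.

(** The subring j(A)[z] of K is represented by {poly A}, and a specialization of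
    j(A) by a morphism phi on A that kills the kernel of j, so that adjoining
    elements takes neither quotients nor subrings. *)
Section OneStep.
Variables (F : closedFieldType) (K : fieldType) (A : idomainType).
Variables (j : {rmorphism A -> K}) (z : K).
Local Notation M := (map_poly j).

(* Leading terms killed by j are dropped. *)
Let trunc q : M q != 0 ->
  exists q', [/\ M q' = M q, size q' = size (M q) & j (lead_coef q') != 0].
Proof.
move=> q0; pose q' := take_poly (size (M q)) q.
have Mq' : M q' = M q.
  apply/polyP => i; rewrite !coef_map coef_take_poly.
  case: ltnP => // le_i; have := nth_default 0 le_i.
  by rewrite coef_map => E; rewrite E raddf0.
have sq' : size q' = size (M q).
  apply/eqP; rewrite eqn_leq size_take_poly -Mq'.
  by apply: size_poly.
exists q'; split=> //; rewrite lead_coefE sq' -coef_map Mq' -lead_coefE.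
by rewrite lead_coef_eq0.
Qed.

Let min_poly (P : {poly A} -> Prop) : (forall q q', M q = M q' -> P q -> P q') ->
  (exists2 q, M q != 0 & P q) ->
  exists q, [/\ P q, j (lead_coef q) != 0 &
    forall r, M r != 0 -> P r -> (size q <= size (M r))%N].
Proof.
move=> Pext [q q0 Pq].
have [|n [q1 [q10 Pq1 <-]] nmin] := @exists_least_nat (fun n => exists q,
  [/\ M q != 0, P q & size (M q) = n]); first by exists (size (M q)), q.
have [q2 [Mq2 sq2 lq2]] := trunc q10.
exists q2; split=> // [|r r0 Pr]; first exact: Pext Pq1.
by rewrite sq2; apply: nmin; exists r.
Qed.

Let divide (m q : {poly A}) : j (lead_coef m) != 0 -> exists c s r,
  [/\ c != 0, M q * c%:P = M s * M m + M r, (size (M r) < size m)%N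
    & exists k, c = j (lead_coef m ^+ k) /\
         lead_coef m ^+ k *: q = s * m + r].
Proof.
move=> lm; have m0 : m != 0.
  by apply: contraNneq lm => ->; rewrite lead_coef0 rmorph0.
exists (j (lead_coef m ^+ scalp q m)), (q %/ m), (q %% m); split.
- by rewrite rmorphXn expf_neq0.
- have /(congr1 M) := Pdiv.Idomain.divp_eq q m.
  by rewrite map_polyZ -mul_polyC mulrC rmorphD rmorphM.
- by apply: leq_ltn_trans (size_poly _ _) _; rewrite ltn_modp.
- by exists (scalp q m); split=> //; rewrite Pdiv.Idomain.divp_eq.
Qed.

(** One step of Chevalley's theorem: phi extends to j(A)[z], keeping h nonzero,
    as soon as it does not kill g. If z is transcendental over j(A), then g is a
    coefficient of h and z may go to any value outside a finite set. Otherwise let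
    m be a polynomial of least degree that kills z: then z must go to a root of
    phi(m), and g is the leading coefficient of m times a constant g' whose value
    is a multiple of h(z). Such a constant exists because m and h have no factor
    in common; when phi does not kill it, h cannot vanish at the root. *)
Lemma extend_point (h : {poly A}) : (M h).[z] != 0 ->
  exists2 g, j g != 0 & forall phi : {rmorphism A -> F},
    (forall a, j a = 0 -> phi a = 0) -> phi g != 0 ->
    exists2 t, (map_poly phi h).[t] != 0 &
      forall p, (M p).[z] = 0 -> (map_poly phi p).[t] = 0.
Proof.
move=> hz.
have phi0 (phi : {rmorphism A -> F}) r : (forall a, j a = 0 -> phi a = 0) ->
    M r = 0 -> map_poly phi r = 0.
  move=> jphi Mr; apply/polyP => i; rewrite coef_map coef0; apply: jphi.
  by rewrite -coef_map Mr coef0.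
pose P q := (M q).[z] = 0.
have [Pex|nP] := pselect (exists2 q, M q != 0 & P q); last first.
  have Mh : M h != 0 by apply: contraNneq hz => ->; rewrite horner0.
  exists h`_(size (M h)).-1.
    by rewrite -coef_map -lead_coefE lead_coef_eq0.
  move=> phi jphi hphi.
  have /closed_nonrootP[t ht] : map_poly phi h != 0.
    apply: contraNneq hphi => h0.
    by rewrite -coef_map h0 coef0.
  exists t => [|p Mp]; first exact: ht.
  rewrite (phi0 phi p) ?horner0 //; apply/eqP; apply: contrapT => /negP Mp0.
  by apply: nP; exists p.
have [|m [mz lm mmin]] := min_poly _ Pex.
  by rewrite /P => q q' ->.
have m0 : M m != 0.
  by apply: contraNneq lm => m0; rewrite lead_coefE -coef_map m0 coef0.
(* An element e of least degree of D is a constant. If e kills z, its degree is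
   at least that of m, and the remainder of h by m is a smaller element of D.
   Otherwise, if e is not constant, it divides m up to a scalar, and the cofactor
   kills z although its degree is less than that of m. *)
pose D q := exists v, (M q).[z] = (M v).[z] * (M h).[z].
have Dext q q' : M q = M q' -> D q -> D q'.
  by move=> qq' [v e]; exists v; rewrite -qq'.
have [|e [[v ev] le emin]] := min_poly Dext.
  by exists m => //; exists 0; rewrite mz rmorph0 horner0 mul0r.
have e0 : M e != 0.
  by apply: contraNneq le => e0; rewrite lead_coefE -coef_map e0 coef0.
have sM q : j (lead_coef q) != 0 -> size (M q) = size q.
  by move=> lq; rewrite size_map_poly_id0.
have se : size e = 1%N.
  apply/eqP; rewrite eqn_leq; apply/andP; split; last first.
    by rewrite -sM // lt0n size_poly_eq0.
  rewrite leqNgt; apply/negP => se1.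
  have [ez|ez] := eqVneq (M e).[z] 0.
    have [c [s [r [c0 hr sr [k [ck _]]]]]] := divide h lm.
    have rz : (M r).[z] = c * (M h).[z].
      have /(congr1 (fun q => q.[z])) := hr.
      by rewrite !hornerE mz mulr0 add0r mulrC.
    have := sr; rewrite ltnNge => /negP[].
    have r0 : M r != 0.
      apply: contraNneq (mulf_neq0 c0 hz) => r0.
      by rewrite -rz r0 horner0.
    apply: leq_trans (emin r r0 _).
      by rewrite -[size e]sM //; exact: mmin.
    exists (lead_coef m ^+ k)%:P; rewrite rz ck map_polyC hornerC //.
  have [c [s [r [c0 hr sr _]]]] := divide m le.
  have r0 : M r = 0.
    apply/eqP; apply: contraTT sr => r0; rewrite -leqNgt; apply: emin => //.
    exists (- s * v); have /(congr1 (fun q => q.[z])) := hr.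
    rewrite !hornerE mz mul0r ev => /esym/eqP; rewrite addrC addr_eq0 => /eqP->.
    by rewrite rmorphM rmorphN hornerM hornerN !mulNr mulrA.
  rewrite r0 addr0 in hr.
  have s0 : M s != 0.
    apply: contraNneq m0 => s0; move: hr; rewrite s0 mul0r => /eqP.
    by rewrite mulf_eq0 polyC_eq0 (negPf c0) orbF.
  have sz : P s.
    have /(congr1 (fun q => q.[z])) := hr.
    rewrite !hornerE mz mul0r => /esym/eqP; rewrite mulf_eq0 (negPf ez) orbF.
    by move/eqP.
  have := mmin s s0 sz; rewrite leqNgt => /negP[].
  have := congr1 (fun q : {poly K} => size q) hr.
  rewrite mulrC mul_polyC size_scale // size_mul // (sM m lm) => ->.
  move: se1; rewrite -(sM e) //; case: (size (M e)) => [|[|b]] // _.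
  by rewrite addnS /= addnS ltnS leq_addr.
have [g' eg'] : exists g', e = g'%:P by exists e`_0; apply: size1_polyC; rewrite se.
have jg' : j g' != 0 by move: le; rewrite eg' lead_coefC.
exists (lead_coef m * g'); first by rewrite rmorphM mulf_neq0.
move=> phi jphi; rewrite rmorphM mulf_eq0 negb_or => /andP[phim phig].
have sm : size (map_poly phi m) = size m by rewrite size_map_poly_id0.
have /closed_rootP[t mt] : size (map_poly phi m) != 1%N.
  rewrite sm; apply/eqP => sm1; move: mz m0.
  rewrite /P (size1_polyC (eq_leq sm1)) map_polyC hornerC /= => ->.
  by rewrite polyC0 eqxx.
have kill p : (M p).[z] = 0 -> (map_poly phi p).[t] = 0.
  move=> pz; have [c [s [r [c0 hr sr [k [ck hk]]]]]] := divide p lm.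
  have r0 : M r = 0.
    apply/eqP; apply: contraTT sr => r0; rewrite -leqNgt; apply: mmin => //.
    have /(congr1 (fun q => q.[z])) := hr.
    by rewrite !hornerE pz mul0r mz mulr0 add0r => /esym.
  have /(congr1 (fun q => (map_poly phi q).[t])) := hk.
  rewrite map_polyZ rmorphD rmorphM hornerZ hornerD hornerM (eqP mt) mulr0.
  rewrite /= (phi0 phi r) //.
  rewrite horner0 addr0 rmorphXn => /eqP.
  by rewrite mulf_eq0 (negPf (expf_neq0 _ phim)) => /eqP.
exists t => //; have := kill (g'%:P - v * h).
rewrite !rmorphB !rmorphM /= !hornerE !map_polyC /= !hornerC.
move: ev; rewrite eg' map_polyC hornerC /= => ->; rewrite subrr => /(_ erefl).
move=> /eqP; rewrite subr_eq0 => /eqP phigE.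
by apply: contraNneq phig => h0; rewrite phigE h0 mulr0.
Qed.

End OneStep.

Lemma rmorph_mmap (F : nzRingType) (B B' : comNzRingType) N (f : F -> B)
    (h : 'I_N -> B) (rho : {rmorphism B -> B'}) (p : {mpoly F[N]}) :
  rho (mmap f h p) = mmap (rho \o f) (rho \o h) p.
Proof.
rewrite /mmap rmorph_sum; apply: eq_bigr => m _; rewrite rmorphM; congr (_ * _).
by rewrite /mmap1 rmorph_prod; apply: eq_bigr => i _; rewrite rmorphXn.
Qed.

Lemma eq_mmap (F B : nzRingType) N (f f' : F -> B) (h h' : 'I_N -> B) p :
  f =1 f' -> h =1 h' -> mmap f h p = mmap f' h' p.
Proof.
move=> ff' hh'; rewrite /mmap; apply: eq_bigr => m _; rewrite ff'; congr (_ * _).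
by rewrite /mmap1; apply: eq_bigr => i _; rewrite hh'.
Qed.

Section Extension.
Variables (F : closedFieldType) (K : fieldType).

(** B is an iterated polynomial ring over A, with one variable for each element
    of zs. *)
Lemma extend_points (zs : seq K) (A : idomainType) (j : {rmorphism A -> K}) :
  exists2 g, j g != 0 & forall phi : {rmorphism A -> F},
    (forall a, j a = 0 -> phi a = 0) -> phi g != 0 ->
    exists (B : idomainType) (i : {rmorphism A -> B}) (k : {rmorphism B -> K})
           (psi : {rmorphism B -> F}),
      [/\ forall a, k (i a) = j a, forall a, psi (i a) = phi a,
          forall b, k b = 0 -> psi b = 0 &
          forall z, z \in zs -> exists b, k b = z].
Proof.
elim: zs A j => [|z zs IHzs] A j.
  exists 1; first by rewrite rmorph1 oner_neq0.
  by move=> phi jphi _; exists A, idfun, j, phi; split.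
have [g' g'0 hg'] := IHzs {poly A} (horner_eval z \o map_poly j).
have [g g0 hg] := extend_point F g'0; exists g => // phi jphi phig.
have [t tg' ht] := hg phi jphi phig.
have [|//|B [i [k [psi [ki psii kpsi hzs]]]]] :=
  hg' (horner_eval t \o map_poly phi); first exact: ht.
exists B, (i \o polyC), k, psi; split=> //= [a|a|y].
- by rewrite ki /= map_polyC /= /horner_eval hornerC.
- by rewrite psii /= map_polyC /= /horner_eval hornerC.
rewrite inE => /orP[/eqP ->|]; last exact: hzs.
by exists (i 'X); rewrite ki /= map_polyX /horner_eval hornerX.
Qed.

(** The inverse of the value of q is adjoined together with the coordinates of y:
    its specialization shows that q does not vanish at b. *)
Lemma extend_to_point (A : idomainType) (c : {rmorphism F -> A})
    (j : {rmorphism A -> K}) N (y : 'I_N -> K) (q : {mpoly F[N]}) :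
  mmap (j \o c) y q != 0 ->
  exists2 g, j g != 0 & forall phi : {rmorphism A -> F},
    (forall x, phi (c x) = x) ->
    (forall a, j a = 0 -> phi a = 0) -> phi g != 0 ->
    exists2 b : 'I_N -> F, q.@[b] != 0 &
      forall a u, j a = mmap (j \o c) y u -> phi a = u.@[b].
Proof.
move=> q0.
have [g g0 hg] := extend_points ((mmap (j \o c) y q)^-1 :: codom y) j.
exists g => // phi phic jphi phig.
have [B [i [k [psi [ki psii kpsi hzs]]]]] := hg phi jphi phig.
have bex l : exists b, k b = y l by apply: hzs; rewrite inE codom_f orbT.
pose bs l := sval (cid (bex l)); have bsE l : k (bs l) = y l.
  by rewrite /bs; case: cid.
pose b l := psi (bs l).
have kE u : k (mmap (i \o c) bs u) = mmap (j \o c) y u.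
  by rewrite rmorph_mmap; apply: eq_mmap => x /=.
have psiE u : psi (mmap (i \o c) bs u) = u.@[b].
  by rewrite rmorph_mmap; apply: eq_mmap => x //=; rewrite psii phic.
have kinj b1 b2 : k b1 = k b2 -> psi b1 = psi b2.
  by move=> e; apply/eqP; rewrite -subr_eq0 -rmorphB kpsi // rmorphB e subrr.
exists b => [|a u au]; last by rewrite -psiE -psii; apply: kinj; rewrite ki kE.
have [r kr] : exists r, k r = (mmap (j \o c) y q)^-1.
  by apply: hzs; rewrite inE eqxx.
apply/eqP => qb0; have := kinj (r * mmap (i \o c) bs q) 1.
rewrite !rmorphM !rmorph1 kE kr psiE qb0 mulr0 mulVf // => /(_ erefl)/esym/eqP.
by rewrite oner_eq0.
Qed.

Lemma nullstellensatz (iota : {rmorphism F -> K}) N (y : 'I_N -> K)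
    (q : {mpoly F[N]}) : mmap iota y q != 0 ->
  exists2 b : 'I_N -> F, q.@[b] != 0 &
    forall p, mmap iota y p = 0 -> p.@[b] = 0.
Proof.
move=> q0; have [|g g0 hg] := @extend_to_point F idfun iota N y q.
  by rewrite (eq_mmap (f' := iota) (h' := y)).
have iota0 a : iota a = 0 -> idfun a = 0.
  by move/eqP; rewrite fmorph_eq0 => /eqP.
have [//|//||b qb hb] := hg idfun.
  by apply: contraNneq g0 => /= ->; rewrite rmorph0.
by exists b => // p p0; rewrite -(hb 0 p) ?rmorph0.
Qed.

End Extension.

(** * Relative algebraic closure *)

Section RelativeAlgebraicity.
Variable K : fieldType.
Implicit Types S : set K.

Definition is_subfield S :=
  [/\ S 1, forall x y, S x -> S y -> S (x - y) &
      forall x y, S x -> S y -> S (x / y)].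

Definition alg_over S : set K :=
  [set x | exists p : {poly K}, [/\ p != 0, forall i, S p`_i & root p x]].

Section Fixed.
Variable S : set K.

(** The proof h is an argument so that the field structure of the subtype can be
    inferred from its type. *)
Definition subfield_pred (h : is_subfield S) : pred K := fun x => `[< S x >].

Variable S_sub : is_subfield S.

Fact subfield_divring : divring_closed (subfield_pred S_sub).
Proof.
have [h1 hB hd] := S_sub.
split=> [|x y /asboolP Sx /asboolP Sy|x y /asboolP Sx /asboolP Sy];
  apply/asboolP; first [exact: h1 | exact: hB | exact: hd].
Qed.

HB.instance Definition _ :=
  GRing.isDivringClosed.Build K (subfield_pred S_sub) subfield_divring.

Inductive subfield_type := SubfieldElt x & x \in subfield_pred S_sub.
Definition subfield_val u := let: SubfieldElt x _ := u in x.

HB.instance Definition _ := [isSub for subfield_val].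
HB.instance Definition _ := [Choice of subfield_type by <:].
HB.instance Definition _ := [SubChoice_isSubIntegralDomain of subfield_type by <:].
HB.instance Definition _ := [SubIntegralDomain_isSubField of subfield_type by <:].

Lemma alg_overE x :
  alg_over S x <-> algebraicOver (\val : subfield_type -> K) x.
Proof.
split=> [[p [p0 Sp px]]|[p p0 px]].
  pose q := \poly_(i < size p) (insubd (0 : subfield_type) p`_i).
  have qp : map_poly \val q = p.
    apply/polyP => i; rewrite coef_map coef_poly; case: ltnP => [_|le_i].
      by apply: (@insubdK _ _ subfield_type); apply/asboolP.
    by rewrite nth_default ?rmorph0.
  by exists q; [apply: contraNneq p0 => q0; rewrite -qp q0 rmorph0 | rewrite qp].
exists (map_poly \val p); split=> // [|i].
  by rewrite map_poly_eq0.
by rewrite coef_map /=; case: (p`_i) => v /= /asboolP.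
Qed.

Lemma sub_alg_over : S `<=` alg_over S.
Proof.
move=> x Sx; have xS : x \in subfield_pred S_sub by apply/asboolP.
apply/alg_overE; rewrite -[x]/(\val (SubfieldElt xS)).
exact: (algebraic_id (\val : {rmorphism subfield_type -> K})).
Qed.

Lemma alg_over_subfield : is_subfield (alg_over S).
Proof.
split=> [|x y /alg_overE Sx /alg_overE Sy|x y /alg_overE Sx /alg_overE Sy].
- apply/alg_overE; exact: (algebraic1 (\val : {rmorphism subfield_type -> K})).
- by apply/alg_overE; exact: algebraic_sub.
- by apply/alg_overE; exact: algebraic_div.
Qed.

(** Transitivity of algebraicity. *)
Lemma alg_over_root (p : {poly K}) x :
  p != 0 -> (forall i, alg_over S p`_i) -> root p x ->
  alg_over S x.
Proof.
move=> p0 Sp px; apply/alg_overE/integral_algebraic.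
apply: (integral_root p0 px) => _ /(nthP 0)[i _ <-].
by apply/integral_algebraic/alg_overE.
Qed.

End Fixed.
End RelativeAlgebraicity.

Section AlgebraicClosureOperator.
Variables (F K : fieldType) (iota : {rmorphism F -> K}).
Implicit Types A B : set K.

(** The subfield generated by A and the constants. *)
Definition field_gen A : set K :=
  [set x | forall S, is_subfield S -> (forall c, S (iota c)) -> A `<=` S -> S x].

Definition acl A : set K := alg_over (field_gen A).

Lemma field_gen_subfield A : is_subfield (field_gen A).
Proof.
split=> [S [h1 _ _] _ _ //|x y gx gy S|x y gx gy S] hS Sc SA; have [h1 hB hd] := hS.
  by apply: hB; [exact: gx | exact: gy].
by apply: hd; [exact: gx | exact: gy].
Qed.

Lemma acl_subfield A : is_subfield (acl A).
Proof. exact/alg_over_subfield/field_gen_subfield. Qed.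

Lemma sub_acl A : A `<=` acl A.
Proof.
move=> x Ax; apply: (sub_alg_over (field_gen_subfield A)) => S _ _; exact.
Qed.

Lemma acl_cst A c : acl A (iota c).
Proof. by apply: (sub_alg_over (field_gen_subfield A)) => S _ h _; apply: h. Qed.

Lemma acl1 A : acl A 1. Proof. by have [] := acl_subfield A. Qed.

Lemma aclB A x y : acl A x -> acl A y -> acl A (x - y).
Proof. by have [_ h _] := acl_subfield A; exact: h. Qed.

Lemma acl0 A : acl A 0.
Proof. by rewrite -(subrr 1); apply: aclB; exact: acl1. Qed.

Lemma aclN A x : acl A x -> acl A (- x).
Proof. by move=> Ax; rewrite -sub0r; apply: aclB => //; exact: acl0. Qed.

Lemma aclD A x y : acl A x -> acl A y -> acl A (x + y).
Proof. by move=> Ax Ay; rewrite -[y]opprK; apply: aclB => //; exact: aclN. Qed.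

Lemma acl_div A x y : acl A x -> acl A y -> acl A (x / y).
Proof. by have [_ _ h] := acl_subfield A; exact: h. Qed.

Lemma aclM A x y : acl A x -> acl A y -> acl A (x * y).
Proof.
move=> Ax Ay; rewrite -[y]invrK; apply: acl_div => //.
by rewrite -div1r; apply: acl_div => //; exact: acl1.
Qed.

Lemma aclX A x n : acl A x -> acl A (x ^+ n).
Proof.
move=> Ax; elim: n => [|n IHn]; first by rewrite expr0; exact: acl1.
by rewrite exprS; exact: aclM.
Qed.

Lemma acl_sum A I (r : seq I) (P : pred I) f :
  (forall i, P i -> acl A (f i)) -> acl A (\sum_(i <- r | P i) f i).
Proof. by move=> h; elim/big_ind: _ => //; [exact: acl0 | exact: aclD]. Qed.

Lemma acl_prod A I (r : seq I) (P : pred I) f :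
  (forall i, P i -> acl A (f i)) -> acl A (\prod_(i <- r | P i) f i).
Proof. by move=> h; elim/big_ind: _ => //; [exact: acl1 | exact: aclM]. Qed.

Lemma acl_mmap A N (y : 'I_N -> K) p :
  (forall i, acl A (y i)) -> acl A (mmap iota y p).
Proof.
move=> h; apply: acl_sum => m _; apply: aclM; first exact: acl_cst.
by apply: acl_prod => i _; apply: aclX.
Qed.

Lemma acl_root A (p : {poly K}) x :
  p != 0 -> (forall i, acl A p`_i) -> root p x -> acl A x.
Proof. exact/alg_over_root/field_gen_subfield. Qed.

Lemma acl_min A B : A `<=` acl B -> acl A `<=` acl B.
Proof.
move=> AB x [p [p0 hp px]]; apply: acl_root p0 _ px => i.
apply: (hp i) => //; [exact: acl_subfield | exact: acl_cst].
Qed.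

Lemma acl_mono A B : A `<=` B -> acl A `<=` acl B.
Proof. by move=> AB; apply: acl_min => x /AB; exact: sub_acl. Qed.

(** The elements of the field generated by A are fractions of elements of j(D),
    and a polynomial has finitely many coefficients. *)
Lemma acl_clear_denominators (D : comNzRingType) (j : {rmorphism D -> K}) A x :
  (forall c, exists d, j d = iota c) -> (forall a, A a -> exists d, j d = a) ->
  acl A x -> exists2 r : {poly D}, map_poly j r != 0 & root (map_poly j r) x.
Proof.
move=> jc jA [p [p0 hp px]].
pose S : set K := [set x | exists a b, j b != 0 /\ x = j a / j b].
have S_in a : S (j a) by exists a, 1; rewrite rmorph1 oner_neq0 divr1.
have hS : is_subfield S.
  split=> [|_ _ [a [b [b0 ->]]] [a' [b' [b'0 ->]]]
           |_ _ [a [b [b0 ->]]] [a' [b' [b'0 ->]]]].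
  - by rewrite -(rmorph1 j); exact: S_in.
  - exists (a * b' - a' * b), (b * b'); rewrite rmorphB !rmorphM mulf_neq0 //.
    by split=> //; rewrite -[- (j a' / j b')]mulNr addf_div // mulNr.
  - have [a'0|a'0] := eqVneq (j a') 0.
      by rewrite a'0 mul0r invr0 mulr0 -(rmorph0 j); exact: S_in.
    exists (a * b'), (b * a'); rewrite !rmorphM mulf_neq0 //.
    by rewrite invf_div mulf_div.
have Sp i : S p`_i.
  apply: (hp i) => // [c|a /jA[d <-]]; last exact: S_in.
  by have [d <-] := jc c; exact: S_in.
have [d d0 hd] : exists2 d, j d != 0 & forall i, exists a, j d * p`_i = j a.
  have : exists2 d, j d != 0 &
      forall i, (i < size p)%N -> exists a, j d * p`_i = j a.
    elim: (size p) => [|n [d d0 hd]].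
      by exists 1; rewrite ?rmorph1 ?oner_neq0.
    have [a [b [b0 pE]]] := Sp n; exists (d * b).
      by rewrite rmorphM mulf_neq0.
    move=> i; rewrite ltnS leq_eqVlt => /orP[/eqP->|/hd[a' ha']].
      exists (d * a); rewrite pE !rmorphM -mulrA; congr (_ * _).
      by rewrite mulrC divfK.
    by exists (b * a'); rewrite !rmorphM -ha' mulrCA mulrA.
  move=> [d d0 hd]; exists d => // i; case: (ltnP i (size p)) => [/hd//|le_i].
  by exists 0; rewrite nth_default // mulr0 rmorph0.
pose r := \poly_(i < size p) sval (cid (hd i)).
have rE : map_poly j r = j d *: p.
  apply/polyP => i; rewrite coef_map coef_poly coefZ.
  case: ltnP => [_|le_i]; last first.
    by rewrite [p`_i]nth_default // mulr0; exact: rmorph0.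
  by case: cid => a /= ->.
exists r; first by rewrite rE scaler_eq0 (negPf d0).
by rewrite rE rootZ.
Qed.

(** A relation between x and y is a polynomial in y with coefficients in L[x],
    where L is the closure of A; it is read as a polynomial in x with coefficients
    in L[y]. The latter is not zero, since y is transcendental over L. *)
Lemma acl_exchange A x y :
  acl (x |` A) y -> ~ acl A y -> acl (y |` A) x.
Proof.
move=> xy ny; pose L := subfield_type (acl_subfield A).
pose v : {rmorphism L -> K} := \val.
pose j : {rmorphism {poly L} -> K} := horner_eval x \o map_poly v.
have jC a : acl A a -> exists d, j d = a.
  move=> Aa; have aA : a \in subfield_pred (acl_subfield A) by apply/asboolP.
  exists (SubfieldElt aA)%:P.
  change ((map_poly v (SubfieldElt aA)%:P).[x] = a).
  by rewrite map_polyC hornerC.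
have [||r r0 ry] := @acl_clear_denominators _ j _ _ _ _ xy.
- by move=> c; apply: jC; exact: acl_cst.
- move=> a [->|Aa]; last by apply: jC; exact: sub_acl.
  exists 'X; change ((map_poly v 'X).[x] = x).
  by rewrite map_polyX hornerX.
pose R := map_poly (map_poly v) r.
have coefR k i : (R`_i)`_k = v (r`_i)`_k by rewrite /R (coef_map (map_poly v)) (coef_map v).
have Acoef k i : acl A (R`_i)`_k.
  by rewrite coefR; case: ((r`_i)`_k) => a /= /asboolP.
pose q := R.[y%:P].
have qk k : q`_k = (\poly_(i < size R) (R`_i)`_k).[y].
  rewrite /q horner_coef coef_sum horner_poly; apply: eq_bigr => i _.
  by rewrite -polyC_exp coefMC.
have q0 : q != 0.
  apply/eqP => q0; move/eqP: r0; apply.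
  have R0 k i : (R`_i)`_k = 0.
    apply/eqP; apply: contrapT => /negP Rik; apply: ny.
    apply: (@acl_root A (\poly_(i < size R) (R`_i)`_k)).
    - apply: contraNneq Rik => /(congr1 (fun p : {poly K} => p`_i)).
      rewrite coef_poly coef0; case: ltnP => [_ -> //|le_i _].
      by rewrite [R`_i]nth_default ?coef0.
    - by move=> l; rewrite coef_poly; case: ifP => // _; exact: acl0.
    - by rewrite /root -qk q0 coef0.
  have -> : r = 0.
    apply/polyP => i; apply/polyP => k; rewrite !coef0.
    by have /eqP := R0 k i; rewrite coefR fmorph_eq0 => /eqP.
  by rewrite rmorph0.
apply: acl_root q0 _ _ => [k|].
  rewrite qk horner_poly; apply: acl_sum => i _; apply: aclM.
    by apply: acl_mono (Acoef k i) => a Aa; right.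
  by apply: aclX; apply: sub_acl; left.
have jR : map_poly j r = map_poly (horner_eval x) R.
  by rewrite /R -map_poly_comp.
move: ry; rewrite jR /root -horner_swapXY => /eqP ry.
by rewrite /root /q -horner2_swapXY ry.
Qed.

End AlgebraicClosureOperator.

(** * Algebraic independence *)

Section Independence.
Variables (F K : fieldType) (iota : {rmorphism F -> K}).
Local Notation acl := (acl iota).
Implicit Types (A B G : set K) (s t : seq K).

(** This sequential form of independence is the one suited to inductions that
    adjoin elements to the base. *)
Fixpoint indep A s : Prop :=
  if s is x :: s' then ~ acl A x /\ indep (x |` A) s' else True.

Definition spans A s G := G `<=` acl (A `|` [set` s]).

Lemma acl_eq A B : A `<=` acl B -> B `<=` acl A -> acl A = acl B.
Proof. by move=> AB BA; apply/seteqP; split; exact: acl_min. Qed.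

Lemma acl_setU A B C : acl A = acl B -> acl (A `|` C) = acl (B `|` C).
Proof.
move=> AB; apply: acl_eq => x [] h; try (by apply: sub_acl; right).
  have : acl B x by rewrite -AB; exact: sub_acl.
  by apply: acl_mono => y; left.
have : acl A x by rewrite AB; exact: sub_acl.
by apply: acl_mono => y; left.
Qed.

Lemma indep_ext A B s : acl A = acl B -> indep A s -> indep B s.
Proof.
elim: s A B => //= x s IHs A B AB [nx ind]; split; first by rewrite -AB.
by apply: IHs ind; rewrite ![x |` _]setUC; exact: acl_setU.
Qed.

Lemma set_cons_seq A x s : A `|` [set` x :: s] = (x |` A) `|` [set` s].
Proof.
apply/seteqP; split=> y /=; rewrite inE.
  by case=> [|/orP[/eqP|]]; [left; right | left; left | right].
by case=> [[->|]|]; [right; rewrite eqxx | left | right; apply/orP; right].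
Qed.

Lemma indep_rcons A s x :
  indep A (rcons s x) <-> indep A s /\ ~ acl (A `|` [set` s]) x.
Proof.
elim: s A => [|y s IHs] A /=.
  have -> : A `|` [set` [::]] = A by apply/seteqP; split=> z; [case | left].
  by tauto.
by rewrite IHs set_cons_seq; tauto.
Qed.

(** The first element y of t such that x depends on A and the elements of t up to
    y may be exchanged with x. *)
Lemma exchange_seq A x t : acl (A `|` [set` t]) x -> ~ acl A x ->
  exists2 t', size t = (size t').+1 & spans (x |` A) t' [set` t].
Proof.
elim: t A => [|y t IHt] A.
  have -> : A `|` [set` [::]] = A by apply/seteqP; split=> z; [case | left].
  by [].
rewrite set_cons_seq => xt nx.
have [xy|nxy] := pselect (acl (y |` A) x).
  have yx := acl_exchange xy nx.
  exists t => // z /=; rewrite inE => /orP[/eqP ->|zt].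
    by apply: acl_mono yx => ?; left.
  by apply: sub_acl; right.
have [t' st ht] := IHt _ xt nxy.
exists (y :: t') => /= [|z /=]; first by rewrite st.
rewrite inE set_cons_seq [y |` _]setUCA => /orP[/eqP ->|zt]; last exact: ht.
by apply: sub_acl; left; right; left.
Qed.

Lemma steinitz A s t :
  indep A s -> spans A t [set` s] -> (size s <= size t)%N.
Proof.
elim: s A t => //= x s IHs A t [nx ind] h.
have [|t' st ht] := @exchange_seq A x t _ nx; first by apply: (h x); rewrite /= inE eqxx.
rewrite st ltnS; apply: IHs ind _ => z zs.
have {zs}: acl (A `|` [set` t]) z by apply: h; rewrite /= inE zs orbT.
apply: acl_min => y [Ay|]; last exact: ht.
by apply: sub_acl; left; right.
Qed.

(** Enlarging the base by one element costs at most one independent element: the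
    first one, x, that becomes algebraic. Indeed v and x then generate the same
    closure over the elements before x. *)
Lemma indep_remove A v s : indep A s -> exists s',
  [/\ (size s <= (size s').+1)%N, {subset s' <= s} & indep (v |` A) s'].
Proof.
elim: s A => [|x s IHs] A /=; first by exists [::].
move=> [nx ind]; have [xv|nxv] := pselect (acl (v |` A) x).
  exists s; split=> // [y|]; first by rewrite inE orbC => ->.
  have vx := acl_exchange xv nx.
  apply: indep_ext ind; apply: acl_eq => y [->|Ay] //; by apply: sub_acl; right.
have [s' [le_s sub_s ind']] := IHs _ ind.
exists (x :: s'); split=> //= [y|].
  by rewrite !inE => /orP[->//|/sub_s ->]; rewrite orbT.
by split=> //; rewrite setUCA.
Qed.

Lemma indep_remove_seq A b s : indep A s -> exists s',
  [/\ (size s <= size s' + size b)%N, {subset s' <= s}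
    & indep (A `|` [set` b]) s'].
Proof.
elim: b A s => [|v b IHb] A s ind.
  exists s; split=> //; first by rewrite addn0.
  by apply: indep_ext ind; congr acl; apply/seteqP; split=> z; [left | case].
have [s1 [le1 sub1 ind1]] := indep_remove v ind.
have [s2 [le2 sub2 ind2]] := IHb _ _ ind1.
exists s2; split=> [|x /sub2/sub1//|]; last by rewrite set_cons_seq.
by apply: leq_trans le1 _; rewrite /= addnS ltnS.
Qed.

Lemma indep_adjoin A v s :
  indep A s -> ~ acl (A `|` [set` s]) v -> indep (v |` A) s.
Proof.
elim: s A => //= x s IHs A [nx ind]; rewrite set_cons_seq => nv; split.
  move=> xv; apply: nv; have := acl_exchange xv nx.
  by apply: acl_mono => y; left.
by rewrite setUCA; exact: IHs.
Qed.

(** Independent families in G are no longer than t, and one of maximal length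
    spans G. *)
Lemma basis_exists A G t : spans A t G -> exists b,
  [/\ forall x, x \in b -> G x, indep A b & spans A b G].
Proof.
move=> hG; pose P n := exists s,
  [/\ size s = (size t - n)%N, (n <= size t)%N, indep A s & forall x, x \in s -> G x].
have [|n [s [sE le_n ind sG]] nmin] := @exists_least_nat P.
  by exists (size t), [::]; rewrite subnn.
exists s; split=> // x Gx; apply: contrapT => nx.
have ind' : indep A (rcons s x) by apply/indep_rcons.
have sG' y : y \in rcons s x -> G y.
  by rewrite mem_rcons inE => /orP[/eqP ->//|]; exact: sG.
have : (size (rcons s x) <= size t)%N.
  by apply: (steinitz ind') => y /sG'; exact: hG.
rewrite size_rcons sE => lt_n.
have n0 : (0 < n)%N by case: n lt_n {sE le_n nmin} => //; rewrite subn0 ltnn.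
have : (n <= n.-1)%N; last by lia.
by apply: nmin; exists (rcons s x); split=> //; rewrite ?size_rcons ?sE; lia.
Qed.

End Independence.

(** * Polynomial rings in independent elements *)

Section PolynomialTower.
Variables (F : closedFieldType) (N : nat).
Local Notation mp := {mpoly F[N]}.

Lemma closed_field_big (s : seq F) : exists x, x \notin s.
Proof.
have /closed_nonrootP[x] : \prod_(a <- s) ('X - a%:P) != 0.
  by rewrite monic_neq0 // monic_prod_XsubC.
by rewrite root_prod_XsubC; exists x.
Qed.

Lemma closed_field_uniq n : exists2 s : seq F, uniq s & size s = n.
Proof.
elim: n => [|n [s us sn]]; first by exists [::].
have [x xs] := closed_field_big s.
by exists (x :: s); rewrite /= ?xs ?sn.
Qed.

Lemma nonroot_in (A : idomainType) (c : {rmorphism F -> A}) (p : {poly A}) :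
  p != 0 -> exists a, p.[c a] != 0.
Proof.
move=> p0; have [s us sn] := closed_field_uniq (size p).
apply: contrapT => h.
have := max_poly_roots p0 (_ : all (root p) (map c s)) (_ : uniq (map c s)).
rewrite size_map sn ltnn => h'; suff: false by []; apply: h'.
  apply/allP => _ /mapP[a _ ->]; apply/eqP; apply: contrapT => /eqP pa.
  by apply: h; exists a.
rewrite map_inj_uniq // => a b /eqP; rewrite -subr_eq0 -rmorphB => /eqP cab.
apply/eqP; rewrite -subr_eq0; apply: contraTT isT => ab.
have := oner_neq0 A; rewrite -(rmorph1 c) -(mulfV ab) rmorphM cab mul0r.
by rewrite eqxx.
Qed.

(** A ring of polynomial expressions in some chosen polynomials. It has enough
    F-points to separate its elements, and this property passes to polynomial
    rings. *)
Record param_ring := ParamRing {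
  pr_ring :> idomainType;
  pr_cst : {rmorphism F -> pr_ring};
  pr_map : {rmorphism pr_ring -> mp};
  pr_cstE : forall c, pr_map (pr_cst c) = c%:MP;
  pr_point : forall a : pr_ring, a != 0 -> exists2 phi : {rmorphism pr_ring -> F},
    (forall c, phi (pr_cst c) = c) & phi a != 0 }.

Program Definition base_ring : param_ring :=
  @ParamRing F idfun (@mpolyC N F) _ _.
Next Obligation. by []. Qed.
Next Obligation. by exists idfun. Qed.

Program Definition adjoin_ring (T : param_ring) (p : mp) : param_ring :=
  @ParamRing {poly T} (polyC \o pr_cst T) (horner_eval p \o map_poly (pr_map T))
    _ _.
Next Obligation.
by move=> T p c /=; rewrite map_polyC /horner_eval hornerC /= pr_cstE.
Qed.
Next Obligation.
move=> T p a a0 /=; have [|phi phic phia] := @pr_point T (lead_coef a).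
  by rewrite lead_coef_eq0.
have /closed_nonrootP[t at0] : map_poly phi a != 0.
  apply: contraNneq phia => a00.
  by rewrite lead_coefE -coef_map a00 coef0.
exists (horner_eval t \o map_poly phi) => [c|] /=; last exact: at0.
by rewrite map_polyC /horner_eval hornerC /= phic.
Qed.

(** The polynomial ring in variables that stand for the elements of f, the first
    element of f being the outermost variable. *)
Definition tower (f : seq mp) : param_ring :=
  foldr (fun p T => adjoin_ring T p) base_ring f.

(** No relation holds between the parameters at the point y of K. *)
Definition faithful (T : param_ring) (K : fieldType) (iota : {rmorphism F -> K})
    (y : 'I_N -> K) :=
  forall a : T, mmap iota y (pr_map T a) = 0 -> a = 0.

Section AtPoint.
Variables (K : fieldType) (iota : {rmorphism F -> K}) (y : 'I_N -> K).
Let pi : {rmorphism mp -> K} := mmap iota y.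
Let val (T : param_ring) : {rmorphism T -> K} := pi \o pr_map T.

Let val_cst T c : val T (pr_cst T c) = iota c.
Proof. by rewrite /val /= pr_cstE /pi /= mmapC. Qed.

Let val_adjoin (T : param_ring) p (a : {poly T}) :
  val (adjoin_ring T p) a = (map_poly (val T) a).[pi p].
Proof.
rewrite /val /= /horner_eval -[pi _]horner_map -map_poly_comp.
by [].
Qed.

Let acl_val f (a : tower f) : acl iota [set` map pi f] (val (tower f) a).
Proof.
elim: f a => [a|p f IHf a].
  by rewrite (val_cst base_ring); exact: acl_cst.
rewrite (val_adjoin (T := tower f) p a) horner_coef; apply: acl_sum => i _.
apply: aclM; last by apply: aclX; apply: sub_acl; rewrite /= inE eqxx.
rewrite coef_map; apply: acl_mono (IHf _) => x /=; rewrite inE => ->.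
by rewrite orbT.
Qed.

Let val_surj f x : x \in map pi f -> exists a, val (tower f) a = x.
Proof.
elim: f x => [//|p f IHf x].
rewrite map_cons inE => /orP[/eqP ->|/IHf[a <-]].
  by exists 'X; rewrite (val_adjoin (T := tower f) p) map_polyX hornerX.
by exists a%:P; rewrite (val_adjoin (T := tower f) p) map_polyC hornerC.
Qed.

(** Two forms of independence: the absence of polynomial relations is what
    specializations preserve and reflect, while the sequential form is the one
    for which there is an exchange property. The list is reversed, as the
    outermost variable comes first in a tower and last in [indep]. *)
Lemma tower_faithful f :
  faithful (tower f) iota y <-> indep iota set0 (map (mmap iota y) (rev f)).
Proof.
have zE (T : param_ring) (a : T) : mmap iota y (pr_map T a) = val T a by [].
elim: f => [|p f IHf].
  split=> // _ a; rewrite zE (val_cst base_ring) => /eqP.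
  by rewrite fmorph_eq0 => /eqP.
have fE : set0 `|` [set` map (mmap iota y) (rev f)] = [set` map pi f].
  by apply/seteqP; split=> x /=; rewrite map_rev mem_rev; [case|right].
rewrite rev_cons map_rcons indep_rcons -IHf fE; split=> [h|[h np] a].
  split=> [a a0|].
    have := h a%:P; rewrite zE (val_adjoin (T := tower f) p) map_polyC hornerC.
    by move=> /(_ a0) /eqP; rewrite polyC_eq0 => /eqP.
  move=> ap; have [|x|r r0 rp] := acl_clear_denominators (j := val (tower f)) _ _ ap.
  - by move=> c; exists (pr_cst _ c); exact: val_cst.
  - exact: val_surj.
  have rE : r = 0.
    by apply: h; rewrite zE (val_adjoin (T := tower f) p); exact/eqP.
  by move: r0; rewrite rE rmorph0 eqxx.
rewrite zE (val_adjoin (T := tower f) p) => a0.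
have j0 : map_poly (val (tower f)) a = 0.
  apply/eqP; apply: contrapT => /negP j0; apply: np; apply: acl_root j0 _ _.
    by move=> i; rewrite coef_map; exact: acl_val.
  exact/eqP.
apply/polyP => i; rewrite coef0; apply: h; rewrite zE -coef_map j0.
by rewrite coef0.
Qed.

Lemma tower_value (T : param_ring) (q : mp) (a : {poly T}) :
  mmap iota y (pr_map (adjoin_ring T q) a) =
  (map_poly (mmap iota y \o pr_map T) a).[mmap iota y q].
Proof. exact: val_adjoin. Qed.

(** An algebraic dependence has coefficients in the tower itself. *)
Lemma tower_algebraic f x : acl iota [set` map (mmap iota y) f] x ->
  exists2 r : {poly tower f}, r != 0 &
    root (map_poly (mmap iota y \o pr_map (tower f)) r) x.
Proof.
move=> ax.
have [|z|r r0 rp] := acl_clear_denominators (j := val (tower f)) _ _ ax.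
- by move=> c; exists (pr_cst _ c); exact: val_cst.
- exact: val_surj.
by exists r => //; apply: contraNneq r0 => ->; rewrite rmorph0.
Qed.

End AtPoint.
End PolynomialTower.

(** * Chains of irreducible sets of points *)

Section Specialization.
Variables (F : closedFieldType) (N : nat).
Local Notation mp := {mpoly F[N]}.
Implicit Types (V : set ('I_N -> F)) (p q : mp).

Definition vanish_on p V := forall b, V b -> p.@[b] = 0.

Definition prime_set V := V !=set0 /\
  forall p q, vanish_on (p * q) V -> vanish_on p V \/ vanish_on q V.

Definition generic V (K : fieldType) (iota : {rmorphism F -> K})
    (y : 'I_N -> K) :=
  forall p, mmap iota y p = 0 <-> vanish_on p V.

Definition locus (K : fieldType) (iota : {rmorphism F -> K}) (y : 'I_N -> K) :=
  [set b | forall p, mmap iota y p = 0 -> p.@[b] = 0].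

Lemma generic_prime V (K : fieldType) (iota : {rmorphism F -> K}) y :
  @generic V K iota y -> prime_set V.
Proof.
move=> gV; split.
  apply: contrapT => V0; have : vanish_on 1 V by move=> b Vb; case: V0; exists b.
  by move/gV; rewrite rmorph1 => /eqP; rewrite oner_eq0.
move=> p q /gV; rewrite rmorphM => /eqP; rewrite mulf_eq0.
by case/orP => /eqP /gV; [left | right].
Qed.

Lemma prime_generic V : prime_set V ->
  exists (K : fieldType) (iota : {rmorphism F -> K}) (y : 'I_N -> K),
    generic V iota y.
Proof.
move=> [V0 Vp]; have [b0 Vb0] := V0.
have [||f g [p ->] [q ->] fg|K [ev [ev0 evV]]] := @generic_field _ b0 _ V
  [set f | exists p : mp, f = fun b => p.@[b]] _ _ V0.
- by exists 1; apply/funext => b; rewrite meval1.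
- by move=> f g [p ->] [q ->]; exists (p * q); apply/funext => b; rewrite mevalM.
- by apply: Vp => b Vb; rewrite mevalM fg.
exists K, (ev_cst ev), (fun i => ev (fun b => b i)) => p.
rewrite -(ev_mpoly ev (fun b => b)); split=> [|pV]; last exact: ev0.
by apply: evV; exists p.
Qed.

Lemma locus_generic (K : fieldType) (iota : {rmorphism F -> K}) y :
  generic (@locus K iota y) iota y.
Proof.
move=> p; split=> [p0 b|pV]; first exact.
apply/eqP; apply: contrapT => /negP /(@nullstellensatz F)[b /eqP pb by0].
by apply: pb; apply: pV.
Qed.

(** Some fibre p = a of the locus of y still carries a generic point at which f is
    independent. The constant a is chosen so that the fibre contains, for every
    nonzero q in the tower of f, a point where q is not zero; then an ultrafilter
    on the fibre provides the generic point. *)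
Lemma specialize f p (K : fieldType) (iota : {rmorphism F -> K}) y :
  faithful (tower (p :: f)) iota y ->
  exists a (K' : fieldType) (iota' : {rmorphism F -> K'}) (y' : 'I_N -> K'),
    [/\ forall q, mmap iota y q = 0 -> mmap iota' y' q = 0,
        mmap iota' y' p = iota' a & faithful (tower f) iota' y'].
Proof.
move=> faith; pose T := tower f; pose T' := adjoin_ring T p.
pose j : {rmorphism {poly T} -> K} := mmap iota y \o pr_map T'.
have jc q : mmap (j \o pr_cst T') y q = mmap iota y q.
  by apply: eq_mmap => // c; apply: etrans (congr1 _ (pr_cstE T' c)) (mmapC _ _ _).
have [|g g0 hg] := @extend_to_point F K {poly T} (pr_cst T') j N y 1.
  by rewrite jc rmorph1 oner_neq0.
have g0' : g != 0 by apply: contraNneq g0 => ->; rewrite rmorph0.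
have [a ga] := nonroot_in (pr_cst T) g0'.
pose D := [set b | locus iota y b /\ p.@[b] = a].
(* The element g of the tower with outermost variable p is nonzero at p = a. A
   point of the tower of f where neither q nor this value is zero extends to a
   point of the locus. *)
have D_ex (q : T) : q != 0 -> exists2 b, D b & (pr_map T q).@[b] != 0.
  move=> q0; have [|phi phic phi0] := @pr_point _ _ T (q * g.[pr_cst T a]).
    by rewrite mulf_neq0.
  move: phi0; rewrite rmorphM mulf_eq0 negb_or => /andP[phiq phig].
  pose phi1 : {rmorphism {poly T} -> F} := horner_eval a \o map_poly phi.
  have phi1C t : phi1 t%:P = phi t.
    by rewrite /phi1 /= map_polyC /horner_eval hornerC.
  have [|||b _ hb] := hg phi1.
  - by move=> c; change (phi1 (pr_cst T c)%:P = c); rewrite phi1C.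
  - by move=> t jt; rewrite (faith t jt) rmorph0.
  - by rewrite /phi1 /= /horner_eval -[a]phic horner_map.
  exists b.
    split=> [v v0|].
      by rewrite -(hb 0) ?rmorph0 // jc v0.
    rewrite -(hb 'X).
      by change ((map_poly phi 'X).[a] = a); rewrite map_polyX hornerX.
    by rewrite jc [j _](tower_value iota y p) map_polyX hornerX.
  rewrite -(hb q%:P) ?phi1C // jc [j _](tower_value iota y p) map_polyC.
  by rewrite hornerC.
have D0 : D !=set0.
  by have [|b Db _] := D_ex 1; [exact: oner_neq0 | exists b].
have [b0 _] := D0.
have [|||K' [ev [ev0 evD]]] := @generic_field _ b0 _ D
  [set h | exists2 q : T, q != 0 & h = fun b => (pr_map T q).@[b]] _ _ D0.
- by exists 1; [exact: oner_neq0 | apply/funext => b; rewrite rmorph1 meval1].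
- move=> _ _ [q q0 ->] [q' q'0 ->]; exists (q * q'); first by rewrite mulf_neq0.
  by apply/funext => b; rewrite rmorphM mevalM.
- move=> _ _ [q q0 ->] [q' q'0 ->] qq0; have [|b Db] := D_ex (q * q').
    by rewrite mulf_neq0.
  by rewrite rmorphM mevalM qq0 // eqxx.
exists a, K', (ev_cst ev), (fun i => ev (fun b => b i)).
split=> [q q0||q].
- by rewrite -(ev_mpoly ev (fun b => b)) ev0 // => b [] /(_ q q0).
- have : mmap (ev_cst ev) (fun i => ev (fun b => b i)) (p - a%:MP) = 0.
    rewrite -(ev_mpoly ev (fun b => b)); apply: ev0 => b [_ pb].
    by rewrite mevalB mevalC pb subrr.
  by rewrite mmapB mmapC => /eqP; rewrite subr_eq0 => /eqP.
rewrite -(ev_mpoly ev (fun b => b)) => q0.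
apply/eqP; apply: contrapT => /negP qn0; have [b Db] := D_ex q qn0.
by rewrite (evD (fun b => (pr_map T q).@[b])) ?eqxx //; exists q.
Qed.
(** Iterating the specialization of the outermost parameter lowers V one step at
    a time: the i-th parameter is constant on V i.+1 and not on V i. *)
Lemma specialization_chain f (K : fieldType) (iota : {rmorphism F -> K}) y :
  faithful (tower f) iota y ->
  exists V : nat -> set ('I_N -> F),
    [/\ V 0 = locus iota y, forall i, (i <= size f)%N -> prime_set (V i)
      & forall i, (i < size f)%N -> V i.+1 `<=` V i /\
          exists a, vanish_on (f`_i - a%:MP) (V i.+1) /\
                    ~ vanish_on (f`_i - a%:MP) (V i)].
Proof.
elim: f K iota y => [|p f IHf] K iota y faith.
  exists (fun=> locus iota y); split=> // i _.
  exact: generic_prime (@locus_generic _ _ _).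
have [a [K' [iota' [y' [ker pa faith']]]]] := specialize faith.
have [V [V0 Vp Vs]] := IHf _ _ _ faith'.
exists (fun i => if i is i'.+1 then V i' else locus iota y); split=> //.
  case=> [_|i]; last exact: Vp.
  exact: generic_prime (@locus_generic _ _ _).
case=> [_|i /Vs //]; rewrite V0; split=> [b hb q /ker|]; first exact: hb.
exists a; split=> [|/locus_generic pa0].
  by apply/locus_generic; rewrite mmapB mmapC /= pa subrr.
pose T' := adjoin_ring (tower f) p.
have := faith ('X - (pr_cst (tower f) a)%:P).
rewrite (tower_value iota y p) rmorphB /= map_polyX map_polyC !hornerE /=.
move: pa0; rewrite pr_cstE mmapB => -> /(_ erefl)/eqP.
by rewrite polyXsubC_eq0.
Qed.

(** A power of the variable is divided out. *)
Lemma nonzero_constant_term (T : idomainType) (K : fieldType)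
    (j : {rmorphism T -> K}) (eta : K) (r : {poly T}) :
  eta != 0 -> r != 0 -> root (map_poly j r) eta ->
  exists2 r' : {poly T}, r'`_0 != 0 & root (map_poly j r') eta.
Proof.
move=> eta0; elim/poly_ind: r => [|r c IHr]; first by rewrite eqxx.
move=> r0 rr; have [c0|c0] := eqVneq c 0; last first.
  by exists (r * 'X + c%:P); rewrite // coefD coefMX coefC add0r.
move: r0 rr; rewrite c0 addr0 => r0 rr; apply: IHr.
  by apply: contraNneq r0 => ->; rewrite mul0r.
move: rr; rewrite /root rmorphM /= map_polyX hornerM hornerX mulf_eq0.
by rewrite (negPf eta0) orbF.
Qed.

Lemma faithful_generic (T : param_ring F N) V
    (K K' : fieldType) (iota : {rmorphism F -> K}) (iota' : {rmorphism F -> K'})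
    y y' : generic V iota y -> (forall p, mmap iota' y' p = 0 -> vanish_on p V) ->
  faithful T iota y -> faithful T iota' y'.
Proof. by move=> gV gV' faith a /gV'/gV; exact: faith. Qed.

(** Transcendence degrees increase strictly along a chain of irreducible sets.
    Suppose that on V d.+1 all coordinates are algebraic over those that are
    independent on V d, and let q vanish on V d but not on V d.+1. Then q
    satisfies on V d.+1 an algebraic equation with nonzero constant term, and on
    V d this term gives a relation between the independent coordinates. *)
Lemma prime_chain_rank (V : nat -> set ('I_N -> F)) d :
  (forall i, (i <= d)%N -> prime_set (V i)) ->
  (forall i, (i < d)%N -> V i `<=` V i.+1 /\
     exists2 q, vanish_on q (V i) & ~ vanish_on q (V i.+1)) ->
  exists2 s : seq 'I_N, size s = d &
    forall (K : fieldType) (iota : {rmorphism F -> K}) y,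
      (forall p, mmap iota y p = 0 -> vanish_on p (V d)) ->
      faithful (tower (map (fun l => 'X_l) s)) iota y.
Proof.
elim: d => [|d IHd] Vp Vs.
  by exists [::] => // K iota y _; apply/tower_faithful.
have [i le_i|i lt_i|s sd hs] := IHd.
- by apply: Vp; apply: leqW.
- by apply: Vs; apply: leqW.
have [KQ [iQ [yQ gQ]]] := prime_generic (Vp d (leqnSn d)).
have [KP [iP [yP gP]]] := prime_generic (Vp d.+1 (leqnn _)).
have [sub [q qQ qP]] := Vs d (leqnn _).
have faithQ : faithful (tower (map (fun l => 'X_l) s)) iQ yQ.
  by apply: hs => p /gQ.
have faithP : faithful (tower (map (fun l => 'X_l) s)) iP yP.
  by apply: hs => p /gP pV b /sub; exact: pV.
set t := map _ s in faithQ faithP.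
have [l nl] : exists l, ~ acl iP [set` map (mmap iP yP) t] (yP l).
  apply: contrapT => /forallNP hl; have {}hl l := contrapT (hl l).
  have [r r0 rq] := tower_algebraic (acl_mmap q hl).
  have [|r' r'0 r'q] := nonzero_constant_term _ r0 rq.
    by apply/eqP => /gP.
  pose W : {mpoly F[N]} := (map_poly (pr_map (tower t)) r').[q].
  have WE (K : fieldType) (iota : {rmorphism F -> K}) y :
      mmap iota y W = (map_poly (mmap iota y \o pr_map (tower t)) r').[mmap iota y q].
    by rewrite -(tower_value iota y q).
  have /gQ : vanish_on W (V d).
    by move=> b /sub; apply: (gP W).1; rewrite WE; exact/eqP.
  rewrite WE ((gQ q).2 qQ) horner_coef0 coef_map => /faithQ r'00.
  by rewrite r'00 eqxx in r'0.
exists (l :: s) => [|K iota y gK]; first by rewrite /= sd.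
apply: (faithful_generic gP gK).
apply/tower_faithful; rewrite map_cons rev_cons map_rcons; apply/indep_rcons.
split; first exact/tower_faithful.
rewrite mmapX mmap1U => h; apply: nl; apply: acl_mono h => x.
by case=> //=; rewrite map_rev mem_rev.
Qed.

End Specialization.

(** * Homogeneous polynomials and regular functions *)

Lemma mpoly_elim (R : comNzRingType) N (P : {mpoly R[N]} -> Prop) :
  (forall c, P c%:MP) -> (forall i, P 'X_i) ->
  (forall p q, P p -> P q -> P (p + q)) -> (forall p q, P p -> P q -> P (p * q)) ->
  forall p, P p.
Proof.
move=> PC PX PD PM; elim/mpolyind => [|c m p _ _ Pp].
  by rewrite -mpolyC0; exact: PC.
apply: (PD) => //; rewrite -mul_mpolyC; apply: (PM) => //.
rewrite mpolyXE_id; apply: (big_ind P); [exact: (PC 1) | by move=> ? ? ? ?; exact: PM |].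
move=> i _; elim: (m i) => [|e IHe]; first by rewrite expr0; exact: (PC 1).
by rewrite exprS; exact: PM.
Qed.

Section Points.
Context {R : realType} {n : nat}.
Local Notation C := R[i].
Local Notation P := (projective_space R n).
Implicit Types (X Z U : set P) (x y : P) (p q g h : {mpoly C[n.+1]}).

Definition homogeneous p := exists d, p \is d.-homog.

Lemma homogM p q : homogeneous p -> homogeneous q -> homogeneous (p * q).
Proof. by move=> [d hd] [e he]; exists (d + e)%N; exact: dhomogM. Qed.

Lemma homog_prod (I : Type) (r : seq I) (Q : pred I) (f : I -> {mpoly C[n.+1]}) :
  (forall i, Q i -> homogeneous (f i)) -> homogeneous (\prod_(i <- r | Q i) f i).
Proof.
move=> h; elim/big_ind: _ => //; last exact: homogM.
by exists 0; exact: dhomog1.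
Qed.

(** For a homogeneous p this is independent of the representative of x. *)
Definition nonzero_at p x := exists2 v, v \in val x & coord_eval p v != 0.

Lemma nonzero_at_rep p x v : homogeneous p -> nonzero_at p x -> v \in val x -> v != 0 ->
  coord_eval p v != 0.
Proof.
move=> [d hd] [w wx pw] vx v0; have [c wE] := line_colinear vx v0 wx.
by apply: contraNneq pw => pv; rewrite wE (coord_evalZ _ _ hd) pv mulr0.
Qed.

Lemma nonzero_atM p q x : homogeneous p -> homogeneous q ->
  nonzero_at p x -> nonzero_at q x -> nonzero_at (p * q) x.
Proof.
move=> hp hq px qx; have [v vx v0] := line_neq0 x; exists v => //.
by rewrite coord_evalM mulf_neq0 // ?(nonzero_at_rep hp px) // (nonzero_at_rep hq qx).
Qed.

Lemma nonzero_at_Ml p q x : nonzero_at (p * q) x -> nonzero_at p x.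
Proof.
move=> [v vx]; rewrite coord_evalM mulf_eq0 negb_or => /andP[pv _].
by exists v.
Qed.

Lemma nonzero_at_Mr p q x : nonzero_at (p * q) x -> nonzero_at q x.
Proof. by rewrite mulrC; exact: nonzero_at_Ml. Qed.

Lemma nonzero_at_prod (I : eqType) (r : seq I) (Q : pred I) (f : I -> {mpoly C[n.+1]}) x :
  (forall i, Q i -> homogeneous (f i)) -> (forall i, Q i -> nonzero_at (f i) x) ->
  nonzero_at (\prod_(i <- r | Q i) f i) x.
Proof.
move=> hf fx; suff [] : homogeneous (\prod_(i <- r | Q i) f i) /\
  nonzero_at (\prod_(i <- r | Q i) f i) x by [].
elim/big_ind: _ => [|p q [hp px] [hq qx]|i Qi].
- split; first by exists 0; exact: dhomog1.
  have [v vx _] := line_neq0 x; exists v => //.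
  by rewrite /coord_eval meval1 oner_neq0.
- by split; [exact: homogM | exact: nonzero_atM].
- by split; [exact: hf | exact: fx].
Qed.

Lemma nonzero_at_factor (I : finType) (Q : pred I) (f : I -> {mpoly C[n.+1]}) x i :
  Q i -> nonzero_at (\prod_(i | Q i) f i) x -> nonzero_at (f i) x.
Proof. by move=> Qi; rewrite (bigD1 i) //=; exact: nonzero_at_Ml. Qed.

Lemma zclosed_homog p : homogeneous p -> zclosed [set x | ~ nonzero_at p x].
Proof.
move=> hp; exists [set p]; split; first by move=> _ ->.
apply/seteqP; split=> x /=.
  move=> npx _ -> v vx; apply/eqP; apply: contrapT => /negP pv.
  by apply: npx; exists v.
by move=> h [v vx]; rewrite (h p erefl v vx) eqxx.
Qed.

Lemma zclosed_avoid Z x : zclosed Z -> ~ Z x ->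
  exists g, [/\ homogeneous g, nonzero_at g x & forall y, Z y -> ~ nonzero_at g y].
Proof.
move=> [S [hS ->]] /= /existsNP[g /not_implyP[Sg /existsNP[v]]].
move=> /not_implyP[vx /eqP gv]; exists g; split; first exact: hS.
  by exists v.
by move=> y h [w wy]; rewrite (h g Sg w wy) eqxx.
Qed.

(** Finitely many regular functions have fractions with a common denominator
    near x; the equations of the complements of their domains are put in this
    denominator. *)
Lemma regular_local X (I : finType) (U : I -> set P) (f : I -> P -> C) x :
  (forall i, zopen_in X (U i)) -> (forall i, U i x) ->
  (forall i, regular_on (U i) (f i)) ->
  exists (p : I -> {mpoly C[n.+1]}) q d, [/\ forall i, p i \is d.-homog,
    q \is d.-homog, nonzero_at q x &
    forall y, X y -> nonzero_at q y -> forall i, U i y /\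
      forall v, v \in val y -> v != 0 ->
        f i y = coord_eval (p i) v / coord_eval q v].
Proof.
move=> oU Ux rf.
have loc i : exists t : {mpoly C[n.+1]} * {mpoly C[n.+1]} * nat,
    [/\ t.1.1 \is t.2.-homog, t.1.2 \is t.2.-homog, nonzero_at t.1.2 x &
      forall y, X y -> nonzero_at t.1.2 y -> U i y /\
      forall v, v \in val y -> v != 0 ->
        f i y = coord_eval t.1.1 v / coord_eval t.1.2 v].
  have [d [p [q [Z [hp hq hZ Zx h]]]]] := rf i x (Ux i).
  have [Z' hZ' UE] := oU i.
  have nZx : ~ (Z `|` Z') x.
    by case=> // Z'x; have := Ux i; rewrite UE; case.
  have [g [[e he] gx gZ]] := zclosed_avoid (zclosedU hZ hZ') nZx.
  exists (p * g, q * g, (d + e)%N); split=> /=; try exact: dhomogM.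
    apply: nonzero_atM => //; [by exists d | by exists e |].
    have [v vx v0] := line_neq0 x; exists v => //.
    by have [] := h x (Ux i) Zx v vx v0.
  move=> y Xy qgy; have gy := nonzero_at_Mr qgy.
  have [nZ nZ'] : ~ Z y /\ ~ Z' y.
    by split=> Zy; apply: (gZ y _ gy); [left | right].
  have Uy : U i y by rewrite UE.
  split=> // v vy v0; have [q0 ->] := h y Uy nZ v vy v0.
  by rewrite !coord_evalM -mulf_div divff ?mulr1 // (nonzero_at_rep _ gy) //; exists e.
have [t tP] := choice loc.
have th1 i : (t i).1.1 \is (t i).2.-homog by have [] := tP i.
have th2 i : (t i).1.2 \is (t i).2.-homog by have [] := tP i.
exists (fun i => (t i).1.1 * \prod_(j | j != i) (t j).1.2), (\prod_j (t j).1.2).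
exists (\sum_j (t j).2)%N.
have hprod (Q : pred I) : \prod_(j | Q j) (t j).1.2 \is (\sum_(j | Q j) (t j).2)%N.-homog.
  apply: (big_rec2 (fun a b => a \is b.-homog)); first exact: dhomog1.
  by move=> i e a _; apply: dhomogM.
split=> [i|||y Xy qy i].
- by rewrite [(\sum_j _)%N](bigD1 i) //=; apply: dhomogM.
- exact: hprod.
- by apply: nonzero_at_prod => i _; [exists (t i).2 | have [] := tP i].
have [_ _ _ /(_ y Xy) hi] := tP i.
have qiy : nonzero_at (t i).1.2 y by exact: nonzero_at_factor qy.
have [Uy fE] := hi qiy; split=> // v vy v0; rewrite (fE v vy v0).
move: qy; rewrite (bigD1 i) //= => qy.
rewrite !coord_evalM -mulf_div divff ?mulr1 //.
by apply: (nonzero_at_rep _ (nonzero_at_Mr qy) vy v0); apply: homog_prod => j _; exists (t j).2.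
Qed.

End Points.

(** * Affine charts *)

Section Charts.
Context {R : realType} {n : nat}.
Local Notation C := R[i].
Local Notation P := (projective_space R n).
Implicit Types (X Z U : set P) (x y : P) (p q g h : {mpoly C[n.+1]}).

(** An affine open subset of X with the coordinates that make it a closed
    irreducible subset of an affine space. *)
Record chart X := Chart {
  ch_dim : nat;
  ch_coord : P -> 'I_ch_dim -> C;
  ch_dom : set P;
  ch_open : zopen_in X ch_dom;
  ch_prime : prime_set (ch_coord @` ch_dom);
  ch_closed : forall b,
    (forall p : {mpoly C[ch_dim]}, vanish_on p (ch_coord @` ch_dom) -> p.@[b] = 0) ->
    (ch_coord @` ch_dom) b }.

Arguments ch_coord {X} c _ _.

Lemma dhomog_var (j : 'I_n.+1) : ('X_j : {mpoly C[n.+1]}) \is 1.-homog.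
Proof. by rewrite dhomogX; apply/eqP; exact: mdeg1. Qed.

(** The coordinates of the open set where h and the l-th homogeneous coordinate do
    not vanish: the homogeneous coordinates, normalized by the l-th one, and in
    position 0 the inverse of h, which makes the open set closed. *)
Section Coordinates.
Variables (h : {mpoly C[n.+1]}) (l : 'I_n.+1).
Hypothesis hh : homogeneous h.

Definition normalized y : 'rV[C]_n.+1 :=
  let v := vpick (val y) in (v 0 l)^-1 *: v.

Definition affine_coord (v : 'rV[C]_n.+1) (i : 'I_n.+2) : C :=
  if unlift ord0 i is Some j then v 0 j else (coord_eval h v)^-1.

Lemma affine_coord0 v : affine_coord v ord0 = (coord_eval h v)^-1.
Proof. by rewrite /affine_coord unlift_none. Qed.

Lemma affine_coordS v j : affine_coord v (lift ord0 j) = v 0 j.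
Proof. by rewrite /affine_coord liftK. Qed.

Definition chart_domain X := [set y | X y /\ nonzero_at ('X_l * h) y].

Lemma normalizedP y : nonzero_at 'X_l y -> normalized y \in val y /\ normalized y 0 l = 1.
Proof.
move=> ly; split; first by rewrite memvZ ?memv_pick.
have [v vy v0] := line_neq0 y.
have := @nonzero_at_rep _ _ 'X_l y (vpick (val y)) _ ly (memv_pick _).
rewrite /coord_eval mevalXU => pl; rewrite mxE mulVf //; apply: pl.
  by exists 1%N; exact: dhomog_var.
by rewrite vpick0 -dimv_eq0 (eqP (valP y)).
Qed.

Lemma normalized_unique y v : v \in val y -> v 0 l = 1 -> normalized y = v.
Proof.
move=> vy vl; have v0 : v != 0.
  by apply: contra_eq_neq vl => ->; rewrite mxE eq_sym oner_neq0.
have [|wy wl] := @normalizedP y.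
  by exists v => //; rewrite /coord_eval mevalXU vl oner_neq0.
have [c wE] := line_colinear vy v0 wy; rewrite wE.
by move: wl; rewrite wE mxE vl mulr1 => ->; rewrite scale1r.
Qed.

Lemma chart_domainP X y : chart_domain X y ->
  [/\ X y, normalized y \in val y, normalized y 0 l = 1, normalized y != 0
    & coord_eval h (normalized y) != 0].
Proof.
move=> [Xy lhy]; have [ny nl] := normalizedP (nonzero_at_Ml lhy).
have n0 : normalized y != 0.
  by apply: contra_eq_neq nl => ->; rewrite mxE eq_sym oner_neq0.
by split=> //; exact: nonzero_at_rep (nonzero_at_Mr lhy) ny n0.
Qed.

(** On the chart, equations in the affine coordinates are homogeneous equations:
    denominators are cleared with powers of h, and degrees are adjusted with
    powers of the l-th coordinate. *)
Lemma homogenize (p : {mpoly C[n.+2]}) : exists q d k, q \is d.-homog /\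
  forall v : 'rV[C]_n.+1, v 0 l = 1 -> coord_eval h v != 0 ->
    coord_eval q v = p.@[affine_coord v] * coord_eval h v ^+ k.
Proof.
have [e he] := hh; elim/mpoly_elim: p => [c|i|p q|p q].
- exists c%:MP, 0, 0; split.
    by rewrite -[c%:MP]mulr1 mul_mpolyC dhomogZ // dhomog1.
  by move=> v _ _; rewrite /coord_eval !mevalC mulr1.
- case: (unliftP ord0 i) => [j|] ->.
    exists 'X_j, 1%N, 0; split; first by exact: dhomog_var.
    by move=> v _ _; rewrite /coord_eval !mevalXU affine_coordS mulr1.
  exists 1, 0, 1%N; split; first exact: dhomog1.
  move=> v _ hv; rewrite {1}/coord_eval meval1 mevalXU affine_coord0.
  by rewrite expr1 mulVf.
- move=> [p' [d [k [hp' pE]]]] [q' [d' [k' [hq' qE]]]].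
  exists (p' * h ^+ k' * 'X_l ^+ (d' + e * k) + q' * h ^+ k * 'X_l ^+ (d + e * k')).
  exists (d + e * k' + (d' + e * k))%N, (k + k')%N.
  have hX m : ('X_l : {mpoly C[n.+1]}) ^+ m \is m.-homog.
    by rewrite -[X in X.-homog]mul1n; apply: dhomogMn; exact: dhomog_var.
  split.
    apply: dhomogD.
      exact: dhomogM (dhomogM hp' (dhomogMn _ he)) (hX _).
    rewrite [X in X.-homog]addnC.
    exact: dhomogM (dhomogM hq' (dhomogMn _ he)) (hX _).
  move=> v vl hv; have := pE v vl hv; have := qE v vl hv.
  rewrite /coord_eval !(rmorphD, rmorphM, rmorphXn) /= => -> ->.
  by rewrite mevalXU vl !expr1n !mulr1 mulrDl exprD !mulrA [in X in _ + X]mulrAC.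
- move=> [p' [d [k [hp' pE]]]] [q' [d' [k' [hq' qE]]]].
  exists (p' * q'), (d + d')%N, (k + k')%N; split; first exact: dhomogM.
  move=> v vl hv; rewrite coord_evalM pE // qE // mevalM exprD.
  by rewrite mulrACA.
Qed.
Definition lift_poly (p : {mpoly C[n.+1]}) : {mpoly C[n.+2]} :=
  mmap (@mpolyC n.+2 C) (fun j => 'X_(lift ord0 j)) p.

Lemma meval_lift_poly p (b : 'I_n.+2 -> C) :
  (lift_poly p).@[b] = p.@[fun j => b (lift ord0 j)].
Proof.
rewrite /lift_poly (rmorph_mmap _ _ (meval b)).
by apply: eq_mmap => [c|j] /=; [exact: mevalC | exact: mevalXU].
Qed.

Lemma meval_affine p v : (lift_poly p).@[affine_coord v] = coord_eval p v.
Proof. by rewrite meval_lift_poly; apply: eq_mmap => // j; rewrite affine_coordS. Qed.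

Local Notation z := (fun y => affine_coord (normalized y)).

Lemma chart_domain_prime X x0 : irreducible zclosed X -> chart_domain X x0 ->
  prime_set (z @` chart_domain X).
Proof.
move=> [_ Xirr] Dx0; split; first by exists (z x0); exists x0.
move=> p q pq.
have hl : homogeneous ('X_l * h).
  by apply: homogM hh; exists 1%N; exact: dhomog_var.
have [p' [d [k [hp pE]]]] := homogenize p.
have [q' [d' [k' [hq qE]]]] := homogenize q.
have hp' : homogeneous p' by exists d.
have hq' : homogeneous q' by exists d'.
have vanish_of (r : {mpoly C[n.+2]}) r' k0 : homogeneous r' ->
    (forall v : 'rV[C]_n.+1, v 0 l = 1 -> coord_eval h v != 0 ->
      coord_eval r' v = r.@[affine_coord v] * coord_eval h v ^+ k0) ->
    X `<=` [set y | ~ nonzero_at r' y] -> vanish_on r (z @` chart_domain X).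
  move=> hr rE Xr _ [y Dy <-]; have [Xy ny nl n0 hy] := chart_domainP Dy.
  have : coord_eval r' (normalized y) = 0.
    by apply/eqP; apply: contrapT => /negP ry; apply: (Xr y Xy); exists (normalized y).
  by move=> /eqP; rewrite rE // mulf_eq0 (negPf (expf_neq0 _ hy)) orbF => /eqP.
have nX : ~ X `<=` [set y | ~ nonzero_at ('X_l * h) y].
  by case: Dx0 => Xx0 hx0 /(_ x0 Xx0); apply.
have cover : X `<=` [set y | ~ nonzero_at ('X_l * h) y] `|`
    ([set y | ~ nonzero_at p' y] `|` [set y | ~ nonzero_at q' y]).
  move=> y Xy; have [hy|] := pselect (nonzero_at ('X_l * h) y); last by left.
  right; have Dy : chart_domain X y by [].
  have [_ ny nl n0 hy0] := chart_domainP Dy.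
  have /eqP : (p * q).@[z y] = 0 by apply: pq; exists y.
  rewrite mevalM mulf_eq0 => /orP[/eqP p0|/eqP q0].
    left=> py; have := nonzero_at_rep hp' py ny n0.
    by rewrite pE // p0 mul0r eqxx.
  right=> qy; have := nonzero_at_rep hq' qy ny n0.
  by rewrite qE // q0 mul0r eqxx.
have [//|Xpq] := Xirr _ _ (zclosed_homog hl)
  (zclosedU (zclosed_homog hp') (zclosed_homog hq')) cover.
have [Xp|Xq] := Xirr _ _ (zclosed_homog hp') (zclosed_homog hq') Xpq.
  by left; exact: vanish_of hp' pE Xp.
by right; exact: vanish_of hq' qE Xq.
Qed.

Lemma chart_domain_closed Z1 Z2 (b : 'I_n.+2 -> C) :
  zclosed Z1 -> (forall y, Z2 y -> ~ nonzero_at h y) ->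
  (forall p : {mpoly C[n.+2]},
     vanish_on p (z @` chart_domain (Z1 `\` Z2)) -> p.@[b] = 0) ->
  (z @` chart_domain (Z1 `\` Z2)) b.
Proof.
move=> [S [hS ->]] hZ2 hb; pose v : 'rV[C]_n.+1 := \row_j b (lift ord0 j).
have vE p : (lift_poly p).@[b] = coord_eval p v.
  by rewrite meval_lift_poly; apply: eq_mmap => // j; rewrite mxE.
have vl : v 0 l = 1.
  rewrite mxE; have := hb ('X_(lift ord0 l) - 1).
  rewrite mevalB meval1 mevalXU => h0; apply/eqP; rewrite -subr_eq0; apply/eqP.
  apply: h0 => _ [y /chart_domainP[_ _ nl _ _] <-].
  by rewrite mevalB meval1 mevalXU affine_coordS nl subrr.
have bv : b ord0 * coord_eval h v = 1.
  have := hb ('X_ord0 * lift_poly h - 1).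
  rewrite mevalB mevalM meval1 mevalXU vE => h0; apply/eqP; rewrite -subr_eq0.
  apply/eqP; apply: h0 => _ [y /chart_domainP[_ _ _ _ hy] <-].
  by rewrite mevalB mevalM meval1 mevalXU meval_affine affine_coord0 mulVf // subrr.
have hv : coord_eval h v != 0.
  by apply: contra_eq_neq bv => ->; rewrite mulr0 eq_sym oner_neq0.
have v0 : v != 0 by apply: contra_eq_neq vl => ->; rewrite mxE eq_sym oner_neq0.
have dv : \dim <[v]> == 1%N by rewrite dim_vline v0.
pose y : P := exist _ <[v]>%VS dv.
have vy : v \in val y by exact: memv_line.
have ny : normalized y = v by exact: normalized_unique.
have hy : nonzero_at h y by exists v.
exists y.
  split; last first.
    apply: nonzero_atM => //; first by exists 1%N; exact: dhomog_var.
    by exists v => //; rewrite /coord_eval mevalXU vl oner_neq0.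
  split=> [p Sp w /vlineP[c ->]|/hZ2 //].
  have [d hd] := hS p Sp; rewrite (coord_evalZ _ _ hd) -vE hb ?mulr0 //.
  move=> _ [y' /chart_domainP[[Zy' _] ny' _ _ _] <-].
  by rewrite meval_affine; apply: Zy'.
apply/funext => i; rewrite ny; case: (unliftP ord0 i) => [j|] ->.
  by rewrite affine_coordS mxE.
by rewrite affine_coord0; apply: (mulIf hv); rewrite bv mulVf.
Qed.

End Coordinates.

(** The polynomial h that defines the chart is a multiple of a common denominator
    of the f i, of the numerators of those that do not vanish at x0 and of an
    equation of the boundary of X. All of these are thus invertible on the
    chart. *)
Lemma local_chart X x0 (I : finType) (U : I -> set P) (f : I -> P -> C) :
  quasi_projective X -> irreducible zclosed X -> X x0 ->
  (forall i, zopen_in X (U i)) -> (forall i, U i x0) ->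
  (forall i, regular_on (U i) (f i)) ->
  exists c : chart X, [/\ ch_dom c x0,
    forall i, ch_dom c `<=` U i,
    forall i, exists p : {mpoly C[ch_dim c]}, forall y, ch_dom c y ->
      f i y = p.@[ch_coord c y] &
    forall i, f i x0 != 0 -> exists p : {mpoly C[ch_dim c]}, forall y,
      ch_dom c y -> f i y * p.@[ch_coord c y] = 1].
Proof.
move=> [Z1 [Z2 [cZ1 cZ2 XE]]] Xirr Xx0 oU Ux rf.
have [p [q [d [hp hq qx fE]]]] := regular_local oU Ux rf.
have hp' i : homogeneous (p i) by exists d.
have hq' : homogeneous q by exists d.
have [h2 [hh2 h2x h2Z]] : exists g, [/\ homogeneous g, nonzero_at g x0 &
    forall y, Z2 y -> ~ nonzero_at g y].
  by apply: zclosed_avoid => //; move: Xx0; rewrite XE; case.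
have [v vx v0] := line_neq0 x0.
have [l vl] : exists l, v 0 l != 0.
  by apply/rV0Pn.
pose pr := \prod_(i | f i x0 != 0) p i.
have hpr : homogeneous pr by apply: homog_prod.
pose h := q * (pr * h2).
have hh : homogeneous h by apply: homogM => //; exact: homogM.
have prx : nonzero_at pr x0.
  apply: nonzero_at_prod => // i fi; exists v => //; apply: contraNneq fi => pv.
  by have [_ fx] := fE x0 Xx0 qx i; rewrite (fx v vx v0) pv mul0r.
have Dx0 : chart_domain h l X x0.
  split; first exact: Xx0.
  apply: nonzero_atM hh _ _; first by exists 1%N; exact: dhomog_var.
    by exists v => //; rewrite /coord_eval mevalXU.
  by apply: nonzero_atM hq' (homogM hpr hh2) qx _; exact: nonzero_atM.
have hZ2 y : Z2 y -> ~ nonzero_at h y by move=> /h2Z h2y /nonzero_at_Mr/nonzero_at_Mr.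
have oD : zopen_in X (chart_domain h l X).
  exists [set y | ~ nonzero_at ('X_l * h) y].
    by apply/zclosed_homog/homogM => //; exists 1%N; exact: dhomog_var.
  apply/seteqP; split=> y [Xy hy]; split; [exact: Xy | | exact: Xy |].
    by move=> nh; exact: nh hy.
  exact: contrapT hy.
have cD b : (forall p : {mpoly C[n.+2]},
    vanish_on p ((fun y => affine_coord h (normalized l y)) @` chart_domain h l X) ->
    p.@[b] = 0) ->
    ((fun y => affine_coord h (normalized l y)) @` chart_domain h l X) b.
  by rewrite XE; apply: chart_domain_closed.
exists (Chart oD (chart_domain_prime hh Xirr Dx0) cD) => /=; split=> //.
- by move=> i y [Xy /nonzero_at_Mr/nonzero_at_Ml qy]; have [] := fE y Xy qy i.
- move=> i; exists (lift_poly (p i * (pr * h2)) * 'X_ord0) => y Dy.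
  have [Xy ny nl n0 hy] := chart_domainP hh Dy.
  have [_ fy] := fE y Xy (nonzero_at_Ml (nonzero_at_Mr Dy.2)) i; rewrite (fy _ ny n0).
  rewrite mevalM mevalXU meval_affine affine_coord0 !coord_evalM.
  move: hy; rewrite !coord_evalM mulf_eq0 negb_or => /andP[hq0 hr0].
  by rewrite -mulf_div divff // mulr1.
move=> i fi; pose pr' := \prod_(j | (f j x0 != 0) && (j != i)) p j.
exists (lift_poly (q * (q * pr' * h2)) * 'X_ord0) => y Dy.
have [Xy ny nl n0 hy] := chart_domainP hh Dy.
have [_ fy] := fE y Xy (nonzero_at_Ml (nonzero_at_Mr Dy.2)) i; rewrite (fy _ ny n0).
rewrite mevalM mevalXU meval_affine affine_coord0.
have hE : h = q * (p i * pr' * h2) by rewrite /h /pr (bigD1 i).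
move: hy; rewrite hE !coord_evalM.
move: (coord_eval q _) (coord_eval (p i) _) (coord_eval pr' _) (coord_eval h2 _).
move=> u v1 w1 t; rewrite !mulf_eq0 !negb_or.
case/andP=> u0 /andP[/andP[v10 w10] t0].
by field; rewrite u0 v10 w10 t0.
Qed.

End Charts.

Arguments ch_coord {R n X} c _ _.

(** * Homogenization, and evaluation at the generic point of a chart *)

Lemma ev_ext (T : Type) (F K : fieldType) (ev : evaluation T F K) (D : set T) f g :
  (forall h, (forall x, D x -> h x = 0) -> ev h = 0) ->
  (forall x, D x -> f x = g x) -> ev f = ev g.
Proof.
move=> ev0 fg; have := ev0 (fun x => f x + -1 * g x).
rewrite evD evM ev_c rmorphN1 mulN1r => h.
by apply/eqP; rewrite -subr_eq0 h // => x Dx; rewrite fg // mulN1r subrr.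
Qed.

Lemma homogeneous_scale (R : comNzRingType) m d (p : {mpoly R[m]}) c (u : 'I_m -> R) :
  p \is d.-homog -> p.@[fun i => c * u i] = c ^+ d * p.@[u].
Proof.
move=> /dhomogP hp; rewrite !mevalE mulr_sumr.
apply: eq_big_seq => k /hp hk; rewrite mulrCA; congr (_ * _).
rewrite -hk /= mdegE -prodrXr -big_split /=.
by apply: eq_bigr => i _; rewrite exprMn.
Qed.

Lemma homogeneous_comp (R : comNzRingType) m N d e (p : {mpoly R[m]})
    (q : 'I_m -> {mpoly R[N]}) :
  p \is d.-homog -> (forall i, q i \is e.-homog) ->
  mmap (@mpolyC N R) q p \is (d * e).-homog.
Proof.
move=> /dhomogP hp hq; rewrite /mmap big_seq; apply: rpred_sum => k /hp hk.
rewrite mul_mpolyC; apply: dhomogZ; rewrite -hk /= mdegE big_distrl /=.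
apply: (big_rec2 (fun a b => a \is b.-homog)); first exact: dhomog1.
move=> i a b _ hb; apply: dhomogM => //; rewrite mulnC; exact: dhomogMn.
Qed.

(** The homogenization by one more variable, at the values in any extension
    field. *)
Lemma homogenize_by (F : fieldType) m (p : {mpoly F[m]}) :
  exists (q : {mpoly F[m.+1]}) d, q \is d.-homog /\
    forall (K : fieldType) (iota : {rmorphism F -> K}) (u : 'I_m.+1 -> K),
      u ord0 != 0 ->
      mmap iota u q =
        mmap iota (fun j => u (lift ord0 j) / u ord0) p * u ord0 ^+ d.
Proof.
have var j : ('X_j : {mpoly F[m.+1]}) \is 1.-homog.
  by rewrite dhomogX; apply/eqP; exact: mdeg1.
have vark k : ('X_ord0 : {mpoly F[m.+1]}) ^+ k \is k.-homog.
  by rewrite -[X in X.-homog]mul1n; apply: dhomogMn.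
elim/mpoly_elim: p => [c|i|p p'|p p'].
- exists c%:MP, 0; split.
    by rewrite -[c%:MP]mulr1 mul_mpolyC dhomogZ // dhomog1.
  by move=> K iota u _; rewrite !mmapC mulr1.
- exists 'X_(lift ord0 i), 1%N; split=> // K iota u u0.
  by rewrite !mmapX !mmap1U expr1 divfK.
- move=> [q [d [hq qE]]] [q' [d' [hq' qE']]].
  exists (q * 'X_ord0 ^+ d' + q' * 'X_ord0 ^+ d), (d + d')%N; split.
    apply: dhomogD; first exact: dhomogM.
    by rewrite addnC; exact: dhomogM.
  move=> K iota u u0; rewrite !(rmorphD, rmorphM, rmorphXn) /= qE // qE' //.
  rewrite mmapX mmap1U exprD mulrDl -!mulrA; congr (_ + _ * _).
  by rewrite mulrC.
- move=> [q [d [hq qE]]] [q' [d' [hq' qE']]].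
  exists (q * q'), (d + d')%N; split; first exact: dhomogM.
  move=> K iota u u0; rewrite !rmorphM /= qE // qE' // exprD.
  by rewrite mulrACA.
Qed.

Section RegularFunctions.
Context {R : realType} {n : nat}.
Local Notation C := R[i].
Local Notation P := (projective_space R n).
Implicit Types (X U : set P) (f g : P -> C).

Lemma regular_on_cst U c : regular_on U (fun=> c).
Proof.
move=> x _; exists 0, c%:MP, 1, set0; split=> //.
- by rewrite -[c%:MP]mulr1 mul_mpolyC dhomogZ // dhomog1.
- exact: dhomog1.
- exact: zclosed0.
- by move=> y _ _ v _ _; rewrite /coord_eval mevalC meval1 divr1 oner_eq0.
Qed.

Lemma regular_onD U f g :
  regular_on U f -> regular_on U g -> regular_on U (fun x => f x + g x).
Proof.
move=> hf hg x Ux; have [d [p [q [Z [hp hq hZ Zx h]]]]] := hf _ Ux.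
have [d' [p' [q' [Z' [hp' hq' hZ' Zx' h']]]]] := hg _ Ux.
exists (d + d')%N, (p * q' + p' * q), (q * q'), (Z `|` Z').
split; try exact: dhomogM; try exact: zclosedU; last first.
- move=> y Uy /not_orP[nZ nZ'] v vy v0.
  have [q0 ->] := h _ Uy nZ _ vy v0; have [q0' ->] := h' _ Uy nZ' _ vy v0.
  by rewrite /coord_eval mevalD !mevalM mulf_neq0 // addf_div.
- by case.
by apply: dhomogD; [|rewrite addnC]; exact: dhomogM.
Qed.

Lemma chart_field X (c : chart X) :
  exists (K : fieldType) (ev : evaluation P C K),
    (forall f, (forall y, ch_dom c y -> f y = 0) -> ev f = 0) /\
    forall p : {mpoly C[ch_dim c]}, ev (fun y => p.@[ch_coord c y]) = 0 ->
      vanish_on p (ch_coord c @` ch_dom c).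
Proof.
have [[_ [y0 Dy0 _]] pc] := ch_prime c.
have [||||K [ev [ev0 evS]]] := @generic_field _ y0 _ (ch_dom c)
  [set f | exists p : {mpoly C[ch_dim c]}, f = fun y => p.@[ch_coord c y]].
- by exists 1; apply/funext => y; rewrite meval1.
- by move=> f g [p ->] [q ->]; exists (p * q); apply/funext => y; rewrite mevalM.
- by exists y0.
- move=> f g [p ->] [q ->] pq; have [|pV|qV] := pc p q.
  + by move=> _ [y Dy <-]; rewrite mevalM; exact: pq.
  + by left=> y Dy; apply: pV; exists y.
  + by right=> y Dy; apply: qV; exists y.
exists K, ev; split=> // p p0 _ [y Dy <-].
by apply: (evS (fun y => p.@[ch_coord c y])) => //; exists p.
Qed.

End RegularFunctions.

(** * The Kodaira map *)

Section LinearSpanTheory.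
Variables (F : fieldType) (V : lmodType F) (S : set V).

Lemma sub_lspan : S `<=` lspan S.
Proof.
move=> s Ss; exists 1%N, (fun=> 1), (fun=> s); split=> //.
by rewrite big_ord1 scale1r.
Qed.

Lemma lspan_lin a u v : lspan S u -> lspan S v -> lspan S (a *: u + v).
Proof.
move=> [m [c [b [Sb ->]]]] [m' [c' [b' [Sb' ->]]]].
exists (m + m')%N.
exists (fun l => match fintype.split l with inl i => a * c i | inr i => c' i end).
exists (fun l => match fintype.split l with inl i => b i | inr i => b' i end).
split=> [l|]; first by case: fintype.split.
rewrite big_split_ord /= scaler_sumr; congr (_ + _); apply: eq_bigr => i _.
  by have /= -> := unsplitK (inl i : 'I_m + 'I_m'); rewrite scalerA.
by have /= -> := unsplitK (inr i : 'I_m + 'I_m').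
Qed.

Lemma lspan_elim (Q : V -> Prop) : S `<=` Q -> Q 0 ->
  (forall a u v, Q u -> Q v -> Q (a *: u + v)) -> lspan S `<=` Q.
Proof.
move=> SQ Q0 QL _ [m [a [b [Sb ->]]]]; apply: big_rec => // i v _ Qv.
by apply: QL => //; exact: SQ.
Qed.

End LinearSpanTheory.

Section KodairaMap.
Context {R : realType} {n : nat} {X : set (projective_space R n)}.
Local Notation C := R[i].
Local Notation P := (projective_space R n).
Variables (I : finType) (E : I -> linear_series X).
Local Notation T := (tensor (fun i => ls_bundle (E i))).
Local Notation W := (@product_series R n X I E).
Local Notation kodaira := (@kodaira R n X I E).
Implicit Types (g : section T) (a : lb_index T) (x y : P).

Lemma product_series_global g : W g -> global_section g.
Proof.
apply: lspan_elim => [_ [s Es <-]||c u v [ru cu zu] [rv cv zv]].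
- by apply: tensor_section_global => i; exact: ls_global (Es i).
- split=> // [a|a b x _ _]; first exact: regular_on_cst.
  by rewrite mulr0.
- split=> [a|a b x ax bx|a x nax].
  + exact: regular_onD (regular_onM (regular_on_cst c) (ru a)) (rv a).
  + change (c * u a x + v a x = lb_trans a b x * (c * u b x + v b x)).
    by rewrite (cu a b) // (cv a b) // mulrDr mulrCA.
  + by change (c * u a x + v a x = 0); rewrite zu // zv // mulr0 addr0.
Qed.

Lemma product_series_tensor s : systems E s -> W (tensor_section s).
Proof. by move=> Es; apply: sub_lspan; exists s. Qed.

Lemma vanish_atE g a x : W g -> lb_open a x -> vanish_at g x <-> g a x = 0.
Proof.
move=> /product_series_global[_ cg _] ax; split=> [|g0 b bx]; first exact.
by rewrite (cg b a) // g0 mulr0.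
Qed.

Lemma kodairaE x a g : W g -> lb_open a x -> kodaira x g <-> g a x = 0.
Proof. by move=> Wg ax; rewrite -(vanish_atE Wg ax); split=> [[]|]. Qed.

Hypothesis E_bpf : forall i, base_point_free (E i).

Lemma nonvanishing_system x : X x -> exists e (a : lb_index T),
  [/\ systems E e, lb_open a x & forall i, e i (a i) x != 0].
Proof.
move=> Xx; have h i : exists t : section (ls_bundle (E i)) * lb_index (ls_bundle (E i)),
    [/\ ls_sections (E i) t.1, lb_open t.2 x & t.1 t.2 x != 0].
  have [s Es ns] := E_bpf i Xx.
  have [b /not_implyP[bx /eqP sb]] : exists b, ~ (lb_open b x -> s b x = 0).
    by apply/existsNP => h; apply: ns.
  by exists (s, b).
pose t i := sval (cid (h i)).
have tP i : [/\ ls_sections (E i) (t i).1, lb_open (t i).2 x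
    & (t i).1 (t i).2 x != 0] by rewrite /t; case: cid.
exists (fun i => (t i).1), (fun i => (t i).2); split=> [i||i].
- by have [] := tP i.
- by split=> // i _; have [] := tP i.
- by have [] := tP i.
Qed.

Lemma tensor_sectionE (s : system E) a x : lb_open a x ->
  tensor_section s a x = \prod_i s i (a i) x.
Proof. by move=> ax; rewrite /tensor_section asboolT. Qed.

Lemma evaluation_functional a x : functional W (fun g => g a x).
Proof. by []. Qed.

Lemma kodaira_kernel x a : lb_open a x ->
  kodaira x = W `&` [set g | g a x = 0].
Proof.
move=> ax; apply/seteqP; split=> g [Wg gx]; split=> //.
  exact/(vanish_atE Wg ax).
exact/(vanish_atE Wg ax).
Qed.

Lemma kodaira_hyperplane x : X x -> hyperplane W (kodaira x).
Proof.
move=> Xx; have [e [a [Ee ax ea]]] := nonvanishing_system Xx.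
exists (fun g => g a x); split; first exact: evaluation_functional.
  exists (tensor_section e); first exact: product_series_tensor.
  by rewrite tensor_sectionE //; apply/prodf_neq0 => i _.
exact: kodaira_kernel.
Qed.

(** All functionals with the kernel [kodaira x] are proportional to the
    evaluation at x. *)
Lemma dual_vanish_kodaira m d (p : {mpoly C[m]}) (g : 'I_m -> section T) x a :
  X x -> lb_open a x -> p \is d.-homog -> (forall l, W (g l)) ->
  dual_vanish W p g (kodaira x) <-> p.@[fun l => g l a x] = 0.
Proof.
move=> Xx ax hp Wg; split=> [|p0 phi hphi kphi].
  by move/(_ (fun g => g a x)); apply; [exact: evaluation_functional|exact: kodaira_kernel].
have [e [b [Ee bx eb]]] := nonvanishing_system Xx.
have Wte := product_series_tensor Ee.
have e0 : tensor_section e a x != 0.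
  apply/eqP => /(vanish_atE Wte ax) /(vanish_atE Wte bx) /eqP.
  by rewrite tensor_sectionE //; apply/negP/prodf_neq0 => i _.
have prop u : W u -> phi u = phi (tensor_section e) / tensor_section e a x * u a x.
  move=> Wu; pose c := u a x / tensor_section e a x.
  have Wv : W (- c *: tensor_section e + u) by exact: lspan_lin.
  have : kodaira x (- c *: tensor_section e + u).
    apply/(kodairaE Wv ax); change (- c * tensor_section e a x + u a x = 0).
    by rewrite mulNr divfK // addNr.
  rewrite kphi => -[_ /=]; rewrite hphi // mulNr addrC => /eqP.
  by rewrite subr_eq0 => /eqP ->; rewrite /c mulrC mulrA mulrAC.
rewrite (_ : (fun l => phi (g l)) = fun l =>
   phi (tensor_section e) / tensor_section e a x * g l a x); last first.
  by apply/funext => l; exact: prop.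
by rewrite (homogeneous_scale _ _ hp) p0 mulr0.
Qed.

(** A homogeneous relation between sections that holds on a nonempty open set
    holds everywhere, by irreducibility. *)
Lemma vanish_dense (D : set P) m d (p : {mpoly C[m]}) (g : 'I_m -> section T) :
  irreducible zclosed X -> zopen_in X D -> D !=set0 -> p \is d.-homog ->
  (forall l, W (g l)) ->
  (forall y, D y -> exists2 a, lb_open a y & p.@[fun l => g l a y] = 0) ->
  forall x a, lb_open a x -> p.@[fun l => g l a x] = 0.
Proof.
move=> [_ Xirr] [Z cZ DE] [y0 Dy0] hp Wg hD x a ax.
have Xx : X x by case: ax.
pose f (o : option 'I_m) := if o is Some l then g l a else fun=> 0.
have [|//||r [q [e [hr hq qx fE]]]] := @regular_local _ _ X _
  (fun _ : option 'I_m => tensor_open a) f x.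
- by move=> l; exact: tensor_openP.
- case=> [l|]; last exact: regular_on_cst.
  by have [rg _ _] := product_series_global (Wg l); exact: rg.
pose s := mmap (@mpolyC n.+1 C) (r \o Some) p.
have hs : s \is (d * e).-homog by apply: homogeneous_comp => // l; exact: hr.
have sE v : coord_eval s v = p.@[fun l => coord_eval (r (Some l)) v].
  rewrite /coord_eval /s (rmorph_mmap _ _ (meval (fun i => v 0 i))).
  by apply: eq_mmap => // c; exact: mevalC.
have hs' : homogeneous s by exists (d * e)%N.
have hq' : homogeneous q by exists e.
have sval y v : X y -> nonzero_at q y -> v \in val y -> v != 0 ->
    coord_eval s v = coord_eval q v ^+ d * p.@[fun l => g l a y].
  move=> Xy qy vy v0; rewrite sE -(homogeneous_scale _ _ hp).
  congr (_.@[_]); apply/funext => l.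
  have [_ fy] := fE y Xy qy (Some l); rewrite [g l a y](fy v vy v0).
  by rewrite mulrC divfK // (nonzero_at_rep hq' qy).
have cover : X `<=` (Z `|` [set y | ~ nonzero_at q y]) `|` [set y | ~ nonzero_at s y].
  move=> y Xy; have [Zy|nZy] := pselect (Z y); first by left; left.
  have [qy|] := pselect (nonzero_at q y); last by left; right.
  right=> sy; have [v vy v0] := line_neq0 y.
  have /eqP := nonzero_at_rep hs' sy vy v0; apply; rewrite (sval y v) //.
  have Dy : D y by rewrite DE.
  have [b bo pb] := hD y Dy; have [ay _] := fE y Xy qy None.
  rewrite (_ : (fun l => g l a y) = fun l => lb_trans a b y * g l b y).
    by rewrite (homogeneous_scale _ _ hp) pb !mulr0.
  apply/funext => l; have [_ cg _] := product_series_global (Wg l).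
  exact: cg.
have cZq := zclosedU cZ (zclosed_homog hq').
have [XZq|Xs] := Xirr _ _ cZq (zclosed_homog hs') cover.
  have [XZ|Xq] := Xirr _ _ cZ (zclosed_homog hq') XZq.
    by move: Dy0; rewrite DE => -[/XZ].
  by case: (Xq x Xx).
have [v vx v0] := line_neq0 x.
have : coord_eval s v = 0.
  by apply/eqP; apply: contrapT => /negP sv; apply: (Xs x Xx); exists v.
move=> /eqP; rewrite (sval x v) // mulf_eq0 expf_eq0 (negPf (nonzero_at_rep hq' qx vx v0)).
by rewrite andbF => /eqP.
Qed.

End KodairaMap.

(** * Dimension of the image of the Kodaira map *)

Section KodairaDimension.
Context {R : realType} {n : nat} {X : set (projective_space R n)}.
Local Notation C := R[i].
Local Notation P := (projective_space R n).

(** With the nowhere zero e i as units, the sections of the series become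
    functions on the chart, which are polynomials in its coordinates. *)
Definition adapted_chart (c : chart X) (I : finType) (E : I -> linear_series X)
    (a : forall i, lb_index (ls_bundle (E i))) (e : system E) : Prop :=
  [/\ forall i, ch_dom c `<=` lb_open (a i), systems E e,
      forall i s, ls_sections (E i) s -> exists p : {mpoly C[ch_dim c]},
        forall y, ch_dom c y -> s (a i) y = p.@[ch_coord c y]
    & forall i, exists p : {mpoly C[ch_dim c]},
        forall y, ch_dom c y -> e i (a i) y * p.@[ch_coord c y] = 1].

Variables (X_irr : irreducible zclosed X) (c : chart X).
Variables (K : fieldType) (ev : evaluation P C K).
Hypotheses (ev0 : forall f, (forall y, ch_dom c y -> f y = 0) -> ev f = 0)
  (evS : forall p : {mpoly C[ch_dim c]}, ev (fun y => p.@[ch_coord c y]) = 0 ->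
     vanish_on p (ch_coord c @` ch_dom c)).
Local Notation D := (ch_dom c).
Local Notation z := (ch_coord c).
Local Notation iota := (ev_cst ev).

Definition generic_coord (i : 'I_(ch_dim c)) : K := ev (fun y => z y i).

Lemma chart_generic : generic (z @` D) iota generic_coord.
Proof.
move=> p; rewrite -(ev_mpoly ev z); split=> [|pV]; first exact: evS.
by apply: ev0 => y Dy; apply: pV; exists y.
Qed.

Lemma chart_locus : locus iota generic_coord = z @` D.
Proof.
apply/seteqP; split=> [b lb|b Vb p /chart_generic]; last exact.
by apply: ch_closed => p /chart_generic; exact: lb.
Qed.

Lemma chart_nonempty : exists y, D y.
Proof. by have [[_ [y Dy _]] _] := ch_prime c; exists y. Qed.

Lemma chart_sub y : D y -> X y.
Proof. by have [Z _ ->] := ch_open c; case. Qed.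

Section Series.
Variables (I : finType) (E : I -> linear_series X).
Variables (a : forall i, lb_index (ls_bundle (E i))) (e : system E).
Arguments a : clear implicits.
Arguments e : clear implicits.
Hypothesis adE : adapted_chart c a e.
Hypothesis E_bpf : forall i, base_point_free (E i).
Local Notation T := (tensor (fun i => ls_bundle (E i))).
Local Notation W := (@product_series R n X I E).
Local Notation kodaira := (@kodaira R n X I E).
Local Notation te := (tensor_section e : section T).
Let ta : lb_index T := a.

Definition quotients i : set K :=
  [set v | exists2 s, ls_sections (E i) s & v = ev (s (a i)) / ev (e i (a i))].

Lemma ta_open y : D y -> lb_open ta y.
Proof. by have [Da _ _ _] := adE; move=> Dy; split=> [|i _]; [exact: chart_sub|exact: Da]. Qed.

Lemma product_series_poly g : W g ->
  exists p : {mpoly C[ch_dim c]}, forall y, D y -> g ta y = p.@[z y].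
Proof.
have [_ _ Ep _] := adE.
apply: (@lspan_elim _ _ _ (fun g : section T => exists p : {mpoly C[ch_dim c]},
  forall y, D y -> g ta y = p.@[z y])) => [_ [s Es <-]||k u v [p pE] [q qE]].
- have h i := cid (Ep i (s i) (Es i)).
  exists (\prod_i sval (h i)) => y Dy.
  rewrite tensor_sectionE; last exact: ta_open.
  by rewrite rmorph_prod; apply: eq_bigr => i _; case: (h i) => p /= ->.
- by exists 0 => y _; rewrite meval0.
- exists (k%:MP * p + q) => y Dy; rewrite mevalD mevalM mevalC -pE // -qE //.
Qed.

Lemma e_neq0 i y : D y -> e i (a i) y != 0.
Proof.
have [_ _ _ /(_ i)[p pE]] := adE; move=> Dy.
by apply: contra_eq_neq (pE y Dy) => ->; rewrite mul0r eq_sym oner_neq0.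
Qed.

Lemma ev_e_neq0 i : ev (e i (a i)) != 0.
Proof.
have [_ _ _ /(_ i)[p pE]] := adE.
have : ev (e i (a i)) * ev (fun y => p.@[z y]) = 1.
  by rewrite -evM -(rmorph1 iota) -ev_c; apply: (ev_ext ev0).
by move=> h; apply: contra_eq_neq h => ->; rewrite mul0r eq_sym oner_neq0.
Qed.

Lemma te_neq0 y : D y -> te ta y != 0.
Proof.
move=> Dy; rewrite tensor_sectionE; last exact: ta_open.
by apply/prodf_neq0 => i _; exact: e_neq0.
Qed.

Lemma ev_tensor (s : system E) : ev (tensor_section s ta) = \prod_i ev (s i (a i)).
Proof.
rewrite -ev_prod; apply: (ev_ext ev0) => y Dy.
by rewrite tensor_sectionE //; exact: ta_open.
Qed.

Lemma ev_te_neq0 : ev (te ta) != 0.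
Proof. by rewrite ev_tensor; apply/prodf_neq0 => i _; exact: ev_e_neq0. Qed.

(** Together with [quotient_section]: the quotients of products of sections and
    those of their factors generate the same field. *)
Lemma product_series_acl B g : (forall i, quotients i `<=` acl iota B) -> W g ->
  acl iota B (ev (g ta) / ev (te ta)).
Proof.
move=> QB; apply: (@lspan_elim _ _ _ (fun g : section T =>
  acl iota B (ev (g ta) / ev (te ta)))) => [_ [s Es <-]||k u v hu hv].
- rewrite !ev_tensor -prodf_div; apply: acl_prod => i _; apply: (QB i).
  by exists (s i).
- by rewrite ev0 // mul0r; exact: acl0.
- rewrite (_ : ev _ = iota k * ev (u ta) + ev (v ta)); last first.
    by rewrite -ev_c -evM -evD.
  by rewrite mulrDl -mulrA; apply: aclD => //; apply: aclM => //; exact: acl_cst.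
Qed.

(** A quotient s / e_i does not change when numerator and denominator are
    multiplied by the other e_j. *)
Lemma quotient_section v i : quotients i v -> exists g f,
  [/\ W g, v = mmap iota generic_coord f &
      forall y, D y -> f.@[z y] = g ta y / te ta y].
Proof.
have [_ Ee Ep Ei] := adE; move=> [s Es ->].
have [p pE] := Ep i s Es; have [q qE] := Ei i.
have pqE y : D y -> s (a i) y / e i (a i) y = (p * q).@[z y].
  move=> Dy; rewrite mevalM -pE //; congr (_ * _).
  by apply: (mulfI (e_neq0 i Dy)); rewrite qE // divff // e_neq0.
exists (tensor_section (dfwith e s)), (p * q); split.
- apply: product_series_tensor => j; have [ij|ij] := eqVneq i j.
    by case: j / ij; rewrite dfwith_in.
  by rewrite dfwith_out //; exact: Ee.
- rewrite -(ev_mpoly ev z) -(ev_ext ev0 pqE); apply: (mulIf (ev_e_neq0 i)).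
  rewrite divfK ?ev_e_neq0 // -evM; apply: (ev_ext ev0) => y Dy.
  by rewrite divfK // e_neq0.
- move=> y Dy; rewrite -pqE // !tensor_sectionE; try exact: ta_open.
  rewrite (bigD1 i) //= [X in _ = _ / X](bigD1 i) //= dfwith_in.
  have -> : \prod_(j | j != i) dfwith e s j (ta j) y =
      \prod_(j | j != i) e j (ta j) y.
    by apply: eq_bigr => j ij; rewrite dfwith_out // eq_sym.
  rewrite -mulf_div divff ?mulr1 //.
  by apply/prodf_neq0 => j _; exact: e_neq0.
Qed.

(** The closed sets of hyperplanes are handled through their equations: a
    homogeneous polynomial in finitely many elements of the series. *)
Definition dual_equation : Type :=
  {m : nat & ({mpoly C[m]} * ('I_m -> section T))%type}.

Definition good_equation (f : dual_equation) : Prop :=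
  (exists d, (tagged f).1 \is d.-homog) /\ forall l, W ((tagged f).2 l).

Local Notation holds f H := (dual_vanish W (tagged f).1 (tagged f).2 H).

Definition dual_closure (B : set (set (section T))) : set (set (section T)) :=
  [set H | hyperplane W H /\ forall f : dual_equation, good_equation f ->
     (forall H', B H' -> holds f H') -> holds f H].

Lemma dual_closure_closed B : dual_zclosed W (dual_closure B).
Proof.
exists [set f | good_equation f /\ forall H', B H' -> holds f H'].
split=> [f []//|]; apply/seteqP; split=> H [hH hf]; split=> //.
  by move=> f [gf Bf]; exact: hf.
by move=> f gf Bf; exact: hf.
Qed.

Lemma dual_closure_min B Z : dual_zclosed W Z -> B `<=` Z -> dual_closure B `<=` Z.
Proof.
move=> [S [hS ->]] BZ H [hH hf]; split=> // f Sf.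
apply: (hf f (hS f Sf)) => H' /BZ[_]; exact.
Qed.

Lemma sub_dual_closure B : (forall H, B H -> hyperplane W H) -> B `<=` dual_closure B.
Proof. by move=> hB H BH; split=> [|f _]; [exact: hB|apply]. Qed.

Lemma sections_poly m (p : {mpoly C[m]}) (g : 'I_m -> section T) :
  (forall l, W (g l)) -> exists q : {mpoly C[ch_dim c]},
    forall y, D y -> p.@[fun l => g l ta y] = q.@[z y].
Proof.
move=> Wg; pose h l := cid (product_series_poly (Wg l)).
exists (mmap (@mpolyC _ C) (fun l => sval (h l)) p) => y Dy.
rewrite (rmorph_mmap _ _ (meval (z y))).
apply: eq_mmap => [k|l] /=; first by rewrite mevalC.
by case: (h l) => q /= ->.
Qed.

Lemma equation_poly (f : dual_equation) : good_equation f ->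
  exists p : {mpoly C[ch_dim c]},
    forall y, D y -> holds f (kodaira y) <-> p.@[z y] = 0.
Proof.
move=> [[d hd] Wf]; have [p pE] := sections_poly (tagged f).1 Wf.
exists p => y Dy; rewrite -pE //.
by rewrite (dual_vanish_kodaira E_bpf (chart_sub Dy) (ta_open Dy) hd Wf).
Qed.

Definition kodaira_part (V : set ('I_(ch_dim c) -> C)) : set (set (section T)) :=
  [set H | exists y, [/\ D y, V (z y) & H = kodaira y]].

Definition kodaira_piece V : set (set (section T)) :=
  (kodaira @` X) `&` dual_closure (kodaira_part V).

Lemma sub_kodaira_piece V y : D y -> V (z y) -> kodaira_piece V (kodaira y).
Proof.
move=> Dy Vy; split; first by exists y => //; exact: chart_sub.
apply: sub_dual_closure; last by exists y.
by move=> _ [y' [/chart_sub Xy' _ ->]]; exact: kodaira_hyperplane.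
Qed.

(** An equation of hyperplanes is, on the chart, a polynomial equation for the
    points, so that the irreducibility of V passes to its image. *)
Lemma kodaira_piece_irreducible V : prime_set V -> V `<=` z @` D ->
  irreducible (dual_zclosed W) (kodaira_piece V).
Proof.
move=> [[b Vb] Vp] VD; split.
  have [y Dy yb] := VD b Vb; exists (kodaira y).
  by apply: sub_kodaira_piece => //; rewrite yb.
move=> Z1 Z2 cZ1 cZ2 cover.
suff [h|h] : kodaira_part V `<=` Z1 \/ kodaira_part V `<=` Z2.
- by left=> H [_]; exact: dual_closure_min.
- by right=> H [_]; exact: dual_closure_min.
have hyp y : D y -> hyperplane W (kodaira y).
  by move=> /chart_sub; exact: kodaira_hyperplane.
have witness Z : dual_zclosed W Z -> ~ kodaira_part V `<=` Z ->
    exists2 p : {mpoly C[ch_dim c]}, ~ vanish_on p V &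
      forall y, D y -> Z (kodaira y) -> p.@[z y] = 0.
  move=> [S [hS ->]] /existsNP[_ /not_implyP[[y [Dy Vy ->]]]].
  move=> /not_andP[/(_ (hyp y Dy))//|/existsNP[f /not_implyP[Sf nf]]].
  have [p pE] := equation_poly (hS f Sf); exists p.
    by move=> /(_ _ Vy)/(pE y Dy).
  by move=> y' Dy' [_ hf]; apply/(pE y' Dy'); exact: hf.
apply: contrapT => /not_orP[/(witness _ cZ1)[p pV pZ] /(witness _ cZ2)[q qV qZ]].
have [b' Vb'|//|//] := Vp p q.
have [y Dy yb] := VD b' Vb'; rewrite -yb mevalM.
have Vy : V (z y) by rewrite yb.
have [/(pZ y Dy)->|/(qZ y Dy)->] := cover _ (sub_kodaira_piece Dy Vy).
  by rewrite mul0r.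
by rewrite mulr0.
Qed.

(** The image of the chain of sets of points on which the f_i are successively
    constant. The images are distinct, because the condition f_i = s is a linear
    equation g - s te on hyperplanes. *)
Lemma kodaira_chain_lower (f : seq {mpoly C[ch_dim c]}) :
  (forall p, p \in f -> exists2 g : section T, W g &
     forall y, D y -> p.@[z y] = g ta y / te ta y) ->
  faithful (tower f) iota generic_coord ->
  exists Z, irreducible_chain (dual_zclosed W) (kodaira @` X) (size f) Z.
Proof.
move=> fg faith; have [V [V0 Vp Vs]] := specialization_chain faith.
have VD i : (i <= size f)%N -> V i `<=` z @` D.
  elim: i => [_|i IHi lt_i]; first by rewrite V0 chart_locus.
  by move=> b Vb; apply: IHi (ltnW lt_i) _ _; have [Vi _] := Vs i lt_i; exact: Vi.
exists (fun i => kodaira_piece (V (size f - i)%N)); split=> i le_i.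
  split; first by apply: kodaira_piece_irreducible; [apply: Vp|apply: VD]; exact: leq_subr.
  by exists (dual_closure (kodaira_part (V (size f - i)%N))) => //; exact: dual_closure_closed.
set j := (size f - i.+1)%N; have -> : (size f - i)%N = j.+1 by rewrite /j; lia.
have lt_j : (j < size f)%N by rewrite /j; lia.
have [sub [s [s1 s0]]] := Vs j lt_j.
split.
  move=> H [XH cH]; split=> //; apply: dual_closure_min cH.
    exact: dual_closure_closed.
  move=> _ [y [Dy Vy ->]]; have [] // := @sub_kodaira_piece (V j) y Dy.
  exact: sub.
have [g Wg gE] := fg _ (mem_nth 0 lt_j).
have [_ Ee _ _] := adE; have Wte := product_series_tensor Ee.
pose F : dual_equation := existT _ 2
  ('X_ord0 - s *: 'X_ord_max, fun l => if l == ord0 then g else te).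
have gF : good_equation F.
  split=> [|l]; last by rewrite /F /=; case: ifP.
  exists 1%N; rewrite /F /= -scaleNr; apply: dhomogD; last apply: dhomogZ;
    rewrite dhomogX; apply/eqP; exact: mdeg1.
have FE y : D y -> holds F (kodaira y) <-> (f`_j - s%:MP).@[z y] = 0.
  move=> Dy; have [[d hd] WF] := gF.
  rewrite (dual_vanish_kodaira E_bpf (chart_sub Dy) (ta_open Dy) hd WF).
  rewrite /F /= mevalB mevalZ !mevalXU /= mevalB mevalC gE //.
  have t0 := te_neq0 Dy; split=> [/eqP|h].
    by rewrite subr_eq0 => /eqP ->; rewrite mulfK // subrr.
  have -> : g ta y = s * te ta y.
    by apply: (mulIf (invr_neq0 t0)); rewrite mulfK //; apply/eqP; rewrite -subr_eq0 h.
  by rewrite subrr.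
move=> le; apply: s0 => b Vb; have [y Dy yb] := VD j (ltnW lt_j) b Vb.
rewrite -yb; apply/(FE y Dy).
have [] := le (kodaira y); first by apply: sub_kodaira_piece => //; rewrite yb.
move=> _ [_ hF]; apply: hF => // _ [y' [Dy' Vy' ->]].
by apply/(FE y' Dy'); exact: s1.
Qed.

(** The irreducibility of a set of hyperplanes, with closed sets defined by one
    equation each. *)
Lemma irreducible_cover (A : set (set (section T))) (f g : dual_equation) :
  irreducible (dual_zclosed W) A -> A `<=` kodaira @` X ->
  good_equation f -> good_equation g ->
  (forall y, X y -> A (kodaira y) -> holds f (kodaira y) \/ holds g (kodaira y)) ->
  (forall y, X y -> A (kodaira y) -> holds f (kodaira y)) \/
  (forall y, X y -> A (kodaira y) -> holds g (kodaira y)).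
Proof.
move=> [_ irrA] AX gf gg cover.
pose Zf (h : dual_equation) := [set H | hyperplane W H /\ holds h H].
have cZ h : good_equation h -> dual_zclosed W (Zf h).
  move=> gh; exists [set h]; split=> [_ ->//|].
  apply/seteqP; split=> H [hH hh]; split=> //; first by move=> _ ->.
  exact: hh.
have [|h|h] := irrA _ _ (cZ f gf) (cZ g gg).
- move=> H AH; have [y Xy yH] := AX H AH; rewrite -yH in AH *.
  have hy := kodaira_hyperplane E_bpf Xy.
  by have [] := cover y Xy AH; [left | right].
- by left=> y _ /h[].
- by right=> y _ /h[].
Qed.

(** Each inclusion of the chain is strict because of one equation. The finitely
    many sections GG in these equations, divided by a section g0 that does not
    vanish at some point of the smallest set, map the points above the chain to
    irreducible sets in an affine space, and the inclusions remain strict. Hence d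
    of the functions GG / g0 are independent on the largest set, therefore on
    X. *)
Lemma kodaira_chain_upper d Z (b : seq K) :
  irreducible_chain (dual_zclosed W) (kodaira @` X) d Z ->
  (forall i, quotients i `<=` acl iota [set` b]) -> (d <= size b)%N.
Proof.
move=> [Zi Zs] Qb.
have ZX i : (i <= d)%N -> Z i `<=` kodaira @` X.
  by move=> /Zi[_ [k _ ->]] H [].
have Z0 i : (i <= d)%N -> Z 0 `<=` Z i.
  elim: i => [_ H //|i IHi lt_i H /(IHi (ltnW lt_i))].
  by have [le _] := Zs i lt_i; exact: le.
have [[[H1 Z1] _] _] := Zi 0 (leq0n _).
have [x1 Xx1 x1H] := ZX 0 (leq0n _) H1 Z1; rewrite -{}x1H in Z1.
have [e1 [a1 [Ee1 a1x e1x]]] := nonvanishing_system E_bpf Xx1.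
pose g0 : section T := tensor_section e1.
have Wg0 : W g0 by exact: product_series_tensor.
have g0x1 : g0 a1 x1 != 0.
  by rewrite /g0 tensor_sectionE //; apply/prodf_neq0 => i _.
have tv_ex y : exists t : lb_index T, X y -> lb_open t y.
  have [Xy|nXy] := pselect (X y); last by exists a1.
  by have [t _ ty] := @lb_cover _ _ _ T _ Xy; exists t.
have [tv tvP] := choice tv_ex.
have g0E y t : X y -> lb_open t y -> (g0 t y = 0) <-> (g0 (tv y) y = 0).
  by move=> Xy ty; rewrite -(vanish_atE Wg0 ty) -(vanish_atE Wg0 (tvP y Xy)).
have holdsE (f : dual_equation) y : good_equation f -> X y ->
    holds f (kodaira y) <-> (tagged f).1.@[fun l => (tagged f).2 l (tv y) y] = 0.
  move=> [[k hk] Wf] Xy.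
  by rewrite (dual_vanish_kodaira E_bpf Xy (tvP y Xy) hk Wf).
pose F0 : dual_equation := existT _ 1%N ('X_ord0, fun=> g0).
have gF0 : good_equation F0.
  by split=> //; exists 1%N; rewrite dhomogX; apply/eqP; exact: mdeg1.
have F0E y : X y -> holds F0 (kodaira y) <-> g0 (tv y) y = 0.
  by move=> Xy; rewrite holdsE //= mevalXU.
have fs_ex i : exists f : dual_equation, (i < d)%N ->
    [/\ good_equation f, forall H, Z i H -> holds f H &
        exists y, [/\ X y, Z i.+1 (kodaira y) & ~ holds f (kodaira y)]].
  have [lt_i|] := ltnP i d; last by exists F0.
  have [_ [k [S [hS kE]] ZE]] := Zi i (ltnW lt_i).
  have [_ /existsNP[H /not_implyP[ZH nZH]]] := Zs i lt_i.
  have [y Xy yH] := ZX i.+1 lt_i H ZH; rewrite -{}yH in ZH nZH.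
  have [f [Sf nf]] : exists f, S f /\ ~ holds f (kodaira y).
    apply: contrapT => /forallNP h; apply: nZH; rewrite ZE; split; first by exists y.
    rewrite kE; split=> [|f Sf]; first exact: kodaira_hyperplane.
    by apply: contrapT => nf; apply: (h f).
  exists f => _; split; [exact: hS | | by exists y].
  by move=> H'; rewrite ZE kE => -[_ [_]]; apply.
have [fs fsP] := choice fs_ex.
pose J : finType := {i : 'I_d & 'I_(tag (fs i))}.
pose m := #|J|.
pose GG (l : 'I_m) : section T :=
  (tagged (fs (tag (enum_val l : J)))).2 (tagged (enum_val l : J)).
have WGG l : W (GG l).
  have [[_ h] _ _] := fsP _ (ltn_ord (tag (enum_val l : J))); exact: h.
pose rho y (l : 'I_m) : C := GG l (tv y) y / g0 (tv y) y.
pose V i := [set u | exists y, [/\ X y, Z i (kodaira y), g0 (tv y) y != 0 & u = rho y]].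
pose usec (o : 'I_m.+1) : section T := if unlift ord0 o is Some l then GG l else g0.
have usec0 : usec ord0 = g0 by rewrite /usec unlift_none.
have usecS l : usec (lift ord0 l) = GG l by rewrite /usec liftK.
have Wusec o : W (usec o) by rewrite /usec; case: unlift.
(* A relation between the quotients GG / g0, homogenized, is a relation between
   sections. *)
have hom_eq (p : {mpoly C[m]}) : exists (q : {mpoly C[m.+1]}) k, [/\ q \is k.-homog,
    forall t y, g0 t y != 0 ->
      q.@[fun o => usec o t y] =
      p.@[fun l => GG l t y / g0 t y] * g0 t y ^+ k &
    ev (g0 ta) != 0 ->
      mmap iota (fun o => ev (usec o ta)) q =
      mmap iota (fun l => ev (GG l ta) / ev (g0 ta)) p * ev (g0 ta) ^+ k].
  have [q [k [hq qE]]] := homogenize_by p; exists q, k; split=> // [t y g0y|g00].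
    have /= := qE C idfun (fun o => usec o t y); rewrite usec0 => /(_ g0y) h.
    by apply: (etrans h); congr (_ * _); apply: eq_mmap => // l; rewrite usecS.
  have /= := qE K iota (fun o => ev (usec o ta)); rewrite usec0 => /(_ g00) ->.
  by congr (_ * _); apply: eq_mmap => // l; rewrite usecS.
have cut (p : {mpoly C[m]}) : exists2 f : dual_equation, good_equation f &
    forall y, X y -> holds f (kodaira y) <-> g0 (tv y) y = 0 \/ p.@[rho y] = 0.
  have [q [k [hq qE _]]] := hom_eq p.
  exists (existT _ m.+1 ('X_ord0 * q, usec)).
    split=> //; exists (1 + k)%N; apply: dhomogM => //.
    by rewrite dhomogX; apply/eqP; exact: mdeg1.
  move=> y Xy; rewrite holdsE //=; last first.
    split=> //; exists (1 + k)%N; apply: dhomogM => //.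
    by rewrite dhomogX; apply/eqP; exact: mdeg1.
  rewrite mevalM mevalXU usec0.
  have [->|g0y] := eqVneq (g0 (tv y) y) 0; first by rewrite mul0r; tauto.
  rewrite qE //; split=> [/eqP|[/eqP|h]].
  - rewrite !mulf_eq0 (negPf g0y) (negPf (expf_neq0 _ g0y)) orbF => /eqP; by right.
  - by rewrite (negPf g0y).
  - by rewrite [p.@[_]]h mul0r mulr0.
(* The smallest set contains the image of x1, where g0 is not zero. *)
have F0Z i : (i <= d)%N -> ~ (forall y, X y -> Z i (kodaira y) -> holds F0 (kodaira y)).
  move=> le_i /(_ x1 Xx1 (Z0 i le_i _ Z1))/(F0E x1 Xx1)/(g0E x1 a1 Xx1 a1x) g00.
  by rewrite g00 eqxx in g0x1.
have Vp i : (i <= d)%N -> prime_set (V i).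
  move=> le_i; split.
    exists (rho x1), x1; split=> //; first exact: Z0 Z1.
    by apply/eqP => /(g0E x1 a1 Xx1 a1x)/eqP; exact/negP.
  move=> p q pq; have [f gf fE] := cut p; have [g gg gE] := cut q.
  have [irr _] := Zi i le_i.
  have fin (r : {mpoly C[m]}) (h : dual_equation) : (forall y, X y -> holds h (kodaira y) <->
      g0 (tv y) y = 0 \/ r.@[rho y] = 0) ->
      (forall y, X y -> Z i (kodaira y) -> holds h (kodaira y)) -> vanish_on r (V i).
    move=> hE Zh _ [y [Xy Zy g0y ->]]; have /(hE y Xy)[|//] := Zh y Xy Zy.
    by move=> g00; rewrite g00 eqxx in g0y.
  have [y Xy Zy|h|h] := irreducible_cover irr (ZX i le_i) gf gg.
  - have [g00|g0y] := eqVneq (g0 (tv y) y) 0; first by left; apply/(fE y Xy); left.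
    have /eqP : (p * q).@[rho y] = 0 by apply: pq; exists y.
    rewrite mevalM mulf_eq0 => /orP[/eqP p0|/eqP q0].
      by left; apply/(fE y Xy); right.
    by right; apply/(gE y Xy); right.
  - by left; exact: fin fE h.
  - by right; exact: fin gE h.
have Vs i : (i < d)%N -> V i `<=` V i.+1 /\
    exists2 q, vanish_on q (V i) & ~ vanish_on q (V i.+1).
  move=> lt_i; have [gf Zf [y1 [Xy1 Zy1 nf1]]] := fsP i lt_i; split.
    move=> _ [y [Xy Zy g0y ->]]; exists y; split=> //.
    by have [le _] := Zs i lt_i; exact: le.
  pose io : 'I_d := Ordinal lt_i.
  pose ix (l : 'I_(tag (fs i))) : 'I_m := enum_rank
    (Tagged (fun i : 'I_d => 'I_(tag (fs i))) (l : 'I_(tag (fs io))) : J).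
  pose q := mmap (@mpolyC m C) (fun l => 'X_(ix l)) (tagged (fs i)).1.
  have qE y : X y -> g0 (tv y) y != 0 -> q.@[rho y] = 0 <-> holds (fs i) (kodaira y).
    move=> Xy g0y; have [[k hk] _] := gf.
    have -> : q.@[rho y] = (g0 (tv y) y)^-1 ^+ k *
        (tagged (fs i)).1.@[fun l => (tagged (fs i)).2 l (tv y) y].
      rewrite -(homogeneous_scale _ _ hk) /q (rmorph_mmap _ _ (meval (rho y))).
      apply: eq_mmap => [s|l] /=; first by rewrite mevalC.
      by rewrite mevalXU /rho /GG /ix enum_rankK /= mulrC.
    rewrite (holdsE (fs i) y gf Xy); split=> [/eqP|->]; last by rewrite mulr0.
    rewrite mulf_eq0 (negPf (expf_neq0 _ (invr_neq0 g0y))) => /eqP; exact.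
  exists q.
    by move=> _ [y [Xy Zy g0y ->]]; apply/qE => //; exact: Zf.
  move=> qV; have [irr _] := Zi i.+1 lt_i.
  have [y Xy Zy|h|h] := irreducible_cover irr (ZX i.+1 lt_i) gf gF0.
  - have [g00|g0y] := eqVneq (g0 (tv y) y) 0; first by right; apply/F0E.
    by left; apply/qE => //; apply: qV; exists y.
  - by apply: nf1; exact: h.
  - exact: F0Z h.
have [s sd hs] := prime_chain_rank Vp Vs.
have g00 : ev (g0 ta) != 0.
  apply: contraNneq g0x1 => g00; apply/eqP.
  have [p pE] := product_series_poly Wg0.
  have pV : vanish_on p (z @` D).
    by apply: evS; rewrite -g00; apply: (ev_ext ev0) => y Dy; rewrite pE.
  have [y0 Dy0] := chart_nonempty.
  have : ('X_ord0 : {mpoly C[1]}).@[fun=> g0 a1 x1] = 0.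
    apply: (@vanish_dense _ _ _ _ E D 1%N 1%N _ (fun=> g0) X_irr (ch_open c)) => //.
    - by exists y0.
    - by rewrite dhomogX; apply/eqP; exact: mdeg1.
    - move=> y Dy; exists ta; first exact: ta_open.
      by rewrite mevalXU pE //; apply: pV; exists y.
  by rewrite mevalXU.
(* The independent functions are transported to the chart: a relation there
   holds on all of X by density. *)
have : faithful (tower (map (fun l => 'X_l) s)) iota
    (fun l => ev (GG l ta) / ev (g0 ta)).
  apply: hs => p p0 _ [y [Xy Zy g0y ->]].
  have [q [k [hq qE qK]]] := hom_eq p.
  have [q' q'E] := sections_poly q Wusec.
  have q'V : vanish_on q' (z @` D).
    apply: evS; rewrite -(ev_ext ev0 q'E).
    by rewrite (ev_mpoly ev (fun y o => usec o ta y)) qK // p0 mul0r.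
  have [y0 Dy0] := chart_nonempty.
  have : q.@[fun o => usec o (tv y) y] = 0.
    apply: (@vanish_dense _ _ _ _ E D _ k q usec X_irr (ch_open c)) => //.
    - by exists y0.
    - move=> y' Dy'; exists ta; first exact: ta_open.
      by rewrite q'E //; apply: q'V; exists y'.
    - exact: tvP.
  move=> /eqP; rewrite qE // mulf_eq0 (negPf (expf_neq0 _ g0y)) orbF.
  by move=> /eqP.
move=> /tower_faithful ind; rewrite -sd -(size_map (fun l => 'X_l : {mpoly C[m]}) s).
rewrite -size_rev -(size_map (mmap iota (fun l => ev (GG l ta) / ev (g0 ta)))).
apply: (steinitz ind) => x /= /mapP[q]; rewrite mem_rev => /mapP[l _ ->] ->.
rewrite mmapX mmap1U set0U.
have -> : ev (GG l ta) / ev (g0 ta) =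
    (ev (GG l ta) / ev (te ta)) / (ev (g0 ta) / ev (te ta)).
  by rewrite -mulf_div divff ?mulr1 // invr_neq0 // ev_te_neq0.
by apply: acl_div; exact: product_series_acl.
Qed.

(** The Krull dimension of the image of the Kodaira map is the transcendence
    degree of the field generated by the quotients of sections. *)
Lemma kodaira_dim_basis (b : seq K) :
  indep iota set0 b -> (forall x, x \in b -> exists i, quotients i x) ->
  (forall i, quotients i `<=` acl iota [set` b]) -> kodaira_dim E = size b.
Proof.
move=> ind bQ Qb.
have [f [fb fg]] : exists f : seq {mpoly C[ch_dim c]},
    map (mmap iota generic_coord) f = b /\ forall p, p \in f ->
    exists2 g : section T, W g & forall y, D y -> p.@[z y] = g ta y / te ta y.
  elim: b {ind Qb} bQ => [|x b IHb] bQ; first by exists [::].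
  have [|f [fb fg]] := IHb.
    by move=> x' x'b; apply: bQ; rewrite inE x'b orbT.
  have [|i /quotient_section[g [p [Wg xp pg]]]] := bQ x; first by rewrite inE eqxx.
  exists (p :: f); split; first by rewrite /= fb -xp.
  by move=> q; rewrite inE => /orP[/eqP ->|/fg//]; exists g.
have [Z ZE] : exists Z, irreducible_chain (dual_zclosed W) (kodaira @` X) (size b) Z.
  have := @kodaira_chain_lower (rev f); rewrite size_rev -(size_map (mmap iota generic_coord)) fb.
  apply=> [p|]; first by rewrite mem_rev; exact: fg.
  by apply/tower_faithful; rewrite revK fb.
rewrite /kodaira_dim /krull_dim.
set Q := (X in xget _ X).
have Qex : exists k, Q k.
  by exists (size b); split=> [|k Z' /kodaira_chain_upper]; [exists Z|apply].
have [[Z' Z'E] h] := xgetPex 0%N Qex.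
apply/eqP; rewrite eqn_leq; apply/andP; split; last exact: h ZE.
exact: kodaira_chain_upper Z'E Qb.
Qed.

End Series.
End KodairaDimension.

(** * Avoiding algebraic relations *)

Section GenericScalars.
Variables (F : closedFieldType) (K : fieldType) (iota : {rmorphism F -> K}).
Local Notation acl := (acl iota).

(** A line whose direction is not in a subspace meets this subspace in at most
    one point. *)
Lemma generic_scalar (T : finType) (A : T -> set K) (x y : K) :
  exists bad : seq F, forall lam, lam \notin bad -> forall t,
    ~ acl (A t) y -> ~ acl (A t) (x + iota lam * y).
Proof.
have h t : exists l, forall lam, lam != l -> ~ acl (A t) y ->
    ~ acl (A t) (x + iota lam * y).
  have [[l hl]|nl] := pselect (exists l, acl (A t) (x + iota l * y)); last first.
    by exists 0 => lam _ _ hlam; apply: nl; exists lam.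
  exists l => lam neq ny hlam; apply: ny.
  have n0 : iota (lam - l) != 0 by rewrite fmorph_eq0 subr_eq0.
  have -> : y = (x + iota lam * y - (x + iota l * y)) / iota (lam - l).
    apply: (mulIf n0); rewrite divfK // rmorphB mulrBr opprD addrACA subrr add0r.
    by rewrite ![y * _]mulrC.
  by apply: acl_div; [exact: aclB | exact: acl_cst].
have [l hl] := choice h.
exists (codom l) => lam nbad t; apply: hl.
by apply: contraNneq nbad => ->; exact: codom_f.
Qed.

(** A vector space over an infinite field is not a finite union of proper
    subspaces, here those of the vectors whose value is algebraic over A t. *)
Lemma avoid_subspaces (V : lmodType F) (E : set V) (v : V -> K) (T : finType)
    (A : T -> set K) (r : seq T) :
  E !=set0 -> (forall c s s', E s -> E s' -> E (c *: s + s')) ->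
  (forall c s s', E s -> E s' -> v (c *: s + s') = iota c * v s + v s') ->
  exists2 z, E z & forall t, t \in r ->
    (exists2 s, E s & ~ acl (A t) (v s)) -> ~ acl (A t) (v z).
Proof.
move=> [z0 Ez0] Elin vlin; elim: r => [|t r [z Ez zr]]; first by exists z0.
have [[[s Es ns] az]|h] := pselect ((exists2 s, E s & ~ acl (A t) (v s)) /\ acl (A t) (v z)).
  have [bad hbad] := generic_scalar A (v s) (v z).
  have [lam lam_bad] := closed_field_big bad.
  exists (lam *: z + s); first exact: Elin.
  move=> t'; rewrite inE vlin // [_ * _ + _]addrC => /orP[/eqP -> _ h|t'r ex].
    apply: ns; have -> : v s = v s + iota lam * v z - iota lam * v z by rewrite addrK.
    by apply: aclB => //; apply: aclM => //; exact: acl_cst.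
  by apply: hbad => //; exact: zr.
exists z => // t'; rewrite inE => /orP[/eqP -> ex az|/zr//].
by apply: h.
Qed.

(** A polynomial in one variable with coefficients in the closure of A and with a
    transcendental root is zero. *)
Lemma transcendental_substitution k (A : set K) (u : 'I_k -> K) (i : 'I_k) c
    (Q : {mpoly F[k]}) :
  ~ acl A (u i) -> (forall j, j != i -> acl A (u j)) -> mmap iota u Q = 0 ->
  mmap iota (fun j => if j == i then c else u j) Q = 0.
Proof.
move=> ni uA Q0; pose q := mmap (polyC \o iota)
  (fun j => if j == i then 'X else (u j)%:P) Q.
have qE x : q.[x] = mmap iota (fun j => if j == i then x else u j) Q.
  rewrite -[q.[x]]/(horner_eval x q) /q (rmorph_mmap _ _ (horner_eval x)).
  apply: eq_mmap => [d|j] /=; rewrite /horner_eval ?hornerC //.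
  by case: eqP => _; rewrite ?hornerX ?hornerC.
have qA l : acl A q`_l.
  rewrite /q /mmap coef_sum; apply: acl_sum => m _ /=.
  rewrite coefCM; apply: aclM; first exact: acl_cst.
  pose S (p : {poly K}) := forall l, acl A p`_l.
  suff : S (mmap1 (fun j => if j == i then 'X else (u j)%:P) m) by apply.
  have SM p p' : S p -> S p' -> S (p * p').
    move=> hp hp' l'.
    by rewrite coefM; apply: acl_sum => ? _; exact: aclM.
  have SC x : acl A x -> S x%:P.
    move=> Ax l'; rewrite coefC; case: eqP => // _.
    exact: acl0.
  rewrite /mmap1; apply: (big_ind S); [exact: (SC 1 (acl1 _ _)) | exact: SM | move=> j _].
  elim: (m j) => [|e IHe]; first by rewrite expr0; exact: (SC 1 (acl1 _ _)).
  rewrite exprS; apply: SM => //; case: (altP (j =P i)) => [_|ji].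
    move=> l'; rewrite coefX; case: (l' == 1%N); first exact: acl1.
    exact: acl0.
  by apply: SC; exact: uA.
have q0 : q = 0.
  apply/eqP; apply: contrapT => /negP q0; apply: ni; apply: (acl_root q0 qA).
  rewrite /root qE -[X in _ == X]Q0; apply/eqP; apply: eq_mmap => // j.
  by case: eqP => [->|].
by rewrite -qE q0 horner0.
Qed.

(** The last element of T is transcendental over all the other values; it is
    substituted first. *)
Lemma independent_substitution k (A : set K) (T : seq 'I_k) (u : 'I_k -> K)
    (Q : {mpoly F[k]}) :
  uniq T -> indep iota A (map u T) -> (forall j, j \notin T -> acl A (u j)) ->
  mmap iota u Q = 0 ->
  mmap iota (fun j => if j \in T then 0 else u j) Q = 0.
Proof.
elim/last_ind: T u => [|T i IHT] u; first by [].
rewrite rcons_uniq map_rcons => /andP[iT uT] /indep_rcons[ind ni] uA Q0.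
pose u1 j := if j == i then 0 else u j.
have u1T j : j \in T -> u1 j = u j.
  by move=> jT; rewrite /u1; case: eqP => // ji; rewrite -ji jT in iT.
have Q1 : mmap iota u1 Q = 0.
  apply: (transcendental_substitution _ ni) => // j ji.
  have [jT|jT] := boolP (j \in T).
    by apply: sub_acl; right => /=; exact: map_f.
  apply: (@acl_mono _ _ _ A) => [y|]; first by left.
  by apply: uA; rewrite mem_rcons inE negb_or ji.
apply: etrans (IHT u1 uT _ _ Q1).
- apply: eq_mmap => // j; rewrite mem_rcons inE /u1.
  by case: eqP => //= _; case: ifP.
- by rewrite (_ : map u1 T = map u T) //; apply/eq_in_map.
- move=> j jT; rewrite /u1; case: eqP => [_|/eqP ji]; first exact: acl0.
  by apply: uA; rewrite mem_rcons inE negb_or ji.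
Qed.

End GenericScalars.

(** * Selecting independent quotients *)

(** The finitely many functions to be made polynomial are the elements of
    generating families of the series, with e i in front. *)
Lemma adapted_chart_exists (R : realType) (n : nat) (X : set (projective_space R n))
    (I : finType) (E : I -> linear_series X) x0 :
  quasi_projective X -> irreducible zclosed X ->
  (forall i, base_point_free (E i)) -> X x0 ->
  exists (c : chart X) (a : forall i, lb_index (ls_bundle (E i))) (e : system E),
    adapted_chart c a e /\ ch_dom c x0.
Proof.
move=> X_qp X_irr bpf Xx0.
have [e [a [Ee ax ea]]] := nonvanishing_system bpf Xx0.
pose bs i := sval (cid (ls_finite_dim (E i))).
have bsE i : ls_sections (E i) = lspan [set` bs i] by rewrite /bs; case: cid.
pose J : finType := {i : I & 'I_(size (bs i)).+1}.
pose sec (j : J) : section (ls_bundle (E (tag j))) :=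
  nth (e (tag j)) (e (tag j) :: bs (tag j)) (tagged j).
have secE j : ls_sections (E (tag j)) (sec j).
  have : sec j \in e (tag j) :: bs (tag j) by apply: mem_nth; rewrite /= ltn_ord.
  rewrite inE => /orP[/eqP ->|sj]; first exact: Ee.
  by rewrite bsE; apply: sub_lspan.
have [|||c [Dx0 Dsub Fp Fi]] := @local_chart R n X x0 J
  (fun j => lb_open (a (tag j))) (fun j => sec j (a (tag j))) X_qp X_irr Xx0.
- by move=> j; exact: lb_openP.
- by move=> j; case: ax => _; apply.
- by move=> j; have [h _ _] := ls_global (secE j); exact: h.
exists c, a, e; split=> //; split=> // [i|i s|i].
- exact: (Dsub (Tagged (fun i => 'I_(size (bs i)).+1) (ord0 : 'I_(size (bs i)).+1) : J)).
- rewrite bsE; apply: (@lspan_elim _ _ _ (fun s : section (ls_bundle (E i)) =>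
    exists p : {mpoly (R[i])%C[ch_dim c]}, forall y, ch_dom c y ->
      s (a i) y = p.@[ch_coord c y])) => [s' s'b||k u v [p pE] [q qE]].
  + have lt : ((index s' (bs i)).+1 < (size (bs i)).+1)%N by rewrite ltnS index_mem.
    have := Fp (Tagged (fun i => 'I_(size (bs i)).+1) (Ordinal lt) : J).
    by rewrite /sec /= nth_index.
  + by exists 0 => y _; rewrite meval0.
  + by exists (k%:MP * p + q) => y Dy; rewrite mevalD mevalM mevalC -pE // -qE.
- apply: (Fi (Tagged (fun i => 'I_(size (bs i)).+1) (ord0 : 'I_(size (bs i)).+1) : J)).
  exact: ea.
Qed.

Lemma min_defect_le (R : realType) (n : nat) (X : set (projective_space R n))
    (I : finType) (E : I -> linear_series X) (J : {set I}) :
  min_defect E <= defect E J.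
Proof. exact: bigmin_le. Qed.

Section Selection.
Context {R : realType} {n : nat} {X : set (projective_space R n)}.
Local Notation C := R[i].
Local Notation P := (projective_space R n).
Variables (X_irr : irreducible zclosed X) (k : nat) (E : 'I_k -> linear_series X).
Hypothesis E_bpf : forall i, base_point_free (E i).
Variables (c : chart X) (a : forall i, lb_index (ls_bundle (E i))) (e : system E).
Arguments a : clear implicits.
Arguments e : clear implicits.
Hypothesis adE : adapted_chart c a e.
Variables (K : fieldType) (ev : evaluation P C K).
Hypotheses (ev0 : forall f, (forall y, ch_dom c y -> f y = 0) -> ev f = 0)
  (evS : forall p : {mpoly C[ch_dim c]}, ev (fun y => p.@[ch_coord c y]) = 0 ->
     vanish_on p (ch_coord c @` ch_dom c)).
Local Notation D := (ch_dom c).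
Local Notation z := (ch_coord c).
Local Notation iota := (ev_cst ev).
Local Notation Q := (quotients ev a e).
Implicit Types (J S : {set 'I_k}) (w : system E).

Definition quotients_of J : set K := [set v | exists2 i, i \in J & Q i v].

Definition quotient i (s : section (ls_bundle (E i))) : K :=
  ev (s (a i)) / ev (e i (a i)).
Arguments quotient : clear implicits.

Lemma defect_basis J : exists b : seq K,
  [/\ indep iota set0 b, quotients_of J `<=` acl iota [set` b],
      forall x, x \in b -> quotients_of J x
    & defect E J = (size b)%:Z - #|J|%:Z].
Proof.
have [|b [bJ ind sp]] := @basis_exists _ _ iota set0 (quotients_of J)
    (codom (generic_coord (c := c) ev)).
  move=> v [i _ /(quotient_section ev0 adE)[g [f [_ -> _]]]].
  by apply: acl_mmap => l; apply: sub_acl; right; exact: codom_f.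
rewrite /spans set0U in sp.
exists b; split=> //; rewrite /defect; case: eqP => [J0|_].
  have -> : b = [::].
    by case: b bJ {ind sp} => // x b bJ; have [l] := bJ x (mem_head _ _); rewrite J0 inE.
  by rewrite J0 cards0.
congr (_%:Z - _); apply: (@kodaira_dim_basis _ _ _ X_irr c K ev ev0 evS
  _ (subcollection E J) (fun i => a (val i)) (subsystem J e)) => //.
- have [Da Ee Ep Ei] := adE; split=> [i|i|i s|i].
  + exact: Da.
  + exact: Ee.
  + exact: Ep.
  + exact: Ei.
- by move=> i; exact: E_bpf.
- by move=> x /bJ[i iJ Qx]; exists (exist _ i iJ).
- by move=> i x Qx; apply: sp; exists (val i) => //; exact: valP.
Qed.

(** Hall's condition for the choice of one quotient in each series of S: the
    quotients of every part S' have rank at least its cardinal over A. *)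
Definition hall (A : set K) S : Prop := forall S' : {set 'I_k}, S' \subset S ->
  exists s, [/\ indep iota A s, (#|S'| <= size s)%N &
                forall x, x \in s -> acl iota (A `|` quotients_of S') x].

(** The transcendence degree of the quotients of S' and J is at least that of J
    plus the cardinal of S', since the defect of their union is at least the one
    of J; removing a basis for J leaves the rank over this
    basis. *)
Lemma hall_of_defect J b : (forall J', defect E J <= defect E J') ->
  indep iota set0 b -> quotients_of J `<=` acl iota [set` b] ->
  (forall x, x \in b -> quotients_of J x) -> defect E J = (size b)%:Z - #|J|%:Z ->
  hall [set` b] (~: J).
Proof.
move=> Jmin ind sp bJ dJ S' S'J.
have [b' [ind' sp' bJ' dJ']] := defect_basis (S' :|: J).
have [s [le_s sub_s ind_s]] := indep_remove_seq b ind'.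
rewrite set0U in ind_s; exists s; split=> // [|x /sub_s/bJ'[l]].
  have := Jmin (S' :|: J); rewrite dJ dJ' cardsU disjoint_setI0 ?cards0 ?subn0.
    move: le_s {ind_s}; move: (size b) (size b') (size s) #|S'| #|J| => n1 n2 n3 n4 n5.
    by lia.
  rewrite finset.disjoints_subset; exact: S'J.
rewrite inE => /orP[lS Qx|lJ Qx].
  by apply: sub_acl; right; exists l.
apply: (@acl_mono _ _ _ [set` b]) => [y|]; first by left.
by apply: sp; exists l.
Qed.

(** A quotient v of the i-th series that is as generic as possible is
    transcendental over A, and Hall's condition remains true over A and v. If v
    is transcendental over A and the quotients of S', no rank is lost. If not, all
    quotients of the i-th series are algebraic over these, so that Hall's
    condition for S' and i together leaves one element to spare. *)
Lemma hall_adjoin (A : set K) S i v :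
  hall A S -> i \in S -> Q i v ->
  (forall S', S' \subset S :\ i -> acl iota (A `|` quotients_of S') v ->
     Q i `<=` acl iota (A `|` quotients_of S')) ->
  ~ acl iota A v /\ hall (v |` A) (S :\ i).
Proof.
move=> hS iS Qv gen.
have grow (B : set K) : acl iota (A `|` B) `<=` acl iota ((v |` A) `|` B).
  by apply: acl_mono => y [Ay|By]; [left; right | right].
split.
  move=> Av; have [|s [ind]] := hS [set i]%SET; first by rewrite finset.sub1set.
  rewrite cards1; case: s ind => [//|x s] [nx _] _ /(_ x (mem_head _ _)) ax.
  apply: nx; apply: acl_min ax => y [Ay|[j]]; first exact: sub_acl.
  rewrite inE => /eqP -> Qy.
  have := gen finset.set0 (finset.sub0set _); rewrite (_ : A `|` _ = A).
    by apply.
  by apply/seteqP; split=> u; [case=> // -[l]; rewrite inE | left].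
move=> S' S'i; have S'S : S' \subset S by apply: fintype.subset_trans S'i (finset.subD1set _ _).
have iS' : i \notin S'.
  by apply/negP => /(fintype.subsetP S'i); rewrite !inE eqxx.
have [av|nav] := pselect (acl iota (A `|` quotients_of S') v).
  have Qi := gen S' S'i av.
  have [|s [ind le_s sA]] := hS (i |: S').
    by rewrite finset.subUset finset.sub1set iS.
  have [s' [le_s' sub_s ind']] := indep_remove v ind.
  exists s'; split=> // [|x /sub_s/sA ax].
    by move: le_s; rewrite cardsU1 iS'; lia.
  apply: grow; apply: acl_min ax => y [Ay|[j]].
    by apply: sub_acl; left.
  rewrite !inE => /orP[/eqP ->|jS' Qy]; first exact: Qi.
  by apply: sub_acl; right; exists j.
have [s [ind le_s sA]] := hS S' S'S.
exists s; split=> // [|x /sA]; last exact: grow.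
apply: indep_adjoin => // h; apply: nav; apply: acl_min h => y [Ay|/sA//].
by apply: sub_acl; left.
Qed.

Lemma series_lin i lam (s s' : section (ls_bundle (E i))) :
  ls_sections (E i) s -> ls_sections (E i) s' -> ls_sections (E i) (lam *: s + s').
Proof.
by have [b ->] := ls_finite_dim (E i); exact: lspan_lin.
Qed.

Lemma quotientE i s : ls_sections (E i) s ->
  ev (fun y => s (a i) y / e i (a i) y) = quotient i s.
Proof.
move=> Es; have e0 := ev_e_neq0 ev0 adE i.
apply: (mulIf e0); rewrite divfK // -evM; apply: (ev_ext ev0) => y Dy.
by rewrite divfK // (e_neq0 adE).
Qed.

Lemma quotient_lin i lam (s s' : section (ls_bundle (E i))) :
  quotient i (lam *: s + s') = iota lam * quotient i s + quotient i s'.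
Proof. by rewrite /quotient -ev_c mulrA -mulrDl -evM -evD. Qed.

Lemma quotient_poly i s : ls_sections (E i) s -> exists p : {mpoly C[ch_dim c]},
  forall y, D y -> s (a i) y / e i (a i) y = p.@[z y].
Proof.
have [_ _ Ep Ei] := adE; move=> Es.
have [p pE] := Ep i s Es; have [q qE] := Ei i.
exists (p * q) => y Dy; rewrite mevalM -pE //; congr (_ * _).
have e0 := e_neq0 adE i Dy.
by apply: (mulfI e0); rewrite qE // divff.
Qed.

Section PolynomialFunction.
Variable f : system E -> C.
Hypothesis f_poly : polynomial_function f.

Lemma polynomial_on_box w w' : systems E w -> systems E w' ->
  exists q : {mpoly C[k]}, forall tau : 'I_k -> C,
    f (fun i => tau i *: w' i + w i) = q.@[tau].
Proof.
have [m [p [ix [phi [hphi fE]]]]] := f_poly; move=> Ew Ew'.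
exists (mmap (@mpolyC k C) (fun l =>
  (phi l (w' (ix l)))%:MP * 'X_(ix l) + (phi l (w (ix l)))%:MP) p) => tau.
rewrite fE => [|i]; last by apply: series_lin; [exact: Ew' | exact: Ew].
rewrite (rmorph_mmap _ _ (meval tau)); apply: eq_mmap => [d|l] /=.
  by rewrite mevalC.
rewrite mevalD mevalM !mevalC mevalXU mulrC.
by apply: hphi; [exact: Ew' | exact: Ew].
Qed.

Hypothesis f0 : forall s, systems E s -> has_root s -> f s = 0.

(** The polynomial q (tau) = f (w - tau e) vanishes when the tau_i are the values
    at y of w_i / e_i, because w - tau e is then zero at y. *)
Lemma vanish_of_independent x0 J (A : set K) (T : seq 'I_k) w :
  D x0 -> systems E w -> (forall i, i \in J -> vanish_at (w i) x0) ->
  uniq T -> (forall i, (i \in T) = (i \notin J)) ->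
  (forall i, i \in J -> acl iota A (quotient i (w i))) ->
  indep iota A (map (fun i => quotient i (w i)) T) -> f w = 0.
Proof.
move=> Dx0 Ew Jx0 uT TJ JA ind; have [Da Ee _ _] := adE.
have [q0 q0E] := polynomial_on_box Ew Ee.
pose q := mmap (@mpolyC k C) (fun i => - 'X_i) q0.
have qE tau : q.@[tau] = f (fun i => - tau i *: e i + w i).
  rewrite q0E /q (rmorph_mmap _ _ (meval tau)); apply: eq_mmap => [d|i] /=.
    by rewrite mevalC.
  by rewrite mevalN mevalXU.
have qv y : D y -> q.@[fun i => w i (a i) y / e i (a i) y] = 0.
  move=> Dy; have Es i : ls_sections (E i)
      (- (w i (a i) y / e i (a i) y) *: e i + w i).
    by apply: series_lin; [exact: Ee | exact: Ew].
  rewrite qE; apply: f0 => //; exists y; first exact: chart_sub Dy.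
  move=> i b yb; have [_ glue _] := ls_global (Es i).
  rewrite (glue b (a i)) //; last exact: Da.
  change (lb_trans b (a i) y *
    (- (w i (a i) y / e i (a i) y) * e i (a i) y + w i (a i) y) = 0).
  by rewrite mulNr divfK ?(e_neq0 adE) // addNr mulr0.
have qK : mmap iota (fun i => quotient i (w i)) q = 0.
  have := ev_mpoly ev (fun y i => w i (a i) y / e i (a i) y) q.
  rewrite ev0 // => /esym h; apply: etrans h; apply: eq_mmap => // i.
  by rewrite quotientE.
have indT j : j \notin T -> acl iota A (quotient j (w j)).
  by rewrite TJ negbK; exact: JA.
have {qK} := independent_substitution uT ind indT qK.
pose u j : P -> C := if j \in T then fun=> 0
  else fun y => w j (a j) y / e j (a j) y.
have uE j : ev (u j) = if j \in T then 0 else quotient j (w j).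
  rewrite /u; case: ifP => _; last exact: quotientE.
  by rewrite ev_c rmorph0.
have up j : exists p : {mpoly C[ch_dim c]}, forall y, D y -> u j y = p.@[z y].
  rewrite /u; case: ifP => _; last exact: quotient_poly.
  by exists 0 => y _; rewrite meval0.
have [p pE] := choice up.
move=> qK; have : vanish_on (mmap (@mpolyC _ C) p q) (z @` D).
  apply: evS; rewrite -[RHS]qK.
  rewrite -(eq_mmap (f := iota) (h := fun j => ev (u j)) q) //.
  rewrite -(ev_mpoly ev (fun y j => u j y)); apply: (ev_ext ev0) => y Dy.
  rewrite (rmorph_mmap _ _ (meval (z y))); apply: eq_mmap => [d|j] /=.
    by rewrite mevalC.
  by rewrite pE.
move=> /(_ (z x0)); rewrite (rmorph_mmap _ _ (meval (z x0))) => h.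
have q00 : q.@[fun=> 0] = 0.
  rewrite -[RHS]h; last by exists x0.
  apply: eq_mmap => [d|j] /=; first by rewrite mevalC.
  rewrite -pE // /u; case: ifP => // /negbT; rewrite TJ negbK => jJ.
  by rewrite (Jx0 j jJ) ?mul0r //; exact: Da.
rewrite -[RHS]q00 qE; congr f; apply: functional_extensionality_dep => i.
by rewrite oppr0 scale0r add0r.
Qed.

(** The components of w in S are made generic one after the other, those in T
    being so already. If f vanishes for all generic choices of the component i, it
    vanishes at all but finitely many points of the line through w_i in a generic
    direction, and therefore at w_i. *)
Lemma generic_vanish x0 J (b : seq K) S (T : seq 'I_k) w : D x0 ->
  quotients_of J `<=` acl iota [set` b] -> S \subset ~: J ->
  systems E w -> (forall i, i \in J -> vanish_at (w i) x0) ->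
  uniq T -> (forall i, (i \in T) = (i \notin J) && (i \notin S)) ->
  indep iota [set` b] (map (fun i => quotient i (w i)) T) ->
  hall ([set` b] `|` [set` map (fun i => quotient i (w i)) T]) S -> f w = 0.
Proof.
move=> Dx0 bJ; have [m] := ubnP #|S|.
elim: m S T w => [//|m IHm] S T w; rewrite ltnS => le_m SJ Ew Jw uT TE ind hS.
have [S0|[i iS]] := set_0Vmem S.
  apply: (vanish_of_independent Dx0 Ew Jw uT _ _ ind) => i.
    by rewrite TE S0 inE andbT.
  by move=> iJ; apply: bJ; exists i => //; exists (w i).
set A := _ `|` _ in hS; pose AS (S' : {set 'I_k}) := A `|` quotients_of S'.
have [||sec Esec avoid] := @avoid_subspaces _ _ iota _ (ls_sections (E i))
    (quotient i) _ AS (enum {set 'I_k}) _ (@series_lin i).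
- by exists (w i).
- by move=> lam s s' _ _; exact: quotient_lin.
have [bad badP] := generic_scalar iota AS (quotient i (w i)) (quotient i sec).
have iJ : i \notin J by have := fintype.subsetP SJ i iS; rewrite inE.
have iT : i \notin T by rewrite TE iS andbF.
pose w' lam : system E := dfwith w (lam *: sec + w i).
have Ew'i lam : ls_sections (E i) (lam *: sec + w i) by exact: series_lin.
have w'T lam : map (fun j => quotient j (w' lam j)) T =
    map (fun j => quotient j (w j)) T.
  apply/eq_in_map => j jT; rewrite /w' dfwith_out //.
  by apply: contraNneq iT => ->.
have fw' lam : lam \notin bad -> f (w' lam) = 0.
  move=> nbad; set v := quotient i (lam *: sec + w i).
  have Qv : Q i v by exists (lam *: sec + w i).
  have [S' S'S Av|nv hv] := hall_adjoin hS iS Qv.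
    move=> _ [s Es ->]; apply: contrapT => ns.
    apply: (badP lam nbad S'); last by rewrite addrC -quotient_lin.
    by apply: avoid; [rewrite mem_enum | exists s].
  have mapE : map (fun j => quotient j (w' lam j)) (rcons T i) =
      rcons (map (fun j => quotient j (w j)) T) v.
    by rewrite map_rcons w'T /w' dfwith_in.
  apply: (IHm (S :\ i) (rcons T i)).
  - by apply: leq_trans le_m; rewrite [X in (_ < X)%N](cardsD1 i) iS.
  - by apply: fintype.subset_trans SJ; exact: finset.subD1set.
  - move=> j; have [ij|ij] := eqVneq i j; last by rewrite /w' dfwith_out.
    by case: j / ij; rewrite /w' dfwith_in.
  - move=> j jJ; rewrite /w' dfwith_out; first exact: Jw.
    by apply: contraNneq iJ => ->.
  - by rewrite rcons_uniq iT.
  - move=> j; rewrite mem_rcons inE TE !inE negb_and negbK.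
    by case: (eqVneq j i) => [->|_] /=; rewrite ?iJ // andbC.
  - by rewrite mapE; apply/indep_rcons; split.
  - rewrite mapE; rewrite (_ : _ `|` _ = v |` A) //.
    apply/seteqP; split=> y /=; rewrite mem_rcons inE.
      by case=> [yb|/orP[/eqP ->|yT]]; [right; left | left | right; right].
    by case=> [->|[yb|yT]]; [right; rewrite eqxx | left | right; rewrite yT orbT].
have [|q qE] := @polynomial_on_box w (dfwith w sec) Ew.
  move=> j; have [ij|ij] := eqVneq i j; last by rewrite dfwith_out.
  by case: j / ij; rewrite dfwith_in.
pose line (lam : C) j := if j == i then lam else 0.
have w'E lam : f (w' lam) = q.@[line lam].
  rewrite -qE; congr f; apply: functional_extensionality_dep => j; rewrite /line /w'.
  have [ij|ij] := eqVneq i j; first by case: j / ij; rewrite !dfwith_in.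
  by rewrite !dfwith_out // scale0r add0r.
pose r := mmap polyC (fun j => if j == i then 'X else 0) q.
have rE lam : r.[lam] = f (w' lam).
  rewrite w'E -[r.[lam]]/(horner_eval lam r) /r (rmorph_mmap _ _ (horner_eval lam)).
  apply: eq_mmap => [d|j] /=; rewrite /horner_eval ?hornerC //.
  by rewrite /line; case: ifP; rewrite ?hornerX ?horner0.
have r0 : r = 0.
  apply/eqP; apply: contraTT isT => r0.
  have : r * \prod_(lam <- bad) ('X - lam%:P) != 0.
    by rewrite mulf_neq0 // monic_neq0 // monic_prod_XsubC.
  move=> /closed_nonrootP[lam]; rewrite rootM negb_or root_prod_XsubC.
  by case/andP=> /negP rlam /fw'; rewrite -rE => /eqP.
have <- : w' 0 = w; last by rewrite -rE r0 horner0.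
apply: functional_extensionality_dep => j; rewrite /w'.
have [ij|ij] := eqVneq i j; last by rewrite dfwith_out.
by case: j / ij; rewrite dfwith_in scale0r add0r.
Qed.

End PolynomialFunction.
End Selection.

Lemma vanish_beyond_essential (R : realType) (n : nat)
    (X : set (projective_space R n)) (k : nat) (E : 'I_k -> linear_series X)
    (J : {set 'I_k}) (f : system E -> R[i]) x0 (w : system E) :
  quasi_projective X -> irreducible zclosed X ->
  (forall i, base_point_free (E i)) ->
  (forall J', defect E J <= defect E J') ->
  polynomial_function f -> (forall s, systems E s -> has_root s -> f s = 0) ->
  X x0 -> systems E w -> (forall j, j \in J -> vanish_at (w j) x0) -> f w = 0.
Proof.
move=> X_qp X_irr bpf Jmin f_poly f0 Xx0 Ew Jx0.
have [c [a [e [adE Dx0]]]] := adapted_chart_exists X_qp X_irr bpf Xx0.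
have [K [ev [ev0 evS]]] := chart_field c.
have [b [ind sp bJ dJ]] := defect_basis X_irr bpf adE ev0 evS J.
have hJ := hall_of_defect X_irr bpf adE ev0 evS Jmin ind sp bJ dJ.
apply: (generic_vanish adE ev0 evS f_poly f0 (S := ~: J) (T := [::]) Dx0 sp) => //.
- by move=> j; rewrite !inE andbN.
- rewrite (_ : _ `|` _ = [set` b]) //.
  by apply/seteqP; split=> x; [case | left].
Qed.

(** * Subsystems *)

Section Gluing.
Context {R : realType} {n : nat} {X : set (projective_space R n)}.
Local Notation C := R[i].
Variables (I : finType) (E : I -> linear_series X) (J : {set I}).
Local Notation EJ := (subcollection E J).

Definition glue (s : system EJ) (r : system E) : system E := fun i =>
  match @idP (i \in J) with
  | ReflectT iJ => s (exist _ i iJ)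
  | ReflectF _ => r i
  end.
Arguments glue : clear implicits.

Lemma glue_in s r i (iJ : i \in J) : glue s r i = s (exist _ i iJ).
Proof.
rewrite /glue; case: {-}_ / idP => [iJ'|//].
by rewrite (bool_irrelevance iJ' iJ).
Qed.

Lemma glue_out s r i : i \notin J -> glue s r i = r i.
Proof. by rewrite /glue; case: {-}_ / idP => // iJ /negP. Qed.

Lemma glue_subsystem (w : system E) : glue (subsystem J w) w = w.
Proof.
apply: functional_extensionality_dep => i.
by have [iJ|iJ] := boolP (i \in J); [rewrite glue_in | rewrite glue_out].
Qed.

Lemma glue_systems s r : systems EJ s -> systems E r -> systems E (glue s r).
Proof.
move=> Es Er i; have [iJ|iJ] := boolP (i \in J); last by rewrite glue_out.
by rewrite glue_in; exact: (Es (exist _ i iJ)).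
Qed.

Lemma polynomial_subsystem (f : system EJ -> C) :
  polynomial_function f -> polynomial_function (fun w : system E => f (subsystem J w)).
Proof.
move=> [m [p [ix [phi [hphi fE]]]]].
exists m, p, (fun l => val (ix l)), phi; split=> // s Es.
by rewrite fE // => i; exact: Es.
Qed.

(** The coordinates of the components outside J become constants, and the variables
    are renumbered. *)
Lemma polynomial_glue (f : system E -> C) (r : system E) :
  polynomial_function f -> systems E r ->
  polynomial_function (fun s : system EJ => f (glue s r)).
Proof.
move=> [m [p [ix [phi [hphi fE]]]]] Er.
pose L : finType := {l : 'I_m | ix l \in J}.
pose old (l : 'I_#|L|) : 'I_m := val (enum_val l : L).
pose ix' (l : 'I_#|L|) : {i | i \in J} := exist _ (ix (old l)) (valP (enum_val l : L)).
pose q := mmap (@mpolyC #|L| C) (fun l =>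
  match @idP (ix l \in J) with
  | ReflectT lJ => 'X_(enum_rank (exist _ l lJ : L))
  | ReflectF _ => (phi l (r (ix l)))%:MP
  end) p.
exists #|L|, q, ix', (fun l => phi (old l)); split=> [l|s Es]; first exact: hphi.
rewrite fE; last exact: glue_systems.
rewrite /q (rmorph_mmap _ _ (meval _)); apply: eq_mmap => [d|l] /=.
  by rewrite mevalC.
case: {-}_ / idP => [lJ|/negP lJ]; last by rewrite mevalC glue_out.
rewrite mevalXU /ix' /old; set u := enum_val _.
have -> : u = exist _ l lJ by rewrite /u enum_rankK.
by rewrite glue_in /=; congr (phi l (s (exist _ _ _))); exact: bool_irrelevance.
Qed.

End Gluing.

Arguments glue {R n X I E J} s r i.

Theorem theorem2p5 (R : realType) (n : nat) (X : set (projective_space R n))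
    (X_qproj : quasi_projective X) (X_irr : irreducible zclosed X)
    (k : nat) (E : 'I_k -> linear_series X)
    (E_bpf : forall i : 'I_k, base_point_free (E i))
    (E_over : overdetermined E)
    (J : {set 'I_k}) (J_ess : essential E J) :
  consistency_variety E =
  systems E `&` subsystem J @^-1` consistency_variety (subcollection E J).
Proof.
have Jmin J' : defect E J <= defect E J'.
  by have [-> _] := J_ess; exact: min_defect_le.
apply/seteqP; split=> [w Ew|w [Ew EwJ] _ [[S [S_poly ->]] rootS]].
  split=> [|_ [[S [S_poly ->]] rootS]].
    apply: Ew; split=> [|s [] //]; exists set0; split=> //.
    by apply/seteqP; split=> s; [split | case].
  (* A closed condition on the part indexed by J is closed on all systems. *)
  have /= [] := Ew (systems E `&`
    [set s | forall f, [set g | exists2 f', S f' & g = f' \o subsystem J] f -> f s = 0]).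
    split.
      exists [set g | exists2 f', S f' & g = f' \o subsystem J]; split=> //.
      by move=> _ [f Sf ->]; apply: polynomial_subsystem; exact: S_poly.
    move=> s [Es [x Xx rx]]; split=> // _ [f Sf ->] /=.
    have [|_ h] := rootS (subsystem J s).
      by split=> [j|]; [exact: (Es (val j)) | exists x => // j; exact: rx].
    exact: h.
  move=> Ew' hS; split=> [j|f Sf]; first exact: (Ew' (val j)).
  by apply: (hS (f \o subsystem J)); exists f.
split=> // f Sf.
have f0 s : systems E s -> has_root s -> f s = 0.
  by move=> Es rs; have [_ h] := rootS s (conj Es rs); exact: h.
have f_poly := S_poly f Sf.
(* With the other components fixed to those of w, f is a polynomial function of
   the part indexed by J. *)
have /= [|_ h] := EwJ (systems (subcollection E J) `&`
  [set s | forall g, (fun g => g = fun s => f (glue s w)) g -> g s = 0]).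
  split.
    exists (fun g => g = fun s => f (glue s w)); split=> // _ ->.
    exact: polynomial_glue.
  move=> s [Es [x Xx rx]]; split=> // _ ->.
  apply: (vanish_beyond_essential X_qproj X_irr E_bpf Jmin f_poly f0 Xx).
    exact: glue_systems.
  by move=> j jJ; rewrite glue_in; exact: (rx (exist _ j jJ)).
have := h _ erefl; by rewrite glue_subsystem.
Qed.
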